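(* For $0\le r\le\min\{m,n\}$, \[\mathrm{grFrob}(R(\mathcal{Z}_{n,m,r});q)=\sum_{d=0}^{r}q^d\,\{SF_d-SF_{d-1}\}_{\lambda_1\le n+m-d-r},\] with the convention $SF_{-1}=0$. Equivalently, $\mathrm{Frob}(R(\mathcal{Z}_{n,m,r})_d)=\{SF_d-SF_{d-1}\}_{\lambda_1\le n+m-d-r}$ for $0\le d\le r$, and $R(\mathcal{Z}_{n,m,r})_d=0$ for $d>r$.
   Context: Fix positive integers $n,m$. $\mathbb{C}[\mathbf{x}_{n\times m}]$ is the polynomial ring in variables $x_{i,j}$ ($1\le i\le n$, $1\le j\le m$); $\mathfrak{S}_n\times\mathfrak{S}_m$ acts by $(g,h)\cdot x_{i,j}=x_{g(i),h(j)}$, i.e. by permuting rows and columns of matrices. For finite stable $\mathcal{Z}\subseteq\mathrm{Mat}_{n\times m}(\mathbb{C})$, $\mathbf{I}(\mathcal{Z})$ is the vanishing ideal, $\mathrm{gr}\,\mathbf{I}(\mathcal{Z})$ is the ideal generated by the top-degree homogeneous components of its nonzero elements, and $R(\mathcal{Z})=\mathbb{C}[\mathbf{x}_{n\times m}]/\mathrm{gr}\,\mathbf{I}(\mathcal{Z})$, a graded $\mathfrak{S}_n\times\mathfrak{S}_m$-module. $\mathcal{Z}_{n,m,r}$ is the set of rook placements with exactly $r$ rooks, i.e. $n\times m$ $0/1$ matrices with exactly $r$ ones and at most one $1$ in each row and column. For an $\mathfrak{S}_n\times\mathfrak{S}_m$-module $V\cong\bigoplus c_{\lambda,\mu}V^\lambda\otimes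 V^\mu$, $\mathrm{Frob}(V)=\sum c_{\lambda,\mu}s_\lambda\otimes s_\mu$; for graded $V=\bigoplus_d V_d$, $\mathrm{grFrob}(V;q)=\sum_d q^d\mathrm{Frob}(V_d)$. $SF_d:=\sum_{\mu\vdash d}(s_\mu h_{n-d})\otimes(s_\mu h_{m-d})$ ($s$ Schur, $h$ complete homogeneous). For $F=\sum c_{\lambda,\mu}s_\lambda\otimes s_\mu$, $\{F\}_{\lambda_1\le L}:=\sum_{\lambda_1\le L,\ \mu_1\le L}c_{\lambda,\mu}s_\lambda\otimes s_\mu$. *)

(* Defs.v *)
From HB Require Import structures.
From mathcomp Require Import all_boot all_order all_algebra all_fingroup.
From mathcomp Require Import mpoly.
From Stdlib Require Import ClassicalEpsilon.

Set Implicit Arguments.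
Unset Strict Implicit.
Unset Printing Implicit Defensive.

Import Order.TTheory GRing.Theory Num.Theory.
Local Open Scope ring_scope.

Definition is_part (d : nat) (l : seq nat) : bool :=
  [&& sorted geq l, all (fun a => 0 < a)%N l & sumn l == d].

(* duplicate-free list of all partitions of d (every partition of d has at
   most d parts, each at most d) *)
Definition partitions (d : nat) : seq (seq nat) :=
  undup (filter (is_part d)
    (map (fun t : d.-tuple 'I_d.+1 => filter (fun a : nat => (0 < a)%N) (map (@nat_of_ord _) (tval t)))
         (enum {: d.-tuple 'I_d.+1}))).

Definition part1 (l : seq nat) : nat := head 0%N l.

Definition incell (l : seq nat) (i j : nat) : bool :=
  (i < size l)%N && (j < nth 0%N l i)%N.

Definition olab (N : nat) (o : option 'I_N) : nat :=
  if o is Some i then (nat_of_ord i).+1 else 0%N.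

(* semistandard Young tableaux of shape l with entries in 'I_N; a filling is a
   function on a box 'I_B * 'I_B (B large enough to contain the diagram) that is
   None outside the diagram and Some label inside it *)
Definition is_ssyt (l : seq nat) (N B : nat)
    (T : {ffun 'I_B * 'I_B -> option 'I_N}) : bool :=
  [forall c : 'I_B * 'I_B, incell l c.1 c.2 == (T c != None)] &&
  [forall c1 : 'I_B * 'I_B, forall c2 : 'I_B * 'I_B,
     (incell l c1.1 c1.2 && incell l c2.1 c2.2) ==>
     ((((c1.1 == c2.1 :> nat) && (c1.2 <= c2.2)%N) ==> (olab (T c1) <= olab (T c2))%N) &&
      (((c1.2 == c2.2 :> nat) && (c1.1 < c2.1)%N) ==> (olab (T c1) < olab (T c2))%N))].

Definition schur (R : comRingType) (N : nat) (x : 'I_N -> R) (l : seq nat) : R :=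
  let B := (size l + sumn l)%N in
  \sum_(T : {ffun 'I_B * 'I_B -> option 'I_N} | is_ssyt l T)
     \prod_(c : 'I_B * 'I_B | incell l c.1 c.2)
        (if T c is Some i then x i else 1).

Definition hcomp (R : comRingType) (N : nat) (x : 'I_N -> R) (k : nat) : R :=
  \sum_(t : k.-tuple 'I_N | sorted (fun a b : 'I_N => (a <= b)%N) t)
     \prod_(i <- t) x i.

(* The ring of "symmetric functions tensor symmetric functions":        *)
(* polynomials in x_0..x_{n-1}, y_0..y_{m-1}; s_a (x) s_b is s_a(x) s_b(y) *)

Definition SymT (C : comRingType) (n m : nat) := {mpoly C[n + m]}.

Definition xv (C : comRingType) (n m : nat) (i : 'I_n) : SymT C n m :=
  'X_(lshift m i).
Definition yv (C : comRingType) (n m : nat) (j : 'I_m) : SymT C n m :=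
  'X_(rshift n j).

Definition SF (C : comRingType) (n m d : nat) : SymT C n m :=
  \sum_(mu <- partitions d)
     (schur (@xv C n m) mu * hcomp (@xv C n m) (n - d)) *
     (schur (@yv C n m) mu * hcomp (@yv C n m) (m - d)).

Definition SFprev (C : comRingType) (n m d : nat) : SymT C n m :=
  if d is d'.+1 then SF C n m d' else 0.

(* Schur coefficients: some family c with F = sum_{lam |- n, mu |- m} c lam mu
   s_lam (x) s_mu (unique by linear independence of these products, which holds
   since n (resp. m) variables suffice for degree-n (resp. m) symmetric
   functions). *)
Definition schur_expansion (C : comRingType) (n m : nat) (F : SymT C n m)
    (c : seq nat -> seq nat -> C) : Prop :=
  F = \sum_(lam <- partitions n) \sum_(mu <- partitions m)
        c lam mu *: (schur (@xv C n m) lam * schur (@yv C n m) mu).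

Definition schur_coef (C : comRingType) (n m : nat) (F : SymT C n m) :
    seq nat -> seq nat -> C :=
  epsilon (inhabits (fun _ _ => 0)) (schur_expansion F).

Definition trunc (C : comRingType) (n m : nat) (L : nat) (F : SymT C n m) :
    SymT C n m :=
  \sum_(lam <- partitions n) \sum_(mu <- partitions m |
          (part1 lam <= L)%N && (part1 mu <= L)%N)
     schur_coef F lam mu *: (schur (@xv C n m) lam * schur (@yv C n m) mu).

Definition pcyc (R : comRingType) (N : nat) (x : 'I_N -> R) (g : 'S_N) : R :=
  \prod_(c in porbits g) \sum_(i < N) x i ^+ #|c|.

Definition Frob (C : fieldType) (n m : nat) (chi : 'S_n -> 'S_m -> C) :
    SymT C n m :=
  (n`! * m`!)%:R^-1 *:
    \sum_(g : 'S_n) \sum_(h : 'S_m)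
       chi g h *: (pcyc (@xv C n m) g * pcyc (@yv C n m) h).

(* variables x_{i,j} indexed by 'I_K, K = #|'I_n * 'I_m|, via enum_rank *)
Definition NV (n m : nat) : nat := #|{: 'I_n * 'I_m}|.
Definition Poly (C : comRingType) (n m : nat) := {mpoly C[NV n m]}.

Definition vidx (n m : nat) (i : 'I_n) (j : 'I_m) : 'I_(NV n m) :=
  enum_rank (i, j).
Definition vpos (n m : nat) (v : 'I_(NV n m)) : 'I_n * 'I_m := enum_val v.

Definition rooks (n m r : nat) : {set 'M[bool]_(n, m)} :=
  [set A : 'M[bool]_(n, m) |
    [&& #|[set ij : 'I_n * 'I_m | A ij.1 ij.2]| == r,
        [forall i, #|[set j | A i j]| <= 1]%N &
        [forall j, #|[set i | A i j]| <= 1]%N]].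

Definition pt (C : comRingType) (n m : nat) (A : 'M[bool]_(n, m)) :
    'I_(NV n m) -> C :=
  fun v => ((A (vpos v).1 (vpos v).2 : nat)%:R).

Definition inI (C : comRingType) (n m r : nat) (f : Poly C n m) : Prop :=
  forall A, A \in rooks n m r -> meval (pt C A) f = 0.

Definition topc (C : comRingType) (k : nat) (f : {mpoly C[k]}) : {mpoly C[k]} :=
  \sum_(t <- msupp f | mdeg t == (msize f).-1) f@_t *: 'X_[t].

Definition in_grI (C : comRingType) (n m r : nat) (f : Poly C n m) : Prop :=
  exists s : seq (Poly C n m * Poly C n m),
    (forall p, List.In p s -> exists g, inI r g /\ g != 0 /\ p.2 = topc g) /\
    f = \sum_(p <- s) p.1 * p.2.

Definition mons (k d : nat) : seq 'X_{1..k} :=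
  [seq val t | t <- enum {: 'X_{1..k < d.+1}} & mdeg (val t) == d].

Definition Dim (k d : nat) : nat := size (mons k d).

Definition coords (C : comRingType) (k d : nat) (f : {mpoly C[k]}) :
    'rV[C]_(Dim k d) :=
  \row_(i < Dim k d) f@_(nth 0%MM (mons k d) i).

Definition spanP (C : fieldType) (D : nat) (S : 'rV[C]_D -> Prop) : 'M[C]_D :=
  epsilon (inhabits 0)
    (fun U : 'M[C]_D => (forall v, S v -> (v <= U)%MS) /\
       (forall U' : 'M[C]_D, (forall v, S v -> (v <= U')%MS) -> (U <= U')%MS)).

Definition grI_d (C : fieldType) (n m r d : nat) : 'M[C]_(Dim (NV n m) d) :=
  spanP (fun v => exists f : Poly C n m,
           [/\ in_grI r f, f \is [in C[NV n m], d.-homog] & v = coords d f]).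

Definition sigv (n m : nat) (g : 'S_n) (h : 'S_m) (v : 'I_(NV n m)) : 'I_(NV n m) :=
  vidx (g (vpos v).1) (h (vpos v).2).

(* (g,h) acting on monomials: x^t |-> prod_v x_{sig v}^{t v} *)
Definition actm (n m : nat) (g : 'S_n) (h : 'S_m) (t : 'X_{1..NV n m}) :
    'X_{1..NV n m} :=
  [multinom t (sigv g^-1 h^-1 v) | v < NV n m].

(* matrix of the action of (g,h) on C[x]_d (row-vector convention:
   coords ((g,h).f) = coords f *m actmx g h) *)
Definition actmx (C : comRingType) (n m d : nat) (g : 'S_n) (h : 'S_m) :
    'M[C]_(Dim (NV n m) d) :=
  \matrix_(i, j) ((actm g h (nth 0%MM (mons (NV n m) d) i)
                    == nth 0%MM (mons (NV n m) d) j)%:R).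

(* trace of a matrix A restricted to (a stable) row space U *)
Definition trace_on (C : fieldType) (D : nat) (U A : 'M[C]_D) : C :=
  \tr (row_base U *m A *m pinvmx (row_base U)).

(* character of R(Z)_d = C[x]_d / (gr I(Z))_d *)
Definition chiR (C : fieldType) (n m r d : nat) (g : 'S_n) (h : 'S_m) : C :=
  \tr (actmx C d g h) - trace_on (grI_d C n m r d) (actmx C d g h).

Definition FrobR (C : fieldType) (n m r d : nat) : SymT C n m :=
  Frob (chiR C r d).

(* Main.v *)
Require Import Defs.
From HB Require Import structures.
From mathcomp Require Import all_boot all_order all_algebra all_fingroup.
From mathcomp Require Import all_field all_character.
From mathcomp Require Import zify ring.
From mathcomp Require Import mpoly.
From Stdlib Require Import ClassicalEpsilon.

Set Implicit Arguments.
Unset Strict Implicit.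
Unset Printing Implicit Defensive.

Import Order.TTheory GRing.Theory Num.Theory.
Local Open Scope ring_scope.

(** Let [F_d] be the space of functions on the [r]-rook placements spanned by the
    indicators [P <= A] with [P] a [d]-rook placement, that is, the row space of
    the inclusion matrix between [d]- and [r]-placements.  A homogeneous [f] of
    degree [d] lies in [gr I] iff its restriction lies in [F_(d-1)], so the
    character of [R_d] is that of [F_d] minus that of [F_(d-1)].

    Write [a_d] for the multiplicity of [s_la (x) s_mu] in the permutation module
    on [d]-placements and [M] for [max (la_1, mu_1)].  By Pieri's rule [a_d]
    counts the [nu] of size [d] such that [la/nu] and [mu/nu] are horizontal
    strips; the parts of such a [nu] range over independent intervals, and
    reflecting all of them gives [a_d = a_(n + m - M - d)].

    If [|J| + d + r > n + m], symmetrizing over a set [J] of rows (or columns)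
    maps [F_d] into [F_(d-1)], because a product of [1 - u] over the columns
    involved vanishes identically.  Hence the multiplicities in [F_d] and
    [F_(d-1)] agree when [M + d + r > n + m].  For [M + d + r <= n + m] put
    [d' = n + m - M - d >= r].  Then [F_d] inside the functions on
    [d']-placements has multiplicity [a_d' = a_d], so the inclusion map
    from [d]- to [d']-placements is injective on this isotypic component; it
    factors through the [r]-placements, so the one from [d] to [r] is injective
    there as well, and [F_d] has multiplicity [a_d].

    Multiplicities are scalar products with the class functions [psi la] given by
    [p_g = sum_la psi la g * s_la].  These are integral combinations of
    permutation characters of norm one, hence irreducible up to sign. *)

(** * Traces on stable subspaces *)

(** No Specht module is built. What matters about [psi la * psi mu] is that its scalar products with
    characters all share one sign, so two of them adding up to zero both vanish; injectivity on an
    isotypic component is expressed as the vanishing of such a coefficient for the character of a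
    kernel. If [d'] exceeds [min(n, m)] there are no [d']-placements to compare with, but then the
    reflected multiplicity is zero, and so is [a_d]. Symmetrization reaches Schur coefficients
    through monomials: the coefficient of [x^al y^be] in a Frobenius image sums the character over
    stabilizers of colourings whose first colour class has [al_1] elements ([be_1] for the columns),
    and the Kostka matrix is unitriangular with nonzero entries only where [al_1 <= la_1]. Lower
    bounds on the first part therefore pass from monomials to Schur polynomials. Character theory
    takes place over [algC]; the inclusion and permutation matrices have rational entries, which
    carries the multiplicities to the ground field. *)

Section TraceOn.
Variable F : fieldType.

(** Two bases of one row space differ by [X] and [Y] with [Y *m X = 1], and the trace is invariant
    under this change of basis; so [trace_on] can be computed in any basis, not only in
    [row_base U]. *)
Lemma trace_onE (D k : nat) (U A : 'M[F]_D) (B : 'M[F]_(k, D)) (M : 'M[F]_k) :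
  row_free B -> (B :=: U)%MS -> B *m A = M *m B -> trace_on U A = \tr M.
Proof.
move=> freeB eqBU BA; rewrite /trace_on; set R := row_base U.
have freeR : row_free R by exact: row_base_free.
have eqRB : (R :=: B)%MS by apply: eqmx_trans (eq_row_base U) (eqmx_sym eqBU).
clearbody R.
have /submxP [X RX] : (R <= B)%MS by rewrite eqRB.
have /submxP [Y BY] : (B <= R)%MS by rewrite eqRB.
have YX : Y *m X = 1%:M.
  by apply: (row_free_inj freeB); rewrite mul1mx -mulmxA -RX -BY.
have -> : R *m A *m pinvmx R = X *m M *m Y.
  by rewrite {1}RX -(mulmxA X B A) BA {1}BY (mulmxA X) (mulmxA _ Y) mulmxKp.
by rewrite mxtrace_mulC mulmxA YX mul1mx.
Qed.

Lemma trace_on_eqmx (D : nat) (U V A : 'M[F]_D) :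
  stablemx U A -> (U :=: V)%MS -> trace_on U A = trace_on V A.
Proof.
move=> stU eqUV.
have stV : stablemx V A by rewrite (eqmxMr A (eqmx_sym eqUV)) -eqUV.
have /submxP [M RM] : (row_base V *m A <= row_base V)%MS.
  by rewrite eq_row_base (eqmxMr A (eq_row_base V)).
have fR : row_free (row_base V) by exact: row_base_free.
rewrite (trace_onE fR (eq_row_base V) RM).
exact: (trace_onE fR (eqmx_trans (eq_row_base V) (eqmx_sym eqUV)) RM).
Qed.

(* The rank-nullity theorem for traces. *)
Lemma trace_on_exact (D D' : nat) (U K A : 'M[F]_D) (V B : 'M[F]_D')
    (E : 'M[F]_(D, D')) :
  stablemx U A -> U *m A *m E = U *m E *m B ->
  (K :=: U :&: kermx E)%MS -> (V :=: U *m E)%MS ->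
  trace_on U A = trace_on K A + trace_on V B.
Proof.
move=> stU UAE eqK eqV.
have KU : (K <= U)%MS by rewrite eqK capmxSl.
have KE : K *m E = 0 by apply/eqP; rewrite -sub_kermx eqK capmxSr.
have UE0 (k : nat) (X : 'M_(k, D)) : (X <= U)%MS -> X *m A *m E = X *m E *m B.
  by case/submxP=> Y ->; rewrite -!mulmxA !(mulmxA U) UAE !mulmxA.
have stK : (K *m A <= K)%MS.
  rewrite eqK sub_capmx (submx_trans (submxMr A KU) stU) /=.
  by rewrite sub_kermx UE0 // KE mul0mx.
have stV : (V *m B <= V)%MS.
  rewrite (eqmxMr B eqV) -UAE eqV.
  exact: submxMr.
have f1 := row_base_free K; have e1 := eq_row_base K.
have fS := row_base_free V; have eS := eq_row_base V.
set R1 := row_base K in f1 e1; set S := row_base V in fS eS.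
clearbody R1 S.
have /submxP [X SX] : (S <= U *m E)%MS by rewrite eS eqV.
(* [R2] lifts the basis [S] of the image back into [U]. *)
set R2 := X *m U; have R2E : R2 *m E = S by rewrite /R2 -mulmxA.
have R1E : R1 *m E = 0.
  by apply/eqP; rewrite -sub_kermx e1 eqK capmxSr.
have R2U : (R2 <= U)%MS by rewrite submxMl.
have /submxP [M1 R1A] : (R1 *m A <= R1)%MS.
  by rewrite e1 (eqmxMr A e1).
have /submxP [M2 SB] : (S *m B <= S)%MS.
  by rewrite eS (eqmxMr B eS).
have kerR k (Y : 'M_(k, D)) : (Y <= U)%MS -> Y *m E = 0 -> (Y <= R1)%MS.
  by move=> YU YE; rewrite e1 eqK sub_capmx YU sub_kermx YE eqxx.
have /submxP [N R2A] : (R2 *m A - M2 *m R2 <= R1)%MS.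
  apply: kerR; last by rewrite mulmxBl UE0 // -(mulmxA M2) R2E SB subrr.
  rewrite addmx_sub ?eqmx_opp ?(submx_trans (submxMl _ _) R2U) //.
  exact: submx_trans (submxMr A R2U) stU.
(* A basis of [U] adapted to [E]: first a basis of the kernel part, then the lift of a basis of the
   image. In it [A] is block triangular with diagonal blocks [M1] and [M2]. *)
set R := col_mx R1 R2.
have fR : row_free R.
  apply/row_freeP.
  have /row_freeP [Y1 y1] := f1; have /row_freeP [Y2 y2] := fS.
  exists (row_mx (Y1 - E *m Y2 *m R2 *m Y1) (E *m Y2)).
  rewrite mul_col_row !mulmxBr y1 !mulmxA R1E !mul0mx R2E y2.
  by rewrite mul1mx subrr subr0 scalar_mx_block.
have eqR : (R :=: U)%MS.
  apply/eqmxP/andP; split.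
    by rewrite col_mx_sub R2U andbT e1.
  have /submxP [Z UEZ] : (U *m E <= S)%MS by rewrite eS eqV.
  have /submxP [T eT] : (U - Z *m R2 <= R1)%MS.
    apply: kerR; last by rewrite mulmxBl -mulmxA R2E -UEZ subrr.
    by rewrite addmx_sub ?eqmx_opp // (submx_trans (submxMl _ _) R2U).
  apply/submxP; exists (row_mx T Z).
  by rewrite mul_row_col -eT subrK.
have RA : R *m A = block_mx M1 0 N M2 *m R.
  rewrite mul_col_mx mul_block_col mul0mx addr0 -R1A; congr col_mx.
  by rewrite -R2A subrK.
rewrite (trace_onE fR eqR RA) mxtrace_block.
by rewrite -(trace_onE f1 e1 R1A) -(trace_onE fS eS SB).
Qed.

Lemma trace_on_idem (D : nat) (e A : 'M[F]_D) :
  e *m e = e -> stablemx e A -> trace_on e A = \tr (e *m A).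
Proof.
move=> ee st; rewrite /trace_on; set R := row_base e; set C := col_base e.
have CR : C *m R = e by exact: mulmx_base.
have fR : row_free R by exact: row_base_free.
have Re : R *m e = R.
  have /submxP [X ->] : (R <= e)%MS by rewrite eq_row_base.
  by rewrite -mulmxA ee.
have RC : R *m C = 1%:M.
  by apply: (row_free_inj fR); rewrite mul1mx -mulmxA CR Re.
rewrite -[X in \tr X]mulmx1 -RC mulmxA mulmxKpV.
  by rewrite mxtrace_mulC mulmxA CR.
by rewrite eq_row_base (eqmxMr A (eq_row_base e)).
Qed.

Lemma trace_on0 (D : nat) (A : 'M[F]_D) : trace_on 0 A = 0.
Proof. by rewrite trace_on_idem ?mul0mx ?sub0mx ?mxtrace0. Qed.

Lemma trace_on_sum (D : nat) (U : 'M[F]_D) (I : finType) (P : pred I)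
    (A : I -> 'M[F]_D) :
  trace_on U (\sum_(i | P i) A i) = \sum_(i | P i) trace_on U (A i).
Proof. by rewrite /trace_on mulmx_sumr mulmx_suml raddf_sum. Qed.

(** [A] acts as zero on the quotient of [U] by [V], realised as the image under [cokermx V]. This is
    how a symmetrizer that lowers the degree identifies traces on two steps of the filtration. *)
Lemma trace_on_sub (D : nat) (U V A : 'M[F]_D) :
  stablemx U A -> (V <= U)%MS -> (U *m A <= V)%MS ->
  trace_on U A = trace_on V A.
Proof.
move=> stU VU UAV.
have e0 : U *m A *m cokermx V = U *m cokermx V *m (0 : 'M_D).
  by rewrite mulmx0; apply/eqP; rewrite -submxE.
rewrite (@trace_on_exact _ _ U V A (U *m cokermx V) 0 _ stU e0) //.
  by rewrite {2}/trace_on mulmx0 mul0mx mxtrace0 addr0.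
apply/eqmxP; rewrite sub_capmx VU sub_kermx /=.
rewrite mulmx_coker eqxx /=; apply/rV_subP => v; rewrite sub_capmx => /andP[_].
by rewrite sub_kermx submxE.
Qed.

End TraceOn.

Lemma trace_on_map (F F' : fieldType) (f : {rmorphism F -> F'}) (D : nat)
    (U A : 'M[F]_D) :
  stablemx U A -> trace_on (map_mx f U) (map_mx f A) = f (trace_on U A).
Proof.
move=> st.
have /submxP [M RM] : (row_base U *m A <= row_base U)%MS.
  by rewrite eq_row_base (eqmxMr A (eq_row_base U)).
have fR : row_free (row_base U) by exact: row_base_free.
rewrite (trace_onE fR (eq_row_base U) RM).
rewrite (@trace_onE _ _ _ (map_mx f U) (map_mx f A) (map_mx f (row_base U))
  (map_mx f M)) ?trace_map_mx //.
- by rewrite /row_free mxrank_map.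
- by apply/eqmxP; rewrite !map_submx; apply/eqmxP; exact: eq_row_base.
- by rewrite -!map_mxM RM.
Qed.

(** * Partitions and horizontal strips *)

Section Partitions.
Local Open Scope nat_scope.

Definition ispart (l : seq nat) : bool := is_part (sumn l) l.

Lemma is_partE d l : is_part d l = ispart l && (sumn l == d).
Proof. by rewrite /ispart /is_part eqxx andbT andbA. Qed.

Lemma ispart_pos l i : ispart l -> i < size l -> 0 < nth 0 l i.
Proof. by case/and3P=> _ /(all_nthP 0) h _ /h. Qed.

Lemma ispart_nth_le l i : ispart l -> nth 0 l i.+1 <= nth 0 l i.
Proof.
case/and3P=> s _ _; case: (ltnP i.+1 (size l)) => [h|h]; last first.
  by rewrite nth_default.
by have /(sortedP 0) /(_ i h) := s.
Qed.

Lemma ispart_nth_mono l i j : ispart l -> i <= j -> nth 0 l j <= nth 0 l i.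
Proof.
move=> pl /subnKC <-; elim: (j - i) => [|k IH]; first by rewrite addn0.
by rewrite addnS; apply: leq_trans (ispart_nth_le _ pl) IH.
Qed.

Lemma ispart_eq l l' :
  ispart l -> ispart l' -> (forall i, nth 0 l i = nth 0 l' i) -> l = l'.
Proof.
have aux a b : ispart b -> (forall i, nth 0 a i = nth 0 b i) ->
    size b <= size a.
  move=> pb h; rewrite leqNgt; apply/negP => /(ispart_pos pb).
  by rewrite -h nth_default.
move=> pl pl' h; apply: (@eq_from_nth _ 0) => [|i _]; last exact: h.
by apply/eqP; rewrite eqn_leq !aux.
Qed.

Lemma sumn_nth l B : size l <= B -> sumn l = \sum_(i < B) nth 0 l i.
Proof.
elim: l B => [|a l IH] B /=; first by rewrite big1 // => i _; rewrite nth_nil.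
by case: B => // B /IH ->; rewrite big_ord_recl.
Qed.

Lemma ispart_size l : ispart l -> size l <= sumn l.
Proof.
case/and3P=> _ + _; elim: l => //= a l IH /andP[a0 /IH]; lia.
Qed.

Lemma nth_le_sumn l i : nth 0 l i <= sumn l.
Proof.
elim: l i => [|a l IH] [|i] //=; first exact: leq_addr.
exact: leq_trans (IH i) (leq_addl _ _).
Qed.

Lemma mem_partitions d l : (l \in partitions d) = is_part d l.
Proof.
rewrite mem_undup mem_filter; case: (boolP (is_part d l)) => //= pl.
move: (pl); rewrite is_partE => /andP[pl' /eqP sd].
have hsz : size l <= d by rewrite -sd ispart_size.
(* The enumerated tuple that produces [l] is [l] padded with zeros to length [d]. *)
pose s := mkseq (fun i => inord (nth 0 l i) : 'I_d.+1) d.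
have ss : size s == d by rewrite size_mkseq.
apply/mapP; exists (Tuple ss); first by rewrite mem_enum.
have -> : map (@nat_of_ord _) s = l ++ nseq (d - size l) 0.
  apply: (@eq_from_nth _ 0) => [|i].
    by rewrite size_map size_mkseq size_cat size_nseq subnKC.
  rewrite size_map size_mkseq => hi.
  rewrite (nth_map ord0) ?size_mkseq // nth_mkseq // inordK; last first.
    by rewrite ltnS -sd nth_le_sumn.
  by rewrite nth_cat nth_nseq; case: ltnP => // /(nth_default 0) ->; case: ifP.
rewrite filter_cat (eq_in_filter (a2 := predT)); last first.
  by move=> a; case/and3P: pl => _ /allP h _ /h.
by rewrite filter_predT; elim: (d - size l) => [|k IH] //=; rewrite cats0.
Qed.

Lemma partitionsP d l : reflect (ispart l /\ sumn l = d) (l \in partitions d).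
Proof.
rewrite mem_partitions is_partE.
by apply: (iffP andP) => -[pl /eqP e].
Qed.

Lemma partitions_uniq d : uniq (partitions d).
Proof. exact: undup_uniq. Qed.

Lemma partitions0 : partitions 0 = [:: [::]].
Proof.
apply: perm_small_eq => //; apply: uniq_perm (partitions_uniq 0) _ _ => // l.
rewrite inE; apply/partitionsP/eqP => [[pl sl]|-> //].
by have := ispart_size pl; rewrite sl leqn0 size_eq0 => /eqP.
Qed.

Definition parts_upto (S : nat) : seq (seq nat) :=
  flatten [seq partitions k | k <- iota 0 S.+1].

Lemma mem_parts_upto S l : (l \in parts_upto S) = ispart l && (sumn l <= S).
Proof.
apply/flatten_mapP/andP => [[k]|[pl sl]].
  by rewrite mem_iota ltnS /= => h /partitionsP [pl ->].
by exists (sumn l); [rewrite mem_iota ltnS | apply/partitionsP].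
Qed.

Lemma big_parts_upto (R : Type) (idx : R) (op : Monoid.law idx) S
    (P : pred (seq nat)) (F : seq nat -> R) :
  \big[op/idx]_(l <- parts_upto S | P l) F l =
  \big[op/idx]_(k < S.+1) \big[op/idx]_(l <- partitions k | P l) F l.
Proof.
rewrite big_flatten big_map -(big_mkord xpredT
  (fun k => \big[op/idx]_(l <- partitions k | P l) F l)).
by rewrite /index_iota subn0.
Qed.

Lemma parts_upto_uniq S : uniq (parts_upto S).
Proof.
rewrite /parts_upto; move: 0 S.+1 => a b; elim: b a => //= b IH a.
rewrite cat_uniq partitions_uniq IH andbT /=.
apply/hasPn => l /flatten_mapP [k]; rewrite mem_iota => /andP[ka _].
move=> /partitionsP [_ sl]; apply/negP => /partitionsP [_]; lia.
Qed.

Definition mkpart (f : nat -> nat) (B : nat) : seq nat :=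
  [seq a <- mkseq f B | 0 < a].

Lemma nth_filter_pos s i :
  sorted geq s -> nth 0 [seq a <- s | 0 < a] i = nth 0 s i.
Proof.
elim: s i => //= a s IH i pa.
case: posnP => [a0|_] /=; last first.
  by case: i => [|i] //=; apply: IH; exact: path_sorted pa.
have /all_pred1P -> : all (pred1 0) s.
  apply: sub_all (order_path_min _ pa) => [b /=|x y z /= h1 h2].
    by rewrite a0 leqn0.
  exact: leq_trans h2 h1.
rewrite a0 filter_nseq mul0n nth_nil; case: i => //= i.
by rewrite nth_nseq; case: ifP.
Qed.

Lemma mkpart_spec f B :
  (forall i, f i.+1 <= f i) -> (forall i, B <= i -> f i = 0) ->
  ispart (mkpart f B) /\ (forall i, nth 0 (mkpart f B) i = f i).
Proof.
move=> hf f0.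
have srt : sorted geq (mkseq f B).
  by apply/(sortedP 0) => i; rewrite size_mkseq => h; rewrite !nth_mkseq ?(ltnW h) //; exact: hf.
split=> [|i].
  rewrite /ispart /is_part eqxx andbT filter_all andbT.
  by apply: sorted_filter srt => a b c /= h1 h2; apply: leq_trans h2 h1.
rewrite nth_filter_pos //.
case: (ltnP i B) => h; first by rewrite nth_mkseq.
by rewrite nth_default ?size_mkseq // f0.
Qed.

(** The horizontal strip condition as interlacing of parts. Beyond both lengths all entries are
    zero, so testing a finite range makes it decidable without loss. *)
Definition hstrip (la nu : seq nat) : bool :=
  all (fun i => nth 0 la i.+1 <= nth 0 nu i <= nth 0 la i)
    (iota 0 (size la + size nu)).

Lemma hstripP la nu :
  reflect (forall i, nth 0 la i.+1 <= nth 0 nu i <= nth 0 la i) (hstrip la nu).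
Proof.
apply: (iffP allP) => [h i|h i _]; last exact: h.
case: (ltnP i (size la + size nu)) => hi; first by apply: h; rewrite mem_iota.
by rewrite !nth_default //; lia.
Qed.

Lemma hstrip_sumn la nu : ispart la -> ispart nu -> hstrip la nu ->
  sumn nu <= sumn la.
Proof.
move=> pl pn /hstripP h.
rewrite (@sumn_nth la (size la + size nu)) ?leq_addr //.
rewrite (@sumn_nth nu (size la + size nu)) ?leq_addl //.
by apply: leq_sum => i _; case/andP: (h i).
Qed.

Section Reflection.
Variables (nu rho : seq nat).
Hypotheses (pnu : ispart nu) (prho : ispart rho).

Let mx i := maxn (nth 0 nu i) (nth 0 rho i).
Let mn i := minn (nth 0 nu i) (nth 0 rho i).
Let B := size nu + size rho.

Let mx_le_mn_mx i : mn i <= mx i. Proof. rewrite /mn /mx; lia. Qed.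

Let mxB i : B <= i -> mx i = 0.
Proof. by rewrite /B /mx => h; rewrite !nth_default //; lia. Qed.

Let mnB i : B <= i -> mn i = 0.
Proof. by rewrite /B /mn => h; rewrite !nth_default //; lia. Qed.

(* Reflects each coordinate in the interval [[mx i.+1, mn i]] of values allowed
   for the [i]-th part of a common horizontal-strip subpartition. *)
Definition strip_refl (g : nat -> nat) : seq nat :=
  mkpart (fun i => mx i.+1 + mn i - g i) B.

Definition admissible (g : nat -> nat) := forall i, mx i.+1 <= g i <= mn i.

Lemma strip_refl_spec g : admissible g ->
  ispart (strip_refl g) /\
  (forall i, nth 0 (strip_refl g) i = mx i.+1 + mn i - g i).
Proof.
move=> hg; apply: mkpart_spec => i.
  have := hg i; have := hg i.+1; have := mx_le_mn_mx i.+1; lia.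
by move=> h; rewrite mxB ?mnB //; lia.
Qed.

Lemma admissibleP k :
  reflect (admissible (nth 0 k)) (hstrip nu k && hstrip rho k).
Proof.
apply: (iffP andP) => [[/hstripP h1 /hstripP h2] i|h].
  by have := h1 i; have := h2 i; rewrite /mx /mn; lia.
by split; apply/hstripP => i; have := h i; rewrite /mx /mn; lia.
Qed.

Lemma admissible_size k : ispart k -> admissible (nth 0 k) -> size k <= B.
Proof.
move=> pk ak; rewrite leqNgt; apply/negP => h.
by have := ispart_pos pk h; have := ak B; rewrite mnB //; lia.
Qed.

Lemma strip_refl_admissible g : admissible g ->
  admissible (nth 0 (strip_refl g)).
Proof.
by move=> hg i; have [_ ->] := strip_refl_spec hg; have := hg i; lia.
Qed.

(** The interval endpoints [mx i.+1] and [mn i] together exhaust the parts of [nu] and [rho] except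
    for [mx 0], the larger of the two first parts. This missing term is the origin of
    [max(la_1, mu_1)] in the truncation bound. *)
Lemma strip_refl_sumn g : admissible g ->
  sumn (strip_refl g) + \sum_(i < B) g i + mx 0 = sumn nu + sumn rho.
Proof.
move=> hg; have [_ hs] := strip_refl_spec hg.
have sB : size (strip_refl g) <= B.
  by rewrite /strip_refl /mkpart size_filter -[leqRHS](size_mkseq
     (fun i => mx i.+1 + mn i - g i)) count_size.
rewrite (sumn_nth sB) (@sumn_nth nu B) ?leq_addr // (@sumn_nth rho B) ?leq_addl //.
rewrite -!big_split /=.
have -> : \sum_(i < B) (nth 0 nu i + nth 0 rho i) = \sum_(i < B) mn i + \sum_(i < B) mx i.
  by rewrite -big_split; apply: eq_bigr => i _; rewrite /mn /mx /=; lia.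
have -> : \sum_(i < B) mx i = \sum_(i < B) mx i.+1 + mx 0.
  transitivity (\sum_(i < B.+1) mx i).
    by rewrite big_ord_recr /= (mxB (leqnn B)) addn0.
  by rewrite big_ord_recl addnC.
rewrite addnA -big_split /=; congr (_ + _).
by apply: eq_bigr => i _; rewrite hs; have := hg i; lia.
Qed.

Definition common_strips (t : nat) : nat :=
  count (fun k => hstrip nu k && hstrip rho k) (partitions t).

(** Reflection is injective and exchanges the sizes [t] and [t']; the hypothesis is symmetric in
    them, so the inequality yields an equality. *)
Lemma leq_common_strips_refl t t' :
  t + t' + mx 0 = sumn nu + sumn rho -> common_strips t <= common_strips t'.
Proof.
move=> e; rewrite /common_strips -!size_filter.
set P := fun k => _.
have hP k : k \in [seq k <- partitions t | P k] ->
    [/\ ispart k, sumn k = t & admissible (nth 0 k)].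
  by rewrite mem_filter => /andP[/admissibleP h /partitionsP[]].
rewrite -(size_map (fun k => strip_refl (nth 0 k))).
apply: uniq_leq_size.
  rewrite map_inj_in_uniq ?filter_uniq ?partitions_uniq //.
  move=> k k' /hP [pk _ ak] /hP [pk' _ ak'] eqk.
  apply: ispart_eq => // i.
  have [_ h] := strip_refl_spec ak; have [_ h'] := strip_refl_spec ak'.
  by have := h i; rewrite eqk h'; have := ak i; have := ak' i; lia.
move=> _ /mapP [k /hP [pk sk ak] ->]; have [ps _] := strip_refl_spec ak.
rewrite mem_filter; apply/andP; split.
  by apply/admissibleP; exact: strip_refl_admissible.
apply/partitionsP; split => //.
have := strip_refl_sumn ak; rewrite -(@sumn_nth k B) ?sk; first by lia.
exact: admissible_size.
Qed.

Definition common_overs (s : nat) : nat :=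
  count (fun la => hstrip la nu && hstrip la rho) (partitions s).

(** The inverse construction: below the first row stands the reflected common substrip, and the
    first row, which is bounded only from below by [mx 0], absorbs all remaining cells. *)
Let over_fun s k i :=
  if i is i'.+1 then nth 0 (strip_refl (nth 0 k)) i'
  else mx 0 + (sumn k + s - (sumn nu + sumn rho)).


Lemma over_admissible la : hstrip la nu && hstrip la rho ->
  admissible (fun i => nth 0 la i.+1).
Proof.
case/andP => /hstripP h1 /hstripP h2 i.
have := h1 i; have := h2 i; have := h1 i.+1; have := h2 i.+1; rewrite /mx /mn.
lia.
Qed.

Lemma over_sumn la : ispart la -> hstrip la nu && hstrip la rho ->
  sumn la = nth 0 la 0 + \sum_(i < B) nth 0 la i.+1.
Proof.
move=> pl h; rewrite -(big_ord_recl B (fun i => nth 0 la i)); apply: sumn_nth.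
rewrite leqNgt; apply/negP => /(ispart_pos pl); have := over_admissible h B.
by rewrite mnB // andbC; lia.
Qed.

(* The bijection behind the commutation relation of the operators adding and
   removing horizontal strips. *)
Lemma common_oversE s :
  common_overs s =
  count (fun k => (hstrip nu k && hstrip rho k) &&
                  (sumn nu + sumn rho <= sumn k + s)) (parts_upto (sumn nu)).
Proof.
rewrite /common_overs -!size_filter; set P := fun la => _; set Q := fun k => _.
have hP la : la \in [seq la <- partitions s | P la] ->
    [/\ ispart la, sumn la = s, P la & admissible (fun i => nth 0 la i.+1)].
  rewrite mem_filter => /andP[h /partitionsP[pl sl]]; split => //.
  exact: over_admissible.
have hQ k : k \in [seq k <- parts_upto (sumn nu) | Q k] ->
    [/\ ispart k, admissible (nth 0 k) & sumn nu + sumn rho <= sumn k + s].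
  by rewrite mem_filter mem_parts_upto => /andP[/andP[/admissibleP h le] /andP[]].
apply/eqP; rewrite eqn_leq; apply/andP; split.
  rewrite -(size_map (fun la => strip_refl (fun i => nth 0 la i.+1))).
  apply: uniq_leq_size => [|_ /mapP [la /hP [pl sl Pl al] ->]].
    rewrite map_inj_in_uniq ?filter_uniq ?partitions_uniq //.
    move=> la la' /hP [pl sl Pl al] /hP [pl' sl' Pl' al'] e.
    have eS i : nth 0 la i.+1 = nth 0 la' i.+1.
      have [_ h] := strip_refl_spec al; have [_ h'] := strip_refl_spec al'.
      by have := h i; rewrite e h'; have := al i; have := al' i; lia.
    apply: ispart_eq => // -[|i] //.
    have := over_sumn pl Pl; have := over_sumn pl' Pl'; rewrite sl sl'.
    have -> : \sum_(i < B) nth 0 la' i.+1 = \sum_(i < B) nth 0 la i.+1.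
      by apply: eq_bigr => i _; rewrite eS.
    by lia.
  have [ps _] := strip_refl_spec al.
  have hs := strip_refl_admissible al.
  have sS := strip_refl_sumn al.
  have ov := over_sumn pl Pl.
  have h0 : mx 0 <= nth 0 la 0.
    by case/andP: Pl => /hstripP /(_ 0) + /hstripP /(_ 0); rewrite /mx; lia.
  rewrite mem_filter mem_parts_upto ps; apply/and3P; split => //.
    apply/andP; split; first exact/admissibleP.
    by rewrite sl in ov; lia.
  by apply: hstrip_sumn => //; case/admissibleP/andP: hs.
rewrite -(size_map (fun k => mkpart (over_fun s k) B.+1)).
have sp k : ispart k -> admissible (nth 0 k) ->
    ispart (mkpart (over_fun s k) B.+1) /\
    (forall i, nth 0 (mkpart (over_fun s k) B.+1) i = over_fun s k i).
  move=> pk ak; have [ps hs] := strip_refl_spec ak.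
  have as' := strip_refl_admissible ak.
  apply: mkpart_spec => [[|i]|[|i] hi] //=.
  - by have := as' 0; have := mx_le_mn_mx 0; lia.
  - exact: ispart_nth_le.
  - by have := as' i; rewrite mnB //; lia.
apply: uniq_leq_size => [|_ /mapP [k /hQ [pk ak le] ->]].
  rewrite map_inj_in_uniq ?filter_uniq ?parts_upto_uniq //.
  move=> k k' /hQ [pk ak _] /hQ [pk' ak' _] e.
  apply: ispart_eq => // i.
  have [_ h] := sp _ pk ak; have [_ h'] := sp _ pk' ak'.
  have := h i.+1; rewrite e h' /=.
  have [_ ->] := strip_refl_spec ak; have [_ ->] := strip_refl_spec ak'.
  by have := ak i; have := ak' i; lia.
have [ps hs] := sp _ pk ak; have as' := strip_refl_admissible ak.
set la := mkpart _ _ in ps hs *.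
have Pl : P la.
  apply/andP; split; apply/hstripP => -[|i]; rewrite !hs /over_fun /=.
  - by have := as' 0; rewrite /mx /mn; lia.
  - by have := as' i; have := as' i.+1; rewrite /mx /mn; lia.
  - by have := as' 0; rewrite /mx /mn; lia.
  - by have := as' i; have := as' i.+1; rewrite /mx /mn; lia.
rewrite mem_filter Pl; apply/partitionsP; split => //.
rewrite (over_sumn ps Pl) hs /=; under eq_bigr do rewrite hs /=.
have [pr _] := strip_refl_spec ak.
rewrite -sumn_nth; last exact: admissible_size.
have := strip_refl_sumn ak; rewrite -sumn_nth; last exact: admissible_size.
by lia.
Qed.

End Reflection.

Lemma common_strips_refl nu rho t t' :
  ispart nu -> ispart rho ->
  t + t' + maxn (part1 nu) (part1 rho) = sumn nu + sumn rho ->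
  common_strips nu rho t = common_strips nu rho t'.
Proof.
rewrite /part1 -!nth0 => pn pr e; apply/eqP.
by rewrite eqn_leq !leq_common_strips_refl // -e; lia.
Qed.

Lemma common_strips_large nu rho t :
  ispart nu -> ispart rho -> minn (sumn nu) (sumn rho) < t ->
  common_strips nu rho t = 0.
Proof.
move=> pn pr; rewrite /common_strips => h; apply/eqP.
rewrite -leqn0 leqNgt -has_count -all_predC; apply/allP => k /partitionsP [pk sk].
apply/negP => /andP [/(hstrip_sumn pn pk) + /(hstrip_sumn pr pk)].
by rewrite sk; lia.
Qed.

End Partitions.

(** * Schur polynomials: branching, Pieri rule, Cauchy identity *)

Lemma incellE l i j : incell l i j = (j < nth 0%N l i)%N.
Proof.
rewrite /incell; case: ltnP => //= h.
by rewrite nth_default.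
Qed.

(** * Tableaux and the removal of the largest label *)

Section Tableaux.
Local Open Scope nat_scope.
Variable B : nat.
Notation box := ('I_B * 'I_B)%type.

(** Extending the labels by zero to all pairs of naturals turns the tableau conditions into plain
    arithmetic, independent of the surrounding box. *)
Definition label (N : nat) (T : {ffun box -> option 'I_N}) (i j : nat) : nat :=
  if (insub i, insub j) is (Some i', Some j') then olab (T (i', j')) else 0.

Lemma labelE N (T : {ffun box -> option 'I_N}) (i j : 'I_B) :
  label T i j = olab (T (i, j)).
Proof. by rewrite /label !valK. Qed.

Lemma label_out N (T : {ffun box -> option 'I_N}) (i j : nat) :
  (B <= i) || (B <= j) -> label T i j = 0.
Proof.
rewrite /label; case: insubP => [i' hi _|//]; case: insubP => [j' hj _|//].
by rewrite leqNgt hi leqNgt hj.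
Qed.

Lemma olab_inj N : injective (@olab N).
Proof. by move=> [a|] [b|] //= [/val_inj ->]. Qed.

Lemma olab_le N (o : option 'I_N) : olab o <= N.
Proof. by case: o => [a|//]; exact: ltn_ord. Qed.

Lemma label_le N (T : {ffun box -> option 'I_N}) i j : label T i j <= N.
Proof. by rewrite /label; do 2!case: insub => // ?; exact: olab_le. Qed.

Lemma label_inj N (T T' : {ffun box -> option 'I_N}) :
  (forall i j, label T i j = label T' i j) -> T = T'.
Proof.
by move=> h; apply/ffunP => -[i j]; apply: olab_inj; rewrite -!labelE.
Qed.

Definition fits (la : seq nat) := (size la <= B) && (nth 0 la 0 <= B).

Lemma fits_out la i j : ispart la -> fits la -> (B <= i) || (B <= j) ->
  (j < nth 0 la i) = false.
Proof.
move=> pl /andP[h1 h2] /orP[h|h]; first by rewrite nth_default //; lia.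
by have := ispart_nth_mono pl (leq0n i); lia.
Qed.

Record tableau (N : nat) (la : seq nat) (L : nat -> nat -> nat) : Prop := {
  tableau_cell : forall i j, (0 < L i j) = (j < nth 0 la i);
  tableau_row : forall i j j', j <= j' -> j' < nth 0 la i -> L i j <= L i j';
  tableau_col : forall i i' j, i < i' -> j < nth 0 la i' -> L i j < L i' j }.

Lemma ssytP N la (T : {ffun box -> option 'I_N}) : ispart la -> fits la ->
  reflect (tableau N la (label T)) (is_ssyt la T).
Proof.
move=> pl fl.
have labP (o : option 'I_N) : (o != None) = (0 < olab o) by case: o.
apply: (iffP andP) => [[/forallP h1 /forallP h2]|[h1 h2 h3]].
  split.
  - move=> i j; case: (boolP ((B <= i) || (B <= j))) => [o|].
      by rewrite label_out // fits_out.
    rewrite negb_or -!ltnNge => /andP[hi hj].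
    have := h1 (Ordinal hi, Ordinal hj); rewrite labP incellE /= => /eqP ->.
    by rewrite -labelE.
  - move=> i j j' jj' hj'.
    have: ~~ ((B <= i) || (B <= j')).
      by apply/negP => o; move: hj'; rewrite fits_out.
    rewrite negb_or -!ltnNge => /andP[hi hj''].
    have hj : j < B by lia.
    have /forallP /(_ (Ordinal hi, Ordinal hj'')) := h2 (Ordinal hi, Ordinal hj).
    rewrite !incellE /= hj' (leq_ltn_trans jj' hj') eqxx jj' /= => /andP[+ _].
    by rewrite -!labelE.
  - move=> i i' j ii' hj.
    have: ~~ ((B <= i') || (B <= j)).
      by apply/negP => o; move: hj; rewrite fits_out.
    rewrite negb_or -!ltnNge => /andP[hi' hjB].
    have hi : i < B by lia.
    have /forallP /(_ (Ordinal hi', Ordinal hjB)) := h2 (Ordinal hi, Ordinal hjB).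
    rewrite !incellE /= hj (leq_trans hj (ispart_nth_mono pl (ltnW ii'))) eqxx ii'.
    by rewrite /= => /andP[_ +]; rewrite -!labelE.
split; apply/forallP => -[i j].
  by rewrite labP incellE /= -labelE h1.
apply/forallP => -[i' j']; rewrite !incellE /= -!labelE.
apply/implyP => /andP[c1 c2]; apply/andP; split; apply/implyP => /andP[/eqP/val_inj e le].
  by rewrite {}e in c1 *; apply: h2.
by rewrite {}e in c1 *; apply: h3.
Qed.

Variables (N : nat) (la : seq nat).
Hypotheses (pla : ispart la) (fla : fits la).

Definition restr_tab (T : {ffun box -> option 'I_N.+1}) :
    {ffun box -> option 'I_N} :=
  [ffun c => if T c is Some k then insub (val k) else None].

Definition ext_tab (T : {ffun box -> option 'I_N}) :
    {ffun box -> option 'I_N.+1} :=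
  [ffun c => if T c is Some k then Some (widen_ord (leqnSn N) k)
             else if c.2 < nth 0 la c.1 then Some ord_max else None].

Lemma label_restr T i j :
  label (restr_tab T) i j = if label T i j <= N then label T i j else 0.
Proof.
rewrite /label; case: insub => [i'|//]; case: insub => [j'|//].
rewrite ffunE; case: (T _) => [k|] //=.
by case: insubP => [u ku uk|/negbTE nk] /=; rewrite ?uk ?ku ?nk.
Qed.

Lemma label_ext T i j :
  label (ext_tab T) i j =
  if 0 < label T i j then label T i j else if j < nth 0 la i then N.+1 else 0.
Proof.
case: (boolP ((B <= i) || (B <= j))) => [o|].
  by rewrite !label_out // fits_out.
rewrite negb_or -!ltnNge => /andP[hi hj].
rewrite -[i]/(val (Ordinal hi)) -[j]/(val (Ordinal hj)) !labelE ffunE.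
by case: (T _) => [k|] //=; case: ifP.
Qed.

Definition low_row (T : {ffun box -> option 'I_N.+1}) (i : nat) : nat :=
  if i < B then find (fun j => ~~ (0 < label T i j <= N)) (iota 0 B) else 0.

Definition low_shape T := mkpart (low_row T) B.

Lemma low_rowP T i j : tableau N.+1 la (label T) ->
  (j < low_row T i) = (0 < label T i j <= N).
Proof.
move=> tT; rewrite /low_row; case: (ltnP i B) => hi; last first.
  by rewrite label_out ?hi // ltn0.
set p := fun j => _; apply/idP/idP => h.
  have := before_find 0 h; rewrite nth_iota => [/negbFE //|].
  by apply: leq_trans h _; rewrite -[leqRHS](size_iota 0) find_size.
rewrite ltnNge; apply/negP => le.
have hj : j < B by rewrite ltnNge; apply/negP => o; rewrite label_out ?o ?orbT in h.
have hp : has p (iota 0 B) by rewrite has_find size_iota; lia.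
have := nth_find 0 hp; rewrite nth_iota; last by lia.
rewrite /p add0n; set k := find _ _ in le * => /negP [].
have lj : j < nth 0 la i by rewrite -(tableau_cell tT); case/andP: h.
rewrite (tableau_cell tT) (leq_ltn_trans le lj) /=.
by apply: leq_trans (tableau_row tT le lj) _; case/andP: h.
Qed.

(** Columns increase strictly, so a cell with the largest label has no cell below it: the largest
    labels occupy a horizontal strip at the row ends, and the remaining cells form a diagram. *)
Lemma low_shape_spec T : tableau N.+1 la (label T) ->
  [/\ ispart (low_shape T), hstrip la (low_shape T) &
      forall i, nth 0 (low_shape T) i = low_row T i].
Proof.
move=> tT.
have h i : nth 0 la i.+1 <= low_row T i <= nth 0 la i.
  apply/andP; split; rewrite leqNgt; apply/negP => h.
    have := tableau_col tT (ltnSn i) h.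
    have := label_le T i.+1 (low_row T i).
    have: 0 < label T i (low_row T i).
      by rewrite (tableau_cell tT); apply: leq_trans h (ispart_nth_le _ pla).
    by have := low_rowP i (low_row T i) tT; rewrite ltnn; lia.
  have := h; rewrite low_rowP // => /andP[+ _].
  by rewrite (tableau_cell tT) ltnn.
have [p e] : ispart (low_shape T) /\ (forall i, nth 0 (low_shape T) i = low_row T i).
  apply: mkpart_spec => i; first by have := h i; have := h i.+1; lia.
  by rewrite leqNgt /low_row => /negbTE ->.
split => //; apply/hstripP => i; rewrite e; exact: h.
Qed.

Lemma fits_strip nu : ispart nu -> hstrip la nu -> fits nu.
Proof.
move=> pn /hstripP h; move/andP: fla => [h1 h2]; apply/andP; split; last first.
  by case/andP: (h 0) => _ /leq_trans ->.
rewrite leqNgt; apply/negP => /(ispart_pos pn).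
by have := h B; rewrite [nth 0 la B]nth_default //; lia.
Qed.

Lemma tableau_restr T : tableau N.+1 la (label T) ->
  tableau N (low_shape T) (label (restr_tab T)).
Proof.
move=> tT; have [ps hs e] := low_shape_spec tT.
split=> [i j|i j j' jj'|i i' j ii']; rewrite !label_restr e low_rowP //.
- by case: ifP; lia.
- move=> /andP[p0 pN]; rewrite pN.
  have lj : j' < nth 0 la i by rewrite -(tableau_cell tT).
  have le := tableau_row tT jj' lj.
  by rewrite (leq_trans le pN).
- move=> /andP[p0 pN]; rewrite pN.
  have lj : j < nth 0 la i' by rewrite -(tableau_cell tT).
  by have := tableau_col tT ii' lj; case: ifP; lia.
Qed.

Lemma ext_restr T : tableau N.+1 la (label T) -> ext_tab (restr_tab T) = T.
Proof.
move=> tT; apply: label_inj => i j; rewrite label_ext label_restr.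
by rewrite -(tableau_cell tT); have := label_le T i j; do !case: ifP; lia.
Qed.

Lemma restr_ext T : restr_tab (ext_tab T) = T.
Proof.
apply: label_inj => i j; rewrite label_restr label_ext.
by have := label_le T i j; do !case: ifP; lia.
Qed.

Section Ext.
Variables (nu : seq nat) (T : {ffun box -> option 'I_N}).
Hypotheses (pnu : ispart nu) (hs : hstrip la nu) (tT : tableau N nu (label T)).

Lemma tableau_ext : tableau N.+1 la (label (ext_tab T)).
Proof.
move/hstripP: hs => h.
split=> [i j|i j j' jj' hj|i i' j ii' hj]; rewrite !label_ext.
- have := tableau_cell tT i j; have := h i.
  by do !case: ifP; lia.
- rewrite !(tableau_cell tT) hj (leq_ltn_trans jj' hj).
  have := label_le T i j; case: (ltnP j' (nth 0 nu i)) => h2 le.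
    by rewrite (leq_ltn_trans jj' h2); exact: (tableau_row tT jj' h2).
  by case: ifP; lia.
- have h1 : j < nth 0 nu i.
    have := ispart_nth_mono pla ii'; have := h i; lia.
  rewrite !(tableau_cell tT) hj h1.
  have := label_le T i j; case: (ltnP j (nth 0 nu i')) => h2 le; last by lia.
  exact: (tableau_col tT ii' h2).
Qed.

Lemma low_shape_ext : low_shape (ext_tab T) = nu.
Proof.
have [ps _ e] := low_shape_spec tableau_ext.
apply: ispart_eq => // i; rewrite e.
have h j : (j < low_row (ext_tab T) i) = (j < nth 0 nu i).
  rewrite low_rowP; last exact: tableau_ext.
  rewrite label_ext -(tableau_cell tT); have := label_le T i j.
  by do !case: ifP; lia.
apply/eqP; rewrite eqn_leq.
have := h (nth 0 nu i); have := h (low_row (ext_tab T) i); lia.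
Qed.

End Ext.

Lemma card_cells (mu : seq nat) : ispart mu -> fits mu ->
  #|[pred c : box | c.2 < nth 0 mu c.1]| = sumn mu.
Proof.
move=> pm fm; have /andP[sm m0] := fm.
rewrite -sum1_card (sumn_nth sm).
rewrite -(pair_big_dep predT (fun i j : 'I_B => j < nth 0 mu i) (fun _ _ => 1)) /=.
apply: eq_bigr => i _; rewrite -(big_ord_widen B (fun _ => 1)) ?sum1_card ?card_ord //.
exact: leq_trans (ispart_nth_mono pm (leq0n i)) m0.
Qed.

End Tableaux.

Lemma big_seq_pick (V : nmodType) (I : eqType) (r : seq I) (j : I) (P : pred I)
    (F : I -> V) :
  j \in r -> uniq r -> P j -> (forall i, P i -> i = j) ->
  \sum_(i <- r | P i) F i = F j.
Proof.
move=> jr ur Pj h; rewrite big_mkcond (bigD1_seq j) //= Pj big1 ?addr0 // => i.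
by case: ifP => // /h ->; rewrite eqxx.
Qed.

(** * The branching rule *)

Section Schur.
Variable R : comNzRingType.
Implicit Types (x y : nat -> R) (la nu mu : seq nat).

(** Schur polynomials as sums over Gelfand-Tsetlin patterns. Unlike tableaux, this form lends itself
    to induction on the number of variables. *)
Fixpoint gt x (N : nat) (la : seq nat) : R :=
  if N is N'.+1 then
    \sum_(nu <- parts_upto (sumn la) | hstrip la nu)
      gt x N' nu * x N' ^+ (sumn la - sumn nu)
  else (la == [::])%:R.

Definition label_weight x (l : nat) : R := if l is k.+1 then x k else 1.

(** The box size is a free parameter here, since in [schur] it depends on the shape, and the shape
    changes when a label is removed. *)
Definition schur_box x (B N : nat) la : R :=
  \sum_(T : {ffun 'I_B * 'I_B -> option 'I_N} | is_ssyt la T)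
    \prod_(c : 'I_B * 'I_B | incell la c.1 c.2) label_weight x (olab (T c)).

Lemma schur_boxE x B N la : ispart la -> fits B la ->
  schur_box x B N la = gt x N la.
Proof.
elim: N la => [|N IH] la pl fl /=.
  move: pl fl; case: eqP => [->|lan] pl fl.
    rewrite /schur_box (bigD1 [ffun=> None]) /=; last first.
      apply/ssytP => //.
      have l0 (T : {ffun 'I_B * 'I_B -> option 'I_0}) i j : label T i j = 0%N.
        by apply/eqP; rewrite -leqn0 label_le.
      split=> i j; rewrite ?l0 ?nth_nil //.
    rewrite big_pred0 => [|c]; last by rewrite incellE nth_nil.
    rewrite big1 ?addr0 // => T /andP[_ /eqP []]; apply/ffunP => c; rewrite ffunE.
    by case: (T c) => // -[].
  rewrite /schur_box big1 // => T /ssytP [] // h1 _ _.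
  have la0 : (0 < nth 0 la 0)%N by apply: ispart_pos => //; case: (la) lan.
  have := h1 0%N 0%N; rewrite la0 => l0.
  by have := @label_le B 0 T 0 0; rewrite leqNgt l0.
have pr T : is_ssyt la T -> tableau N.+1 la (@label B N.+1 T) by move/ssytP; apply.
(* Tableaux are grouped by the shape of their cells with labels below the largest one; [ext_tab] and
   [restr_tab] then match each group with the tableaux of that smaller shape. *)
transitivity (\sum_(nu <- parts_upto (sumn la) | hstrip la nu)
   \sum_(T : {ffun 'I_B * 'I_B -> option 'I_N.+1} |
       is_ssyt la T && (low_shape T == nu))
     \prod_(c : 'I_B * 'I_B | incell la c.1 c.2) label_weight x (olab (T c))).
  rewrite (exchange_big_dep (fun T => is_ssyt la T)) /=; last first.
    by move=> nu T _ /andP[].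
  apply: eq_bigr => T sT.
  have [ps hs _] := low_shape_spec pl fl (pr T sT).
  rewrite (big_seq_pick _ _ (parts_upto_uniq _) (j := low_shape T)) //.
  - by rewrite mem_parts_upto ps hstrip_sumn.
  - by rewrite hs sT eqxx.
  - by move=> nu /and3P[_ _ /eqP].
rewrite [LHS]big_seq_cond [RHS]big_seq_cond; apply: eq_bigr => nu /andP[].
rewrite mem_parts_upto => /andP[pn _] hs.
have fn : fits B nu by exact: fits_strip hs.
rewrite -IH // /schur_box mulr_suml.
rewrite (reindex_onto (@ext_tab B N la) (@restr_tab B N)) /=; last first.
  by move=> T /andP[/pr tT _]; exact: ext_restr.
apply: eq_big => [T|T].
  apply/idP/idP => [/andP[/andP[/pr tT /eqP e1] /eqP e2]|sT].
    by apply/ssytP => //; have := tableau_restr pl fl tT; rewrite e1 e2.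
  have tT : tableau N nu (label T) by exact/ssytP.
  rewrite restr_ext // eqxx andbT (low_shape_ext pl fl pn hs tT) eqxx andbT.
  by apply/ssytP => //; exact: tableau_ext hs tT.
case/andP => [/andP[/pr tT /eqP e1] /eqP e2].
have tT' : tableau N nu (label T).
  by have := tableau_restr pl fl tT; rewrite e1 e2.
rewrite (bigID (fun c : 'I_B * 'I_B => incell nu c.1 c.2)) /=; congr (_ * _).
  apply: eq_big => [c|[i j]] /=.
    rewrite !incellE; apply/andb_idl.
    by move/hstripP: hs => /(_ c.1); lia.
  rewrite !incellE => /andP[_ /=].
  by rewrite -!labelE label_ext // -(tableau_cell tT') => ->.
rewrite (eq_bigr (fun=> x N)); last first.
  move=> [i j]; rewrite !incellE /= => /andP[c1 c2].
  by rewrite -labelE label_ext // (tableau_cell tT') (negbTE c2) c1.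
rewrite prodr_const; congr (_ ^+ _).
rewrite -(card_cells pl fl) -(card_cells pn fn).
rewrite -[X in (X - _)%N](cardID [pred c : 'I_B * 'I_B | (c.2 < nth 0 nu c.1)%N]).
rewrite [X in (X + _ - _)%N](_ : _ = #|[pred c : 'I_B * 'I_B | (c.2 < nth 0 nu c.1)%N]|).
  rewrite addKn; apply: eq_card => c.
  by rewrite !inE /= unfold_in /= !incellE andbC.
apply: eq_card => c; rewrite !inE; apply/andb_idl.
by move/hstripP: hs => /(_ c.1) /=; lia.
Qed.

Lemma schurE N x la : ispart la ->
  schur (fun i : 'I_N => x i) la = gt x N la.
Proof.
move=> pl; rewrite -(@schur_boxE x (size la + sumn la)) //.
  apply: eq_bigr => T _; apply: eq_bigr => c _.
  by case: (T c).
by rewrite /fits leq_addr (leq_trans (nth_le_sumn _ _)) ?leq_addl.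
Qed.

End Schur.

(** * Complete homogeneous sums, Pieri rule and Cauchy identity *)

Section Complete.
Variable R : comNzRingType.

(* Generating polynomial of the complete homogeneous sums, exact up to degree
   [D]. *)
Definition hser (D : nat) (I : finType) (z : I -> R) : {poly R} :=
  \prod_i \poly_(j < D.+1) z i ^+ j.

Lemma hser_content D (I : finType) (z : I -> R) k :
  (hser D z)`_k =
  \sum_(A : {ffun I -> 'I_D.+1} | (\sum_i A i)%N == k) \prod_i z i ^+ A i.
Proof.
rewrite /hser; under eq_bigr do rewrite poly_def.
rewrite bigA_distr_bigA /= coef_sum [RHS]big_mkcond /=; apply: eq_bigr => A _.
have -> : \prod_i (z i ^+ A i *: 'X^(A i)) =
    (\prod_i z i ^+ A i) *: 'X^(\sum_i A i)%N :> {poly R}.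
  by rewrite scaler_prod -prodrXr.
by rewrite coefZ coefXn eq_sym; case: eqP => _; rewrite ?mulr1 ?mulr0.
Qed.

Lemma hser_scale D (I : finType) (z : I -> R) c k :
  (hser D (fun i => z i * c))`_k = (hser D z)`_k * c ^+ k.
Proof.
rewrite !hser_content mulr_suml; apply: eq_bigr => A /eqP <-.
by rewrite -prodrXr -big_split; apply: eq_bigr => i _; rewrite exprMn.
Qed.

Lemma hser_reindex D (I : finType) (z : I -> R) (s : I -> I) : injective s ->
  hser D (fun i => z (s i)) = hser D z.
Proof. by move=> si; rewrite /hser [RHS](reindex_inj si). Qed.

Lemma eq_hser D (I : finType) (z z' : I -> R) : z =1 z' -> hser D z = hser D z'.
Proof. by move=> e; apply: eq_bigr => i _; rewrite e. Qed.

Lemma hser_ord0 D (z : 'I_0 -> R) : hser D z = 1.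
Proof. by rewrite /hser big_ord0. Qed.

Lemma hser_recr D N (x : nat -> R) k : (k <= D)%N ->
  (hser D (fun i : 'I_N.+1 => x i))`_k =
  \sum_(j < k.+1) (hser D (fun i : 'I_N => x i))`_(k - j) * x N ^+ j.
Proof.
move=> kD; rewrite /hser big_ord_recr coefMr; apply: eq_bigr => j _ /=.
by rewrite coef_poly (leq_trans (ltn_ord j)).
Qed.

Lemma hser_pair_recr D N M (x y : nat -> R) k :
  (hser D (fun ij : 'I_N * 'I_M.+1 => x ij.1 * y ij.2))`_k =
  \sum_(q < k.+1) (hser D (fun ij : 'I_N * 'I_M => x ij.1 * y ij.2))`_q *
     ((hser D (fun i : 'I_N => x i))`_(k - q) * y M ^+ (k - q)).
Proof.
have pairE M' : hser D (fun ij : 'I_N * 'I_M' => x ij.1 * y ij.2) =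
    \prod_(j < M') hser D (fun i : 'I_N => x i * y j).
  by rewrite exchange_big pair_bigA.
rewrite !pairE big_ord_recr coefM; apply: eq_bigr => q _ /=.
by rewrite -hser_scale.
Qed.

Lemma big_partitions_upto S q (P : pred (seq nat)) (F : seq nat -> R) :
  (q <= S)%N ->
  \sum_(l <- partitions q | P l) F l =
  \sum_(l <- parts_upto S | P l && (sumn l == q)) F l.
Proof.
move=> qS; under [RHS]eq_bigl do rewrite andbC.
rewrite -[RHS]big_filter_cond.
apply/perm_big/uniq_perm.
- exact: partitions_uniq.
- exact/filter_uniq/parts_upto_uniq.
move=> l; rewrite mem_filter mem_parts_upto mem_partitions is_partE andbC.
by case: eqP => //= ->; rewrite qS andbT.
Qed.

Variable D : nat.
Notation h x N k := ((hser D (fun i : 'I_N => x i))`_k).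

Lemma sum_const_seq (s : seq (seq nat)) (P : pred (seq nat)) (c : R) :
  \sum_(l <- s | P l) c = c *+ count P s.
Proof. by rewrite big_const_seq iter_addr_0. Qed.

(* Pieri's rule, by induction on the number of variables: comparing the
   coefficients of the last variable leaves exactly [common_oversE]. *)
Lemma pieri (x : nat -> R) N nu k : ispart nu -> (k <= D)%N ->
  gt x N nu * h x N k =
  \sum_(la <- partitions (sumn nu + k) | hstrip la nu) gt x N la.
Proof.
elim: N nu k => [|N IH] nu k pn kD.
  rewrite hser_ord0 coef1 /=; case: eqP => [->|nun] /=.
    rewrite mul1r add0n; case: k {kD} => [|k].
      by rewrite partitions0 big_cons big_nil /= addr0.
    rewrite big_seq_cond big1 // => la /andP[/partitionsP[_ sl] _].
    by case: eqP sl => // ->.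
  rewrite mul0r big_seq_cond big1 // => la /andP[/partitionsP[_ sl] _].
  case: eqP sl => // -> /= sl; case: nun.
  have := ispart_size pn; rewrite (_ : sumn nu = 0)%N; last by lia.
  by rewrite leqn0 size_eq0 => /eqP.
set s := (sumn nu + k)%N; rewrite hser_recr //.
(* Once the powers of the last variable are collected, every term depends on [rho] only through
   [G rho]; both sides become sums of [G rho] weighted by numbers of strips. *)
pose G rho := gt x N rho * x N ^+ (s - sumn rho).
transitivity (\sum_(ka <- parts_upto (sumn nu) | hstrip nu ka)
  \sum_(rho <- parts_upto s | hstrip rho ka && (sumn rho <= sumn ka + k)%N) G rho).
  rewrite /= mulr_suml big_seq_cond [RHS]big_seq_cond; apply: eq_bigr => ka.
  rewrite mem_parts_upto => /andP[/andP[pk sk] hk].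
  rewrite mulr_sumr.
  transitivity (\sum_(j < k.+1) \sum_(rho <- parts_upto s | hstrip rho ka &&
     (sumn rho == sumn ka + (k - j))%N) G rho).
    apply: eq_bigr => j _; have jk := ltn_ord j.
    rewrite mulrACA IH //; last by lia.
    rewrite (big_partitions_upto _ _ (S := s)); last by rewrite /s; lia.
    rewrite mulr_suml; apply: eq_bigr => rho /andP[_ /eqP sr].
    by rewrite -exprD /G sr; congr (_ * _ ^+ _); rewrite /s; lia.
  rewrite (exchange_big_dep (fun rho => hstrip rho ka)) /=; last first.
    by move=> j rho _ /andP[].
  rewrite [RHS]big_mkcondr big_seq_cond [RHS]big_seq_cond.
  apply: eq_bigr => rho /andP[]; rewrite mem_parts_upto => /andP[pr _] hr.
  have le := hstrip_sumn pr pk hr; rewrite hr /=.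
  case: leqP => h1.
    have hj : (sumn ka + k - sumn rho < k.+1)%N by lia.
    rewrite (big_pred1 (Ordinal hj)) // => j /=.
    apply/eqP/eqP => [e|->]; last by rewrite /=; lia.
    by apply: val_inj; rewrite /= e; have := ltn_ord j; lia.
  by rewrite big_pred0 // => j; apply/eqP; lia.
rewrite (exchange_big_dep xpredT) //=.
transitivity (\sum_(rho <- parts_upto s) G rho *+ common_overs nu rho s).
  rewrite big_seq [RHS]big_seq; apply: eq_bigr => rho.
  rewrite mem_parts_upto => /andP[pr sr].
  rewrite sum_const_seq common_oversE //; congr (_ *+ _).
  by apply: eq_count => ka; rewrite andbA /s; congr (_ && _); lia.
transitivity (\sum_(la <- partitions s | hstrip la nu)
   \sum_(rho <- parts_upto s | hstrip la rho) G rho).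
  rewrite (exchange_big_dep xpredT) //=; apply: eq_bigr => rho _.
  by rewrite sum_const_seq.
rewrite big_seq_cond [RHS]big_seq_cond; apply: eq_bigr => la.
by case/andP=> /partitionsP [_ sl] _; rewrite /G sl.
Qed.

(** Induction on the number of [y] variables: branching off the last of them and applying Pieri's
    rule in the [x] variables multiplies the series by exactly the factor belonging to that
    variable. *)
Lemma cauchy (x y : nat -> R) N M k : (k <= D)%N ->
  \sum_(la <- partitions k) gt x N la * gt y M la =
  (hser D (fun ij : 'I_N * 'I_M => x ij.1 * y ij.2))`_k.
Proof.
elim: M k => [|M IH] k kD.
  rewrite /hser big_pred0 => [|[_ []] //]; rewrite coef1.
  case: k {kD} => [|k]; last first.
    rewrite big_seq big1 // => la /partitionsP [_ sl] /=.
    by case: eqP sl => [->|_ _]; rewrite ?mulr0.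
  rewrite partitions0 big_seq1 eqxx mulr1.
  elim: N => //= N IHN; rewrite (_ : parts_upto 0 = [:: [::]]); last first.
    by rewrite /parts_upto /= partitions0.
  by rewrite big_cons big_nil /= IHN mulr1 addr0.
rewrite hser_pair_recr.
transitivity (\sum_(nu <- parts_upto k) gt x N nu * gt y M nu *
   (h x N (k - sumn nu) * y M ^+ (k - sumn nu))).
  transitivity (\sum_(la <- partitions k) \sum_(nu <- parts_upto k | hstrip la nu)
     gt x N la * (gt y M nu * y M ^+ (k - sumn nu))).
    rewrite big_seq [RHS]big_seq; apply: eq_bigr => la /partitionsP [_ sl].
    by rewrite -mulr_sumr /= sl.
  rewrite (exchange_big_dep xpredT) //= big_seq [RHS]big_seq.
  apply: eq_bigr => nu; rewrite mem_parts_upto => /andP[pn sn].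
  rewrite -mulr_suml -[X in partitions X](subnKC sn) -pieri //; last by lia.
  by rewrite mulrACA.
rewrite big_parts_upto; apply: eq_bigr => q _.
rewrite -IH; last by have := ltn_ord q; lia.
rewrite mulr_suml big_seq [RHS]big_seq; apply: eq_bigr => nu /partitionsP [_ ->].
by [].
Qed.

End Complete.

(** * Kostka coefficients and dominance *)

Section Kostka.
Variables (R : comNzRingType) (N : nat).

Definition Xn (i : nat) : {mpoly R[N]} :=
  if insub i is Some k then 'X_k else 0.

Lemma XnE (i : 'I_N) : Xn i = 'X_i.
Proof. by rewrite /Xn valK. Qed.

Lemma mcoeffMXif (p : {mpoly R[N]}) m t :
  (p * 'X_[m])@_t = if (m <= t)%MM then p@_(t - m) else 0.
Proof.
case: ifP => [mt|/negP nmt].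
  by rewrite -{1}(submK mt) addmC mcoeffMX.
rewrite [p]mpolyE mulr_suml raddf_sum big1 //= => s _.
rewrite -scalerAl -mpolyXD mcoeffZ mcoeffX; case: eqP => [e|_]; last first.
  by rewrite mulr0.
by case: nmt; rewrite -e lem_addl.
Qed.

Lemma gt_coef_recr N' (hN : (N' < N)%N) la t :
  (gt Xn N'.+1 la)@_t =
  \sum_(nu <- parts_upto (sumn la) | hstrip la nu)
    if (sumn la - sumn nu <= t (Ordinal hN))%N then
      (gt Xn N' nu)@_(t - U_(Ordinal hN) *+ (sumn la - sumn nu)) else 0.
Proof.
rewrite /= raddf_sum; apply: eq_bigr => nu _ /=.
rewrite -[X in Xn X]/(val (Ordinal hN)) XnE mpolyXn mcoeffMXif.
congr (if _ then _ else _); apply/mnm_lepP/idP => [/(_ (Ordinal hN))|h i].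
  by rewrite mulmnE mnm1E eqxx mul1n.
by rewrite mulmnE mnm1E; case: eqP => [<-|_]; rewrite ?mul1n ?mul0n.
Qed.

Definition psum (t : 'X_{1..N}) (k : nat) : nat := (\sum_(i < N | (i < k)%N) t i)%N.

Definition lsum (la : seq nat) (k : nat) : nat := (\sum_(i < k) nth 0%N la i)%N.

Lemma lsum_size la k : (size la <= k)%N -> lsum la k = sumn la.
Proof. by move=> h; rewrite /lsum -sumn_nth. Qed.

Lemma gt_coef_neq0 N' la t : (N' <= N)%N -> ispart la ->
  (gt Xn N' la)@_t != 0 ->
  [/\ (size la <= N')%N, (forall i : 'I_N, (N' <= i)%N -> t i = 0%N),
      mdeg t = sumn la & forall k, (psum t k <= lsum la k)%N].
Proof.
elim: N' la t => [|N' IH] la t hN pl.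
  rewrite /=; case: (la =P [::]) => [->|_]; last by rewrite mcoeff0 eqxx.
  rewrite mcoeff1; case: (t =P 0%MM) => [->|_]; last by rewrite eqxx.
  move=> _; split => // [i||k]; rewrite ?mnm0E ?mdeg0 //.
  by rewrite /psum big1 // => i _; rewrite mnm0E.
rewrite (gt_coef_recr hN) => hsum.
have /hasP [nu] : has (fun nu => hstrip la nu && ((if (sumn la - sumn nu <=
   t (Ordinal hN))%N then (gt Xn N' nu)@_(t - U_(Ordinal hN) *+ (sumn la - sumn nu))
   else 0) != 0)) (parts_upto (sumn la)).
  apply: contraNT hsum => /hasPn h; rewrite big_seq_cond big1 // => nu.
  by case/andP => /h; rewrite negb_and negbK => /orP [/negbTE -> //|/eqP].
rewrite mem_parts_upto => /andP[pn sn] /andP[/hstripP hs].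
case: leqP => [le|]; last by rewrite eqxx.
set t' := (_ - _)%MM; set e := (sumn la - sumn nu)%N in le t' *.
move=> /(IH _ _ (ltnW hN) pn) [szn tz dt ps].
have t'E i : t' i = (t i - (Ordinal hN == i) * e)%N.
  by rewrite /t' mnmBE mulmnE mnm1E.
have te : t (Ordinal hN) = e.
  by have := tz (Ordinal hN) (leqnn _); rewrite t'E eqxx mul1n; lia.
have sz : (size la <= N'.+1)%N.
  rewrite leqNgt; apply/negP => h; have := ispart_pos pl h.
  by have := hs N'; rewrite [nth 0%N nu N']nth_default //; lia.
have tlt (i : 'I_N) : (i < N')%N -> t' i = t i.
  rewrite t'E; case: eqP => [<-|_]; last by rewrite subn0.
  by rewrite /= ltnn.
have dE : mdeg t = sumn la.
  rewrite (_ : t = t' + U_(Ordinal hN) *+ e)%MM; last first.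
    rewrite submK //; apply/mnm_lepP => i; rewrite mulmnE mnm1E.
    by case: eqP => [<-|_]; rewrite ?mul1n ?mul0n ?te.
  by rewrite mdegD mdegMn mdeg1 dt mul1n /e; lia.
split => // [i hi|k].
  have := tz i (ltnW hi); rewrite t'E; case: eqP => [h|_]; last by rewrite subn0.
  by move: hi; rewrite -h /= ltnn.
case: (leqP k N') => hk.
  apply: (@leq_trans (lsum nu k)); last first.
    by apply: leq_sum => i _; case/andP: (hs i).
  apply: leq_trans (ps k); apply: leq_sum => i hi.
  by rewrite tlt //; lia.
rewrite lsum_size ?(leq_trans sz) // -dE mdegE.
by rewrite /psum [leqRHS](bigID (fun i : 'I_N => (i < k)%N)) leq_addr.
Qed.

(** Only one branch contributes: with exponent [la], removing the last variable must remove the last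
    row, giving [nu0]. *)
Lemma gt_coef_diag N' la (t : 'X_{1..N}) : (N' <= N)%N -> ispart la ->
  (size la <= N')%N -> (forall i : 'I_N, t i = nth 0%N la i)%N ->
  (gt Xn N' la)@_t = 1.
Proof.
elim: N' la t => [|N' IH] la t hN pl sl tE.
  have /eqP -> : la == [::] by rewrite -size_eq0 -leqn0.
  rewrite /= mcoeff1 (_ : t = 0%MM) ?eqxx //.
  apply/mnmP => i; rewrite tE mnm0E nth_default //.
  exact: leq_trans sl _.
rewrite (gt_coef_recr hN).
pose nu0 := mkpart (fun i => if (i < N')%N then nth 0%N la i else 0%N) N'.
have [pn0 nth0] : ispart nu0 /\ (forall i, nth 0%N nu0 i =
    if (i < N')%N then nth 0%N la i else 0)%N.
  apply: mkpart_spec => i; last by rewrite leqNgt => /negbTE ->.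
  by have := ispart_nth_le i pl; case: (ltnP i.+1 N'); case: (ltnP i N'); lia.
have hs0 : hstrip la nu0.
  apply/hstripP => i; rewrite nth0; have := ispart_nth_le i pl.
  case: (ltnP i N') => h; first by lia.
  by rewrite [nth 0%N la i.+1]nth_default //; lia.
have sz0 : (size nu0 <= N')%N.
  rewrite leqNgt; apply/negP => /(ispart_pos pn0).
  by rewrite nth0 ltnn.
have s0 : sumn la = (sumn nu0 + nth 0%N la N')%N.
  rewrite (sumn_nth sl) (sumn_nth sz0) big_ord_recr /=; congr addn.
  by apply: eq_bigr => i _; rewrite nth0 ltn_ord.
have e0 : (sumn la - sumn nu0 = t (Ordinal hN))%N by rewrite tE s0 /=; lia.
(* A contributing [nu] has at most [N'] rows and the size of [nu0], while each of its rows is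
   bounded by that of [nu0]; hence all rows agree. *)
have key nu : ispart nu -> hstrip la nu -> nu != nu0 ->
   (if (sumn la - sumn nu <= t (Ordinal hN))%N then
     (gt Xn N' nu)@_(t - U_(Ordinal hN) *+ (sumn la - sumn nu)) else 0) = 0.
  move=> pn /hstripP hs ne; case: leqP => // le; apply/eqP; apply: contraNT ne.
  move=> /(gt_coef_neq0 (ltnW hN) pn) [szn tz dt ps].
  have := tz (Ordinal hN) (leqnn _).
  rewrite mnmBE mulmnE mnm1E eqxx mul1n => e.
  have es : sumn nu = sumn nu0.
    have : (sumn nu <= sumn la)%N by apply: hstrip_sumn => //; apply/hstripP.
    by lia.
  have hle (i : 'I_N') : (nth 0%N nu i <= nth 0%N nu0 i)%N.
    by rewrite nth0 ltn_ord; case/andP: (hs i).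
  have heq : forall i : 'I_N', nth 0%N nu i = nth 0%N nu0 i.
    have: (\sum_(i < N') nth 0%N nu i == \sum_(i < N') nth 0%N nu0 i)%N.
      by rewrite -!sumn_nth // es.
    rewrite (leqif_sum (fun i _ => leqif_eq (hle i))) => /forallP h i.
    by apply/eqP; have := h i.
  apply/eqP/ispart_eq => // i; case: (ltnP i N') => hi.
    exact: (heq (Ordinal hi)).
  by rewrite !nth_default //; lia.
rewrite big_mkcond (bigD1_seq nu0) ?parts_upto_uniq //=; last first.
  by rewrite mem_parts_upto pn0 s0 leq_addr.
rewrite hs0 e0 leqnn big_seq_cond big1 ?addr0; last first.
  move=> nu; rewrite mem_parts_upto => /andP[/andP[pn _] ne].
  by case: ifP => // hs; exact: key.
apply: IH => // [|i]; first exact: ltnW.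
rewrite mnmBE mulmnE mnm1E nth0 tE; case: eqP => [<-|ne] /=.
  by rewrite ltnn tE mul1n subnn.
rewrite subn0; case: ltnP => // hi; rewrite nth_default //.
apply: leq_trans sl _; rewrite ltn_neqAle hi andbT.
by apply/eqP => e; apply: ne; apply: val_inj.
Qed.

End Kostka.

(** * Schur expansions *)

(** Elimination from the largest weight downwards. Since [Q] propagates along nonzero entries from
    column to row index, the equations indexed by [Q] involve only unknowns indexed by [Q], so a
    partial system already determines a partial solution. [Q] will be a lower bound on a first
    part. *)
Lemma unitriangular_zero (I : eqType) (V : nzRingType) (r : seq I)
    (K : I -> I -> V) (c : I -> V) (w : I -> nat) (Q : pred I) :
  uniq r ->
  {in r, forall i, K i i = 1} ->
  {in r &, forall i j, K i j != 0 -> i = j \/ (w j < w i)%N} ->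
  {in r &, forall i j, Q j -> K i j != 0 -> Q i} ->
  {in r, forall j, Q j -> \sum_(i <- r) c i * K i j = 0} ->
  {in r, forall i, Q i -> c i = 0}.
Proof.
move=> ur K1 Kw KQ c0 j.
pose W := (\max_(i <- r) w i)%N.
have [k] := ubnP (W - w j)%N; elim: k j => // k IH j; rewrite ltnS => hk jr Qj.
have := c0 j jr Qj; rewrite (bigD1_seq j) //= K1 // mulr1.
rewrite big_seq_cond big1 ?addr0 // => i /andP[ir ij].
have [->|nz] := eqVneq (K i j) 0; first by rewrite mulr0.
have [e|lt] := Kw _ _ ir jr nz; first by rewrite e eqxx in ij.
have leW : (w i <= W)%N by apply: leq_bigmax_seq.
by rewrite IH ?mul0r ?(KQ i j) //; lia.
Qed.

Definition mpart (N : nat) (al : seq nat) : 'X_{1..N} :=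
  [multinom nth 0%N al i | i < N].

(** A numerical refinement of the dominance order: dominance between distinct partitions of [n]
    makes this sum of partial sums strictly larger. *)
Definition dweight (n : nat) (la : seq nat) : nat :=
  (\sum_(k < n.+1) lsum la k)%N.

Section Triangular.
Variables (R : comNzRingType) (N n : nat).
Hypothesis nN : (n <= N)%N.
Notation s la := (gt (@Xn R N) N la).

Lemma psum_mpart al k : (size al <= N)%N -> psum (mpart N al) k = lsum al k.
Proof.
move=> sal; rewrite /psum /lsum; under eq_bigr do rewrite mnmE.
case: (leqP k N) => h.
  by rewrite (big_ord_widen N (fun i => nth 0%N al i)).
rewrite [RHS](_ : _ = lsum al k) // lsum_size; last by lia.
rewrite (sumn_nth sal); apply: eq_bigl => i.
by apply: ltn_trans h.
Qed.

Lemma kostka_diag la : la \in partitions n -> (s la)@_(mpart N la) = 1.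
Proof.
case/partitionsP => pl sl; apply: gt_coef_diag => // [|i]; last by rewrite mnmE.
by apply: leq_trans nN; rewrite -sl ispart_size.
Qed.

Lemma kostka_dominance la al k : la \in partitions n -> al \in partitions n ->
  (s la)@_(mpart N al) != 0 -> (lsum al k <= lsum la k)%N.
Proof.
move=> /partitionsP [pl sl] /partitionsP [pa sa].
case/(gt_coef_neq0 (leqnn N) pl) => _ _ _ /(_ k).
by rewrite psum_mpart //; apply: leq_trans nN; rewrite -sa ispart_size.
Qed.

Lemma kostka_part1 la al : la \in partitions n -> al \in partitions n ->
  (s la)@_(mpart N al) != 0 -> (part1 al <= part1 la)%N.
Proof.
move=> hl ha /(kostka_dominance 1 hl ha).
by rewrite /lsum !big_ord_recl !big_ord0 !addn0 /part1 -!nth0.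
Qed.

Lemma kostka_weight la al : la \in partitions n -> al \in partitions n ->
  (s la)@_(mpart N al) != 0 -> la = al \/ (dweight n al < dweight n la)%N.
Proof.
move=> hl ha nz.
have dom k := kostka_dominance k hl ha nz.
have le : (dweight n al <= dweight n la)%N by apply: leq_sum => k _; exact: dom.
case: (ltnP (dweight n al) (dweight n la)) => h; first by right.
left; have e : dweight n al == dweight n la by rewrite eqn_leq le h.
move: e; rewrite /dweight.
rewrite (leqif_sum (fun k _ => leqif_eq (dom (val k)))) => /forallP e.
have eqk (k : nat) : (k <= n)%N -> lsum al k = lsum la k.
  by move=> hk; have /eqP := e (Ordinal (hk : (k < n.+1)%N)).
case/partitionsP: hl => pl sl; case/partitionsP: ha => pa sa.
apply: ispart_eq => // i; case: (ltnP i n) => hi; last first.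
  rewrite !nth_default //; apply: leq_trans hi.
    by rewrite -sa ispart_size.
  by rewrite -sl ispart_size.
have := eqk i.+1 hi; have := eqk i (ltnW hi).
by rewrite /lsum !big_ord_recr /= => ->; lia.
Qed.

Lemma schur_free (c : seq nat -> R) :
  (forall t, \sum_(la <- partitions n) c la * (s la)@_t = 0) ->
  {in partitions n, forall la, c la = 0}.
Proof.
move=> h la hl.
apply: (@unitriangular_zero _ _ (partitions n) (fun la al => (s la)@_(mpart N al))
  c (dweight n) predT) => //.
- exact: partitions_uniq.
- exact: kostka_diag.
- by move=> i j hi hj; exact: kostka_weight.
Qed.

End Triangular.

Lemma rmorph_gt (R S : comNzRingType) (f : {rmorphism R -> S}) (x : nat -> R) N la :
  f (gt x N la) = gt (fun i => f (x i)) N la.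
Proof.
elim: N la => [|N IH] la /=; first by rewrite rmorph_nat.
rewrite rmorph_sum; apply: eq_bigr => nu _.
by rewrite rmorphM rmorphXn IH.
Qed.

Lemma eq_gt (R : comNzRingType) (x y : nat -> R) N la :
  (forall i, (i < N)%N -> x i = y i) -> gt x N la = gt y N la.
Proof.
elim: N la => [|N IH] la //= e; apply: eq_bigr => nu _.
by rewrite e // IH // => i hi; apply: e; exact: ltnW.
Qed.

Section Symmetric.
Variables (R : comNzRingType) (N : nat).
Notation P := {mpoly R[N]}.

(* By the Cauchy identity the Schur polynomials are the coefficients of a series
   that is visibly symmetric. *)
Lemma gt_sym (s : 'S_N) la : ispart la ->
  msym s (gt (@Xn R N) N la) = gt (@Xn R N) N la.
Proof.
move=> pl; set k := sumn la.
pose y := @Xn P k.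
pose f : {rmorphism P -> P} := msym s.
pose x (i : nat) : {mpoly P[k]} := (@Xn R N i)%:MP.
pose x' (i : nat) : {mpoly P[k]} := (f (@Xn R N i))%:MP.
have e : \sum_(mu <- partitions k) gt x' N mu * gt y k mu =
         \sum_(mu <- partitions k) gt x N mu * gt y k mu.
  rewrite (@cauchy _ k x' y _ _ _ (leqnn k)) (@cauchy _ k x y _ _ _ (leqnn k)).
  suff -> : hser k (fun ij : 'I_N * 'I_k => x' ij.1 * y ij.2) =
            hser k (fun ij : 'I_N * 'I_k => x ij.1 * y ij.2) by [].
  pose g (ij : 'I_N * 'I_k) := (s ij.1, ij.2).
  have gi : injective g by move=> [a b] [a' b'] [/perm_inj -> ->].
  rewrite -[RHS](hser_reindex _ _ gi); apply: eq_hser => -[i j] /=.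
  by rewrite /x' /x !XnE /f /= /msym mmapX mmap1U.
apply/eqP; rewrite -subr_eq0; apply/eqP.
(* Independence of the Schur polynomials in [y], with coefficients in the polynomials in [x],
   separates the terms of [e]. *)
apply: (@schur_free P k k (leqnn k)
  (fun mu => f (gt (@Xn R N) N mu) - gt (@Xn R N) N mu)); last first.
  exact/partitionsP.
move=> t; have /(congr1 (mcoeff t)) := e; rewrite !raddf_sum /= => /eqP.
rewrite -subr_eq0 -sumrB => /eqP e0; rewrite -[RHS]e0; apply: eq_bigr => mu _.
rewrite mulrBl; congr (_ - _).
  by rewrite -mcoeffCM rmorph_gt rmorph_gt.
by rewrite -mcoeffCM rmorph_gt.
Qed.

Lemma mpart_sort (t : 'X_{1..N}) : exists (s : 'S_N) (al : seq nat),
  al \in partitions (mdeg t) /\ [multinom t (s i) | i < N] = mpart N al.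
Proof.
pose u := sort geq (tval (codom_tuple t)).
have su : size u = N by rewrite size_sort size_tuple card_ord.
have tot : total geq by move=> a b; exact: leq_total.
have srt : sorted geq u by apply: sort_sorted.
have pu : perm_eq u (codom_tuple t) by rewrite perm_sort.
have cN : size u == #|'I_N| by rewrite su card_ord.
have /tuple_permP [p e] : perm_eq (Tuple cN) (codom_tuple t) by [].
pose cast (i : 'I_N) : 'I_#|'I_N| := enum_rank i.
pose p' (i : 'I_N) : 'I_N := enum_val (p (enum_rank i)).
have p'i : injective p'.
  by move=> i j /enum_val_inj /perm_inj /enum_rank_inj.
exists (perm p'i), (mkpart (nth 0%N u) N).
have le i : (nth 0 u i.+1 <= nth 0 u i)%N.
  case: (ltnP i.+1 (size u)) => h; last by rewrite nth_default.
  by have /(sortedP 0%N) /(_ i h) := srt.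
have [pm hm] : ispart (mkpart (nth 0%N u) N) /\
    (forall i, nth 0%N (mkpart (nth 0%N u) N) i = nth 0%N u i).
  by apply: mkpart_spec => // i hi; rewrite nth_default // su.
split.
  apply/partitionsP; split => //.
  rewrite (@sumn_nth _ N); last first.
    by rewrite leqNgt; apply/negP => /(ispart_pos pm); rewrite hm nth_default ?su.
  under eq_bigr do rewrite hm.
  rewrite -(@sumn_nth u N) ?su // mdegE (perm_sumn pu).
  by rewrite sumnE big_map big_enum.
apply/mnmP => i; rewrite !mnmE hm permE /p' .
have -> : u = [seq tnth (codom_tuple t) (p i) | i <- enum 'I_#|'I_N|] :> seq nat.
  by rewrite [LHS]e.
have hi : (i < size (enum 'I_#|'I_N|))%N by rewrite size_enum_ord card_ord.
rewrite (nth_map (enum_rank i)) //.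
have -> : nth (enum_rank i) (enum 'I_#|'I_N|) i = enum_rank i.
  by apply: ord_inj; rewrite nth_enum_ord ?enum_rank_ord //= card_ord.
by rewrite (tnth_nth 0%N) /= /codom /image_mem (nth_map i) -?cardE // -enum_val_nth.
Qed.

Lemma sym_eq0 (F : P) : (forall s : 'S_N, msym s F = F) ->
  (forall t, F@_t != 0 -> mdeg t = N) ->
  {in partitions N, forall al, F@_(mpart N al) = 0} -> F = 0.
Proof.
move=> sF dF hF; apply/mpolyP => t; rewrite mcoeff0; apply/eqP.
case: (eqVneq (F@_t) 0) => // nz; have [s [al [ha e]]] := mpart_sort t.
rewrite (dF t nz) in ha.
by move: nz; rewrite -{1}(sF s) mcoeff_sym e hF ?eqxx.
Qed.

(** Descending induction on [dweight]: subtracting the Schur polynomials of weight [w], with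
    coefficients read off from [F], clears the coefficients at partitions of weight [w] and leaves
    those of larger weight zero. The diagonal Kostka entries are 1, so no division occurs and the
    expansion holds over the integers. *)
Lemma schur_expand (F : P) : (forall s : 'S_N, msym s F = F) ->
  (forall t, F@_t != 0 -> mdeg t = N) ->
  exists c : seq nat -> R,
    F = \sum_(la <- partitions N) c la *: gt (@Xn R N) N la.
Proof.
move=> sF dF.
pose W := (\max_(la <- partitions N) dweight N la)%N.
have: {in partitions N, forall al, (W.+1 <= dweight N al)%N -> F@_(mpart N al) = 0}.
  move=> al ha; rewrite ltnNge => /negP []; exact: leq_bigmax_seq.
elim: W.+1 F sF dF => {W} [|w IH] F sF dF hF.
  exists (fun=> 0); rewrite big1 => [|la _]; last by rewrite scale0r.
  by apply: sym_eq0 => // al ha; exact: hF.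
pose G := \sum_(la <- partitions N | dweight N la == w)
   F@_(mpart N la) *: gt (@Xn R N) N la.
have [||al ha hw|c hc] := IH (F - G).
- move=> s; rewrite raddfB /= sF; congr (_ - _).
  rewrite raddf_sum /= big_seq_cond [RHS]big_seq_cond; apply: eq_bigr => la.
  by case/andP => /partitionsP [pl _] _; rewrite msymZ gt_sym.
- move=> t; rewrite mcoeffB => nz; apply/eqP; apply: contraNT nz => nt.
  have -> : F@_t = 0 by apply/eqP; apply: contraNT nt => /dF ->.
  rewrite raddf_sum /= big_seq_cond big1 ?subr0 // => la.
  case/andP => /partitionsP [pl sl] _; rewrite mcoeffZ.
  case: (eqVneq ((gt (@Xn R N) N la)@_t) 0) => [->|]; first by rewrite mulr0.
  by case/(gt_coef_neq0 (leqnn N) pl) => _ _ dt _; rewrite dt sl eqxx in nt.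
- rewrite mcoeffB raddf_sum /=.
  have term la : la \in partitions N -> dweight N la == w ->
      (F@_(mpart N la) *: gt (@Xn R N) N la)@_(mpart N al) =
      if la == al then F@_(mpart N al) else 0.
    move=> hl /eqP lw; rewrite mcoeffZ; case: eqP => [->|ne].
      by rewrite (kostka_diag _ (leqnn N) ha) mulr1.
    case: (eqVneq ((gt (@Xn R N) N la)@_(mpart N al)) 0) => [->|].
      by rewrite mulr0.
    by case/(kostka_weight (leqnn N) hl ha) => //; lia.
  rewrite big_seq_cond (eq_bigr (fun la => if la == al then F@_(mpart N al) else 0));
    last by move=> la /andP[]; exact: term.
  rewrite -big_seq_cond -big_mkcondr /=.
  move: hw; rewrite leq_eqVlt => /orP [/eqP ew|lw].
    rewrite (big_seq_pick _ ha (partitions_uniq N)) ?subrr // ?ew ?eqxx //.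
    by move=> i /andP[_ /eqP].
  rewrite hF // big_pred0 ?subr0 // => la.
  by apply/negP => /andP[/eqP + /eqP e]; rewrite e; lia.
exists (fun la => c la + (if dweight N la == w then F@_(mpart N la) else 0)).
under eq_bigr do rewrite scalerDl.
rewrite big_split /= -hc -[LHS](subrK G); congr (_ + _).
rewrite /G big_mkcond; apply: eq_bigr => la _.
by case: ifP => _ //; rewrite scale0r.
Qed.

End Symmetric.

Section Contents.
Variable I : finType.

Lemma content_seq (A : I -> nat) : exists s : seq I, forall i, count_mem i s = A i.
Proof.
exists (flatten [seq nseq (A i) i | i <- enum I]) => i.
rewrite count_flatten sumnE 2!big_map big_enum (bigD1 i) //= big1 ?addn0 => [|j ji].
  by rewrite count_nseq /= eqxx mul1n.
by rewrite count_nseq /= (negbTE ji).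
Qed.

Lemma size_content (s : seq I) : size s = (\sum_i count_mem i s)%N.
Proof.
rewrite -sum1_size (partition_big id predT) //=; apply: eq_bigr => i _.
by rewrite sum1_count.
Qed.

Lemma perm_content (s t : seq I) :
  (forall i, count_mem i s = count_mem i t) -> perm_eq s t.
Proof. by move=> h; apply/allP => i _ /=; rewrite h. Qed.

Lemma prod_content (R : comNzRingType) (z : I -> R) (s : seq I) :
  \prod_(i <- s) z i = \prod_i z i ^+ count_mem i s.
Proof.
rewrite (partition_big id predT) //=; apply: eq_bigr => i _.
rewrite (eq_bigr (fun=> z i)) => [|j /eqP -> //].
by rewrite big_const_seq iter_mulr_1.
Qed.

End Contents.

Lemma hcompE (R : comNzRingType) N D (x : 'I_N -> R) k : (k <= D)%N ->
  hcomp x k = (hser D x)`_k.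
Proof.
move=> kD; rewrite hser_content /hcomp.
pose p (t : k.-tuple 'I_N) := [ffun i => inord (count_mem i t) : 'I_D.+1].
have pE t i : p t i = count_mem i t :> nat.
  rewrite ffunE inordK // ltnS (leq_trans (count_size _ _)) ?size_tuple //.
rewrite (partition_big p (fun A => (\sum_i A i == k)%N)) /=; last first.
  move=> t _; under eq_bigr do rewrite pE.
  by rewrite -size_content size_tuple.
apply: eq_bigr => A /eqP sA.
have [s hs] := content_seq (fun i => A i : nat).
have tot : total (fun a b : 'I_N => a <= b)%N by move=> a b; exact: leq_total.
pose u := sort (fun a b : 'I_N => a <= b)%N s.
have hu i : count_mem i u = A i by rewrite (seq.permP (permEl (perm_sort _ s))).
have su : size u == k by rewrite size_content (eq_bigr _ (fun i _ => hu i)) sA.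
rewrite (big_pred1 (Tuple su)) /=.
  by rewrite prod_content; apply: eq_bigr => i _; rewrite hu.
move=> t /=; apply/andP/eqP => [[st /eqP pt]|->].
  apply: val_inj; apply: (sorted_eq (leT := fun a b : 'I_N => a <= b)%N) => //.
  - by move=> a b c; exact: leq_trans.
  - by move=> a b /anti_leq /val_inj.
  - exact: sort_sorted.
  - by apply: perm_content => i; rewrite hu -pt pE.
split; first exact: sort_sorted.
by apply/eqP/ffunP => i; apply: val_inj; rewrite /= pE hu.
Qed.

Lemma eq_schur (R : comNzRingType) N (x y : 'I_N -> R) la :
  x =1 y -> schur x la = schur y la.
Proof.
move=> e; apply: eq_bigr => T _; apply: eq_bigr => c _.
by case: (T c).
Qed.

(** * Schur expansions in two sets of variables *)

Section SymT.
Variables (C : comNzRingType) (n m : nat).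
Notation S := (SymT C n m).

Definition embx : {mpoly C[n]} -> S := mmap (@mpolyC (n + m) C) (@xv C n m).
Definition emby : {mpoly C[m]} -> S := mmap (@mpolyC (n + m) C) (@yv C n m).

Definition xn (i : nat) : S := if insub i is Some k then xv C m k else 0.
Definition yn (i : nat) : S := if insub i is Some k then yv C n k else 0.

Lemma schur_xE la : ispart la -> schur (@xv C n m) la = gt xn n la.
Proof.
by move=> pl; rewrite -schurE //; apply: eq_schur => i; rewrite /xn valK.
Qed.

Lemma schur_yE la : ispart la -> schur (@yv C n m) la = gt yn m la.
Proof.
by move=> pl; rewrite -schurE //; apply: eq_schur => i; rewrite /yn valK.
Qed.

Lemma schur_embx la : ispart la ->
  schur (@xv C n m) la = embx (gt (@Xn C n) n la).
Proof.
move=> pl; rewrite schur_xE // /embx rmorph_gt; apply: eq_gt => i hi.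
by rewrite -[i]/(val (Ordinal hi)) XnE /xn valK /= mmapX mmap1U.
Qed.

Lemma schur_emby la : ispart la ->
  schur (@yv C n m) la = emby (gt (@Xn C m) m la).
Proof.
move=> pl; rewrite schur_yE // /emby rmorph_gt; apply: eq_gt => i hi.
by rewrite -[i]/(val (Ordinal hi)) XnE /yn valK /= mmapX mmap1U.
Qed.

Definition mcat (t : 'X_{1..n}) (u : 'X_{1..m}) : 'X_{1..(n + m)} :=
  [multinom match split k with inl i => t i | inr j => u j end | k < n + m].

Lemma mcat_lshift t u i : mcat t u (lshift m i) = t i.
Proof.
by rewrite mnmE -[lshift m i]/(unsplit (inl i)) unsplitK.
Qed.

Lemma mcat_rshift t u j : mcat t u (rshift n j) = u j.
Proof.
by rewrite mnmE -[rshift n j]/(unsplit (inr j)) unsplitK.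
Qed.

Lemma mcat_inj t u t' u' : mcat t u = mcat t' u' -> t = t' /\ u = u'.
Proof.
move=> e; split; apply/mnmP => i.
  by rewrite -(mcat_lshift t u) e mcat_lshift.
by rewrite -(mcat_rshift t u) e mcat_rshift.
Qed.

Lemma mcat_prod (t : 'X_{1..n}) (u : 'X_{1..m}) :
  (\prod_i xv C m i ^+ t i) * (\prod_j yv C n j ^+ u j) = 'X_[mcat t u].
Proof.
rewrite (mpolyXE_id C (mcat t u)) big_split_ord /=.
by congr (_ * _); apply: eq_bigr => i _; rewrite ?mcat_lshift ?mcat_rshift.
Qed.

Lemma mcoeff_emb F G t u :
  (embx F * emby G)@_(mcat t u) = F@_t * G@_u.
Proof.
rewrite [in RHS](mpolyE F) [in RHS](mpolyE G) /embx /emby /mmap.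
rewrite !raddf_sum /= !mulr_suml raddf_sum; apply: eq_bigr => a _ /=.
rewrite !mulr_sumr raddf_sum; apply: eq_bigr => b _ /=.
rewrite mulrACA -mpolyCM mcoeffCM -/(mmap1 _ _) mcat_prod mcoeffX.
rewrite !mcoeffZ !mcoeffX mulrACA; congr (_ * _).
case: eqP => [/mcat_inj [-> ->]|ne]; first by rewrite !eqxx mulr1.
case: eqP => [ea|_]; last by rewrite mul0r.
by case: eqP => [eb|_]; rewrite ?mulr0 //; case: ne; rewrite ea eb.
Qed.

Notation ss la mu := (schur (@xv C n m) la * schur (@yv C n m) mu).

(** Under the sum of the two dominance weights, the tensor product of the two Kostka matrices is
    again unitriangular. Nonzero Kostka entries never decrease the first part when passing from
    exponent to shape, which is why [Q] has to be closed under enlarging first parts. *)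
Lemma schur_pair_free (Q : seq nat -> seq nat -> bool) (c : seq nat -> seq nat -> C) :
  (forall la mu al be, Q al be -> (part1 al <= part1 la)%N ->
     (part1 be <= part1 mu)%N -> Q la mu) ->
  {in partitions n & partitions m, forall al be, Q al be ->
     (\sum_(la <- partitions n) \sum_(mu <- partitions m) c la mu *: ss la mu)@_
        (mcat (mpart n al) (mpart m be)) = 0} ->
  {in partitions n & partitions m, forall la mu, Q la mu -> c la mu = 0}.
Proof.
move=> hQ h0 la mu hl hm.
pose Kx la al := (gt (@Xn C n) n la)@_(mpart n al).
pose Ky mu be := (gt (@Xn C m) m mu)@_(mpart m be).
pose r := [seq (la, mu) | la <- partitions n, mu <- partitions m].
have rP p : (p \in r) = (p.1 \in partitions n) && (p.2 \in partitions m).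
  apply/allpairsP/andP => [[[a b] /= [ha hb ->]] //|[ha hb]].
  by exists p; split => //; case: (p).
have K0 (p q : seq nat * seq nat) : Kx p.1 q.1 * Ky p.2 q.2 != 0 ->
    Kx p.1 q.1 != 0 /\ Ky p.2 q.2 != 0.
  move=> nz; split; apply: contraNneq nz => ->; by rewrite ?mul0r ?mulr0.
apply: (@unitriangular_zero _ C r (fun p q => Kx p.1 q.1 * Ky p.2 q.2)
   (fun p => c p.1 p.2) (fun p => dweight n p.1 + dweight m p.2)%N
   (fun p => Q p.1 p.2) _ _ _ _ _ (la, mu)).
- by apply: allpairs_uniq => [||[a b] [a' b'] _ _ [-> ->]] //; apply: partitions_uniq.
- move=> p; rewrite rP => /andP[h1 h2].
  by rewrite /Kx /Ky (kostka_diag _ (leqnn n) h1) (kostka_diag _ (leqnn m) h2) mulr1.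
- move=> [a b] [a' b']; rewrite !rP /= => /andP[h1 h2] /andP[h3 h4].
  move=> /(K0 (a, b) (a', b')) /= [k1 k2].
  case: (kostka_weight (leqnn n) h1 h3 k1) => [->|w1];
  case: (kostka_weight (leqnn m) h2 h4 k2) => [->|w2]; [by left| | |]; right; lia.
- move=> [a b] [a' b']; rewrite !rP /= => /andP[h1 h2] /andP[h3 h4] hq.
  move=> /(K0 (a, b) (a', b')) /= [k1 k2].
  apply: hQ hq _ _.
    exact: (kostka_part1 (leqnn n) h1 h3 k1).
  exact: (kostka_part1 (leqnn m) h2 h4 k2).
- move=> [a b]; rewrite rP /= => /andP[ha hb] hq.
  rewrite -[RHS](h0 a b ha hb hq) raddf_sum big_allpairs /= big_seq [RHS]big_seq.
  apply: eq_bigr => l /partitionsP [pl _]; rewrite raddf_sum big_seq [RHS]big_seq.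
  apply: eq_bigr => k /partitionsP [pk _] /=.
  by rewrite mcoeffZ schur_embx // schur_emby // mcoeff_emb.
- by rewrite rP hl hm.
Qed.

Lemma SF_expand d : (d <= minn n m)%N ->
  SF C n m d = \sum_(la <- partitions n) \sum_(mu <- partitions m)
     (common_strips la mu d)%:R *: ss la mu.
Proof.
move=> hd; rewrite /SF.
have pix nu : nu \in partitions d ->
    schur (@xv C n m) nu * hcomp (@xv C n m) (n - d) =
    \sum_(la <- partitions n | hstrip la nu) schur (@xv C n m) la.
  case/partitionsP => pn sn; rewrite schur_xE // (hcompE _ (leqnn _)).
  have -> : hser (n - d) (@xv C n m) = hser (n - d) (fun i : 'I_n => xn i).
    by apply: eq_hser => i; rewrite /xn valK.
  rewrite pieri // sn subnKC; last by lia.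
  rewrite big_seq_cond [RHS]big_seq_cond; apply: eq_bigr => la.
  by case/andP => /partitionsP [pl _] _; rewrite schur_xE.
have piy nu : nu \in partitions d ->
    schur (@yv C n m) nu * hcomp (@yv C n m) (m - d) =
    \sum_(la <- partitions m | hstrip la nu) schur (@yv C n m) la.
  case/partitionsP => pn sn; rewrite schur_yE // (hcompE _ (leqnn _)).
  have -> : hser (m - d) (@yv C n m) = hser (m - d) (fun i : 'I_m => yn i).
    by apply: eq_hser => i; rewrite /yn valK.
  rewrite pieri // sn subnKC; last by lia.
  rewrite big_seq_cond [RHS]big_seq_cond; apply: eq_bigr => la.
  by case/andP => /partitionsP [pl _] _; rewrite schur_yE.
transitivity (\sum_(nu <- partitions d) \sum_(la <- partitions n)
  \sum_(mu <- partitions m) ss la mu *+ (hstrip la nu && hstrip mu nu)).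
  rewrite big_seq [RHS]big_seq; apply: eq_bigr => nu hn.
  rewrite pix // piy // mulr_suml big_mkcond; apply: eq_bigr => la _.
  case: ifP => h1; last by rewrite big1 // => mu _; rewrite mulr0n.
  rewrite mulr_sumr big_mkcond; apply: eq_bigr => mu _.
  by case: ifP => h2; rewrite ?mulr1n ?mulr0n.
rewrite exchange_big; apply: eq_bigr => la _.
rewrite exchange_big; apply: eq_bigr => mu _ /=.
rewrite scaler_nat /common_strips -sum1_count -sumrMnr /= [RHS]big_mkcond /=.
by apply: eq_bigr => nu _; case: ifP.
Qed.

End SymT.

(** * Colourings and orbit counting *)

Section Burnside.
Variables (gT : finGroupType) (X Y : finType) (R : nzRingType).
Variables (act : X -> gT -> X) (D : pred X) (Phi : X -> Y) (w : Y -> R).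
Hypothesis actM : forall x g h, act x (g * h)%g = act (act x g) h.
Hypothesis actD : forall x g, D x -> D (act x g).
Hypothesis Phi_act : forall x g, D x -> Phi (act x g) = Phi x.
Hypothesis Phi_trans : forall x y, D x -> D y -> Phi x = Phi y ->
  exists g, act x g = y.

(** A weighted orbit count: [Phi] is a complete invariant, so its fibres on [D] are single orbits,
    and the stabilizer sizes along one orbit add up to the group order. *)
Lemma burnside :
  \sum_(g : gT) \sum_(x | D x && (act x g == x)) w (Phi x) =
  (\sum_(y in Phi @: [set x | D x]) w y) *+ #|gT|.
Proof.
rewrite (exchange_big_dep D) /=; last by move=> g x _ /andP[].
transitivity (\sum_(x | D x) w (Phi x) *+ #|[set g | act x g == x]|).
  apply: eq_bigr => x Dx; rewrite -sumr_const; apply: eq_bigl => g.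
  by rewrite Dx inE.
rewrite (partition_big Phi (mem (Phi @: [set x | D x]))) /=; last first.
  by move=> x Dx; apply: imset_f; rewrite inE.
rewrite -sumrMnl; apply: eq_bigr => y /imsetP [x0]; rewrite inE => Dx0 ->.
transitivity (\sum_(x | D x && (Phi x == Phi x0))
    w (Phi x0) *+ #|[set g | act x0 g == x]|).
  apply: eq_bigr => x /andP[Dx /eqP ex]; rewrite ex; congr (_ *+ _).
  have [t ht] := Phi_trans Dx0 Dx (esym ex).
  (* Left translation by [t] identifies the stabilizer of [x] with the elements carrying [x0] to
     [x]; summed over the orbit these partition the group. *)
  rewrite -(card_imset [set g | act x g == x] (mulgI t)).
  apply: eq_card => g; rewrite [RHS]inE.
  apply/imsetP/eqP => [[h + ->]|hg].
    by rewrite inE actM ht => /eqP.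
  exists (t^-1 * g)%g; last by rewrite mulKVg.
  by rewrite inE -{1}ht -actM mulKVg hg.
rewrite sumrMnr; congr (_ *+ _).
rewrite -cardsT -sum1_card (partition_big (act x0)
  (fun x => D x && (Phi x == Phi x0))) /=; last first.
  by move=> g _; rewrite actD ?Phi_act ?eqxx.
apply: eq_bigr => x _; rewrite -sum1_card; apply: eq_bigl => g.
by rewrite !inE.
Qed.

End Burnside.

Lemma perm_of_codom (I : finType) (K : eqType) (u v : I -> K) :
  (forall k, #|[set i | u i == k]| = #|[set i | v i == k]|) ->
  exists g : {perm I}, forall i, v (g i) = u i.
Proof.
move=> h.
have /tuple_permP [p e] : perm_eq (codom_tuple u) (codom_tuple v).
  apply/allP => k _ /=; apply/eqP.
  have cE (z : I -> K) : count_mem k (codom z) = #|[set i | z i == k]|.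
    rewrite /codom /image_mem count_map -size_filter cardE; congr size.
    rewrite /enum_mem -filter_predI; apply: eq_filter => i.
    by rewrite /= inE andbT.
  by rewrite [LHS]cE [RHS]cE h.
have inj : injective (fun i => enum_val (p (enum_rank i))).
  by move=> i j /enum_val_inj /perm_inj /enum_rank_inj.
exists (perm inj) => i; rewrite permE.
have -> : u i = tnth (codom_tuple u) (enum_rank i).
  by rewrite tnth_map /= (tnth_nth i) /= -enum_val_nth enum_rankK.
have -> : tnth (codom_tuple u) (enum_rank i) =
          nth (u i) (codom_tuple u) (enum_rank i) by apply: tnth_nth.
rewrite e (nth_map (enum_rank i)) ?size_enum_ord // nth_ord_enum.
by rewrite tnth_map /= (tnth_nth i) /= -enum_val_nth.
Qed.

Definition fixcol (n : nat) (K : eqType) (g : 'S_n) (f : 'I_n -> K) : bool :=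
  [forall i, f (g i) == f i].

Lemma fixcol_porbit (n : nat) (K : eqType) (g : 'S_n) (f : 'I_n -> K) i j :
  fixcol g f -> j \in porbit g i -> f j = f i.
Proof.
move=> /forallP h /porbitP [k ->]; elim: k => [|k IH]; first by rewrite perm1.
by rewrite expgSr permM (eqP (h _)).
Qed.

(** Expanding the product over cycles picks one colour per cycle, which amounts to a colouring
    invariant under [g]. Power sums thereby become generating functions of fixed points, the form
    that orbit counting requires. *)
Lemma pcyc_colourings (R : comNzRingType) (n : nat) (x : 'I_n -> R) (g : 'S_n) :
  pcyc x g = \sum_(f : {ffun 'I_n -> 'I_n} | fixcol g f) \prod_i x (f i).
Proof.
(* The distributivity lemma needs a default colour [ord0], so the empty case is separate. *)
case: n x g => [|n] x g.
  rewrite /pcyc big1 => [|c]; last first.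
    by case/imsetP => -[].
  rewrite (big_pred1 [ffun i => i]) => [|f].
    by rewrite big_ord0.
  by rewrite /=; apply/forallP/eqP => [_|_ []//]; apply/ffunP => -[].
rewrite /pcyc (big_distr_big_dep ord0) /=.
pose rep (c : {set 'I_n.+1}) := odflt ord0 [pick i in c].
have repP i : rep (porbit g i) \in porbit g i.
  rewrite /rep; case: pickP => [j //|/(_ i)]; by rewrite porbit_id.
pose h (f : {ffun 'I_n.+1 -> 'I_n.+1}) : {ffun {set 'I_n.+1} -> 'I_n.+1} :=
  [ffun c => if c \in porbits g then f (rep c) else ord0].
pose h' (F : {ffun {set 'I_n.+1} -> 'I_n.+1}) : {ffun 'I_n.+1 -> 'I_n.+1} :=
  [ffun i => F (porbit g i)].
have mo i : porbit g i \in porbits g by apply: imset_f.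
rewrite (reindex_onto h h') /=; last first.
  move=> F /pfamilyP [/supportP sF _]; apply/ffunP => c; rewrite !ffunE.
  case: ifP => hc; last by rewrite sF ?hc.
  case/imsetP: hc => i _ ->; congr (F _).
  by apply/eqP; rewrite eq_porbit_mem repP.
have fixE f : (h f \in pfamily ord0 (mem (porbits g)) (fun=> predT)) &&
    (h' (h f) == f) = fixcol g f.
  apply/andP/idP => [[_ /eqP e]|fx].
    apply/forallP => i; rewrite -e !ffunE !mo.
    have -> // : porbit g (g i) = porbit g i.
    by apply/eqP; rewrite eq_porbit_mem -{1}[g]expg1 mem_porbit.
  split.
    apply/pfamilyP; split => //; apply/supportP => c hc.
    by rewrite ffunE (negbTE hc).
  apply/eqP/ffunP => i; rewrite !ffunE mo.
  by apply: (fixcol_porbit fx).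
apply: eq_big => [f|f]; first exact: fixE.
rewrite fixE => fx.
rewrite [RHS](partition_big (porbit g) (mem (porbits g))) /=; last first.
  by move=> i _; exact: mo.
apply: eq_bigr => c hc; case/imsetP: (hc) => j _ e.
rewrite ffunE hc (eq_bigr (fun=> x (f (rep c)))); last first.
  move=> i; rewrite e eq_porbit_mem => hi; congr x.
  by rewrite (fixcol_porbit fx hi) (fixcol_porbit fx (repP j)).
rewrite prodr_const; congr (_ ^+ _); apply: eq_card => i.
by rewrite e -eq_porbit_mem [RHS]unfold_in.
Qed.

Section ColourAction.
Variables (n : nat) (K : finType).
Definition colact (f : {ffun 'I_n -> K}) (g : 'S_n) : {ffun 'I_n -> K} :=
  [ffun i => f (g^-1%g i)].

Lemma colactM f g h : colact f (g * h)%g = colact (colact f g) h.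
Proof. by apply/ffunP => i; rewrite !ffunE invMg permM. Qed.

Lemma colact1 f : colact f 1%g = f.
Proof. by apply/ffunP => i; rewrite !ffunE invg1 perm1. Qed.

Lemma colact_fix f g : (colact f g == f) = fixcol g f.
Proof.
apply/eqP/forallP => [/ffunP e i|e].
  by have := e (g i); rewrite ffunE permK => ->.
by apply/ffunP => i; rewrite ffunE -(eqP (e _)) permKV.
Qed.

End ColourAction.

Lemma card_codom_perm (n : nat) (K : eqType) (u : 'I_n -> K) (g : 'S_n) k :
  #|[set i | u (g i) == k]| = #|[set i | u i == k]|.
Proof.
rewrite -(card_imset _ (@perm_inj _ g)); apply: eq_card => i; rewrite inE.
apply/imsetP/idP => [[j + ->]|h]; first by rewrite inE.
by exists (g^-1%g i); rewrite ?inE permKV.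
Qed.

Section Content.
Variables (I K : finType) (D : nat).
Hypothesis ID : (#|I| <= D)%N.

(** Colour multiplicities are stored in ['I_D.+1] so that contents are the same objects as the
    exponent functions in [hser_content]. *)
Definition content (S : {set I}) (u : I -> K) : {ffun K -> 'I_D.+1} :=
  [ffun k => inord #|[set i in S | u i == k]|].

Lemma contentE S u k : content S u k = #|[set i in S | u i == k]| :> nat.
Proof.
rewrite ffunE inordK // ltnS; apply: leq_trans ID.
exact: max_card.
Qed.

Lemma content_sum S u : (\sum_k content S u k = #|S|)%N.
Proof.
under eq_bigr do rewrite contentE.
rewrite -[RHS]sum1_card (partition_big u predT) //=; apply: eq_bigr => k _.
by rewrite -sum1_card; apply: eq_bigl => i; rewrite inE.
Qed.

Lemma content_prod (R : comNzRingType) (z : K -> R) (S : {set I}) u :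
  \prod_(i in S) z (u i) = \prod_k z k ^+ content S u k.
Proof.
rewrite (partition_big u predT) //=; apply: eq_bigr => k _.
rewrite (eq_bigr (fun=> z k)) => [|i /andP[_ /eqP -> //]].
rewrite contentE prodr_const; congr (_ ^+ _); apply: eq_card => i.
by rewrite !inE.
Qed.

End Content.

Lemma content_imset (I I' K : finType) D (S : {set I}) (u : I' -> K) (phi : I -> I') :
  injective phi -> content D (phi @: S) u = content D S (u \o phi).
Proof.
move=> inj; apply/ffunP => k; rewrite !ffunE; congr inord.
rewrite -[RHS](card_imset _ inj); apply: eq_card => i; rewrite inE.
apply/andP/imsetP => [[/imsetP [j jS ->] e]|[j]].
  by exists j => //; rewrite inE jS.
by rewrite inE => /andP[jS e] ->; split => //; apply: imset_f.
Qed.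

Lemma eq_content (I K : finType) D (S : {set I}) (u v : I -> K) :
  {in S, u =1 v} -> content D S u = content D S v.
Proof.
move=> e; apply/ffunP => k; rewrite !ffunE; congr inord; apply: eq_card => i.
by rewrite !inE; case: (boolP (i \in S)) => //= /e ->.
Qed.

Lemma colouring_of_content (K : finType) (A : K -> nat) n : (\sum_k A k = n)%N ->
  exists u : 'I_n -> K, forall k, #|[set i | u i == k]| = A k.
Proof.
move=> sA; have [s hs] := content_seq A.
have ss : size s == n by rewrite size_content (eq_bigr _ (fun i _ => hs i)) sA.
exists (tnth (Tuple ss)) => k; rewrite -hs.
rewrite -[s in RHS]/(tval (Tuple ss)) -[tval _ in RHS]map_tnth_enum.
rewrite count_map -size_filter cardE; congr size.
by rewrite /enum_mem -filter_predI; apply: eq_filter => i; rewrite /= inE andbT.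
Qed.

(** Orbit counting on pairs of colourings: [g] fixes a pair when it fixes both members, and the
    orbits are the contents of the combined colouring, which the coefficient of the Cauchy kernel
    enumerates. *)
Lemma pcyc_orthogonal (R : comNzRingType) (n D : nat) (x y : 'I_n -> R) :
  (n <= D)%N ->
  \sum_(g : 'S_n) pcyc x g * pcyc y g =
  (hser D (fun ij : 'I_n * 'I_n => x ij.1 * y ij.2))`_n *+ n`!.
Proof.
move=> nD; have cD : (#|'I_n| <= D)%N by rewrite card_ord.
pose X := ({ffun 'I_n -> 'I_n} * {ffun 'I_n -> 'I_n})%type.
pose act (p : X) (g : 'S_n) : X := (colact p.1 g, colact p.2 g).
pose u (p : X) i := (p.1 i, p.2 i).
pose Phi (p : X) := content D setT (u p).
pose w (A : {ffun 'I_n * 'I_n -> 'I_D.+1}) :=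
  \prod_k (x k.1 * y k.2) ^+ A k.
have card_u p k : #|[set i | u p i == k]| = content D setT (u p) k.
  by rewrite contentE //; apply: eq_card => i; rewrite !inE.
have aM p g h : act p (g * h)%g = act (act p g) h.
  by rewrite /act /= !colactM.
have aP p g : predT p -> Phi (act p g) = Phi p.
  move=> _; rewrite /Phi; apply/ffunP => k; apply: val_inj => /=.
  rewrite -!card_u -(card_codom_perm (u (act p g)) g); apply: eq_card => i.
  by rewrite !inE /u /act /= !ffunE permK.
have aT p q : predT p -> predT q -> Phi p = Phi q -> exists g, act p g = q.
  move=> _ _ e.
  have [g hg] : exists g : 'S_n, forall i, u q (g i) = u p i.
    by apply: perm_of_codom => k; rewrite !card_u -/(Phi p) e.
  exists g; case: p q hg {e} => f f' [q q'] hg; congr pair; apply/ffunP => i.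
    by have := hg (g^-1%g i); rewrite /u permKV /= ffunE => -[<-].
  by have := hg (g^-1%g i); rewrite /u permKV /= ffunE => -[_ <-].
have -> : \sum_(g : 'S_n) pcyc x g * pcyc y g =
    \sum_g \sum_(p | predT p && (act p g == p)) w (Phi p).
  apply: eq_bigr => g _; rewrite !pcyc_colourings mulr_suml.
  under eq_bigr do rewrite mulr_sumr.
  rewrite pair_big_dep /=; apply: eq_big => [[f f']|[f f'] _] /=.
    by rewrite /act /= xpair_eqE !colact_fix.
  rewrite -big_split /w -(content_prod cD _ [set: 'I_n] (u (f, f'))) /=.
  by apply: eq_bigl => i; rewrite inE.
rewrite (burnside w aM (fun _ _ _ => isT) aP aT).
rewrite card_Sn; congr (_ *+ _); rewrite hser_content.
apply: eq_bigl => A; apply/imsetP/eqP => [[p _ ->]|sA].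
  by rewrite content_sum // cardsT card_ord.
have [v hv] := colouring_of_content sA.
exists ([ffun i => (v i).1], [ffun i => (v i).2]); first by rewrite inE.
apply/ffunP => k; apply: val_inj; rewrite /= -card_u -hv; apply: eq_card => i.
by rewrite !inE /u /= !ffunE; case: (v i).
Qed.

(** * Rook placements *)

Section Rooks.
Variables (n m : nat).
Implicit Types (P Q : {set 'I_n * 'I_m}).
Notation cell := ('I_n * 'I_m)%type.

Definition rook (P : {set cell}) : bool :=
  [forall c in P, forall c' in P,
     ((c.1 == c'.1) || (c.2 == c'.2)) ==> (c == c')].

Definition rookn (k : nat) (P : {set cell}) : bool := rook P && (#|P| == k).

Definition cellmap (p : 'S_n * 'S_m) (c : cell) : cell := (p.1 c.1, p.2 c.2).

Definition setact (P : {set cell}) (p : 'S_n * 'S_m) : {set cell} :=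
  cellmap p @: P.

Definition rows (P : {set cell}) : {set 'I_n} := [set c.1 | c in P].
Definition cols (P : {set cell}) : {set 'I_m} := [set c.2 | c in P].

Lemma rookP P : reflect
  ({in P &, forall c c', c.1 = c'.1 -> c = c'} /\
   {in P &, forall c c', c.2 = c'.2 -> c = c'}) (rook P).
Proof.
apply: (iffP forall_inP) => [h|[h1 h2] c cP].
  split=> c c' cP c'P e; have /forall_inP /(_ c' c'P) := h c cP;
  by rewrite e eqxx ?orbT => /eqP.
apply/forall_inP => c' c'P; apply/implyP => /orP[/eqP e|/eqP e]; apply/eqP.
  exact: h1.
exact: h2.
Qed.

Lemma rook_sub P Q : P \subset Q -> rook Q -> rook P.
Proof.
move=> /subsetP s /rookP [h1 h2]; apply/rookP.
by split=> c c' /s cQ /s c'Q; [apply: h1 | apply: h2].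
Qed.

Lemma rook_card_rows P : rook P -> #|rows P| = #|P|.
Proof. by move/rookP => [h _]; rewrite card_in_imset // => c c'; apply: h. Qed.

Lemma rook_card_cols P : rook P -> #|cols P| = #|P|.
Proof. by move/rookP => [_ h]; rewrite card_in_imset // => c c'; apply: h. Qed.

Lemma cellmap_inj p : injective (cellmap p).
Proof. by case=> a b [a' b'] [/perm_inj -> /perm_inj ->]. Qed.

Lemma setactM P p q : setact P (p * q)%g = setact (setact P p) q.
Proof.
rewrite /setact -imset_comp; apply: eq_imset => c /=.
by rewrite /cellmap /= !permM.
Qed.

Lemma setact1 P : setact P 1%g = P.
Proof.
rewrite /setact -[RHS]imset_id; apply: eq_imset => -[a b].
by rewrite /cellmap /= !perm1.
Qed.

Lemma mem_setact P p c : (cellmap p c \in setact P p) = (c \in P).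
Proof. exact: mem_imset (@cellmap_inj p). Qed.

Lemma setact_sub P Q p : (setact P p \subset setact Q p) = (P \subset Q).
Proof.
apply/subsetP/subsetP => h c; last first.
  by case/imsetP => d /h dQ ->; rewrite mem_setact.
by rewrite -(mem_setact P p) => /h; rewrite mem_setact.
Qed.

Lemma card_setact P p : #|setact P p| = #|P|.
Proof. exact: card_imset (@cellmap_inj p). Qed.

Lemma rook_setact P p : rook (setact P p) = rook P.
Proof.
have imp Q q : rook Q -> rook (setact Q q).
  move/rookP => [h1 h2]; apply/rookP.
  split=> _ _ /imsetP [c cQ ->] /imsetP [c' c'Q ->] /= /perm_inj e.
    by rewrite (h1 _ _ cQ c'Q e).
  by rewrite (h2 _ _ cQ c'Q e).
by apply/idP/idP => [/(imp _ p^-1%g)|/imp] //; rewrite -setactM mulgV setact1.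
Qed.

Lemma rookn_setact k P p : rookn k (setact P p) = rookn k P.
Proof. by rewrite /rookn rook_setact card_setact. Qed.

Lemma rows_setact P p : rows (setact P p) = p.1 @: rows P.
Proof. by rewrite /rows /setact -!imset_comp. Qed.

Lemma cols_setact P p : cols (setact P p) = p.2 @: cols P.
Proof. by rewrite /cols /setact -!imset_comp. Qed.

Lemma perm_imsetC (I : finType) (g : {perm I}) (S : {set I}) :
  ~: (g @: S) = g @: (~: S).
Proof.
apply/setP => i; rewrite -[i](permKV g) !inE !(mem_imset _ _ (@perm_inj _ g)).
by rewrite inE.
Qed.

Definition fixed_rooks (k : nat) (p : 'S_n * 'S_m) : nat :=
  #|[set P : {set cell} | rookn k P && (setact P p == P)]|.

Section RookColourings.
Variables (k D : nat) (K1 K2 : finType).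
Hypotheses (kn : (k <= n)%N) (km : (k <= m)%N).
Hypotheses (nD : (n <= D)%N) (mD : (m <= D)%N) (nmD : (n * m <= D)%N).

Notation X := ({set cell} * ({ffun 'I_n -> K1} * {ffun 'I_m -> K2}))%type.

Definition tri_act (t : X) (p : 'S_n * 'S_m) : X :=
  (setact t.1 p, (colact t.2.1 p.1, colact t.2.2 p.2)).

Definition pair_col (t : X) (c : cell) := (t.2.1 c.1, t.2.2 c.2).

(** The complete orbit invariant of a coloured placement: colour pairs on the rooks, colours of the
    free rows, colours of the free columns. The three components become the three factors of the
    Frobenius image. *)
Definition tri_content (t : X) :=
  (content D t.1 (pair_col t),
   (content D (~: rows t.1) t.2.1, content D (~: cols t.1) t.2.2)).

Let cellD : (#|{: cell}| <= D)%N.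
Proof. by rewrite card_prod !card_ord. Qed.
Let rowD : (#|'I_n| <= D)%N. Proof. by rewrite card_ord. Qed.
Let colD : (#|'I_m| <= D)%N. Proof. by rewrite card_ord. Qed.

Lemma tri_content_act t p : tri_content (tri_act t p) = tri_content t.
Proof.
rewrite /tri_content /tri_act /= rows_setact cols_setact !perm_imsetC.
rewrite !content_imset; try exact: perm_inj; try exact: cellmap_inj.
congr (_, (_, _)); apply: eq_content => i _ /=; rewrite ?ffunE ?permK //.
by rewrite /pair_col /= !ffunE !permK.
Qed.

Definition row_partner (P : {set cell}) (i : 'I_n) : option 'I_m :=
  [pick j | (i, j) \in P].
Definition col_partner (P : {set cell}) (j : 'I_m) : option 'I_n :=
  [pick i | (i, j) \in P].

Lemma row_partnerE P i j : rook P -> (row_partner P i == Some j) = ((i, j) \in P).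
Proof.
move/rookP => [h _]; rewrite /row_partner; case: pickP => [j' hj'|h0].
  apply/eqP/idP => [[<-] //|hj].
  by have [->] := h _ _ hj' hj erefl.
by rewrite h0.
Qed.

Lemma col_partnerE P i j : rook P -> (col_partner P j == Some i) = ((i, j) \in P).
Proof.
move/rookP => [_ h]; rewrite /col_partner; case: pickP => [i' hi'|h0].
  apply/eqP/idP => [[<-] //|hi].
  by have [->] := h _ _ hi' hi erefl.
by rewrite h0.
Qed.

Lemma row_partner_None P i : (row_partner P i == None) = (i \in ~: rows P).
Proof.
rewrite inE /row_partner; case: pickP => [j hj|h0].
  by apply/esym/negbTE; rewrite negbK; apply/imsetP; exists (i, j).
by apply/esym/imsetP => -[[a b] hc /= e]; have := h0 b; rewrite e hc.
Qed.

Lemma col_partner_None P j : (col_partner P j == None) = (j \in ~: cols P).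
Proof.
rewrite inE /col_partner; case: pickP => [i hi|h0].
  by apply/esym/negbTE; rewrite negbK; apply/imsetP; exists (i, j).
by apply/esym/imsetP => -[[a b] hc /= e]; have := h0 a; rewrite e hc.
Qed.

(* First match the rows by their colour and the colour of their partner, then
   the columns by their colour and the name of their partner. *)
Lemma tri_transitive t t' : rookn k t.1 -> rookn k t'.1 ->
  tri_content t = tri_content t' -> exists p, tri_act t p = t'.
Proof.
case: t t' => P [f1 f2] [Q [e1 e2]] /= /andP[rP _] /andP[rQ _].
rewrite /tri_content /= => -[/ffunP hA /ffunP hb /ffunP hc].
pose F (S : {set cell}) (u1 : 'I_n -> K1) (u2 : 'I_m -> K2) i :=
  (u1 i, omap u2 (row_partner S i)).
have cardF S u1 u2 a b : rook S ->
    #|[set i | F S u1 u2 i == (a, Some b)]| =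
    #|[set c in S | (u1 c.1, u2 c.2) == (a, b)]|.
  move=> rS; have /rookP [h _] := rS.
  rewrite -[RHS](@card_in_imset _ _ (fun c : cell => c.1)); last first.
    by move=> c c'; rewrite !inE => /andP[cS _] /andP[c'S _]; exact: h.
  apply: eq_card => i; rewrite inE /F xpair_eqE; apply/andP/imsetP.
    case=> /eqP <-; case ej : (row_partner S i) => [j|//] /eqP [<-].
    exists (i, j) => //; rewrite inE -row_partnerE // ej eqxx /=.
    by rewrite eqxx.
  case=> -[i' j]; rewrite inE => /andP[iS /eqP [<- <-]] ->; split => //.
  by have /eqP -> : row_partner S i' == Some j by rewrite row_partnerE.
have cardF0 S u1 u2 a :
    #|[set i | F S u1 u2 i == (a, None)]| = #|[set i in ~: rows S | u1 i == a]|.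
  apply: eq_card => i; rewrite !in_set -in_setC -row_partner_None /F xpair_eqE andbC.
  by case: (row_partner S i).
have [g hg] : exists g : 'S_n, forall i, F Q e1 e2 (g i) = F P f1 f2 i.
  apply: perm_of_codom => -[a [b|]].
    have /(congr1 val) := hA (a, b).
    by rewrite /= !contentE // !cardF.
  by have /(congr1 val) := hb a; rewrite /= !contentE // !cardF0.
pose H (S : {set cell}) (u2 : 'I_m -> K2) (v : 'I_n -> 'I_n) j :=
  (u2 j, omap v (col_partner S j)).
have cardH0 S u2 v b :
    #|[set j | H S u2 v j == (b, None)]| = #|[set j in ~: cols S | u2 j == b]|.
  apply: eq_card => j; rewrite !in_set -in_setC -col_partner_None /H xpair_eqE andbC.
  by case: (col_partner S j).
have cardH S u1 u2 (v : 'S_n) b i : rook S ->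
    #|[set j | H S u2 v^-1%g j == (b, Some i)]| =
    ((F S u1 u2 (v i)).2 == Some b).
  move=> rS; rewrite /F /=; case ej : (row_partner S (v i)) => [j|] /=.
    have hj : (v i, j) \in S by rewrite -row_partnerE // ej.
    have eqj : [set j' | H S u2 v^-1%g j' == (b, Some i)] =
        if u2 j == b then [set j] else set0.
      apply/setP => j'; rewrite inE /H xpair_eqE.
      transitivity ((u2 j' == b) && (j' == j)).
        congr (_ && _); apply/idP/eqP => [|->]; last first.
          by have /eqP -> /= : col_partner S j == Some (v i); rewrite ?col_partnerE // permK.
        case ei : (col_partner S j') => [i'|//] /eqP [/(congr1 v)].
        rewrite permKV => ei'.
        have hj' : (v i, j') \in S by rewrite -col_partnerE // ei ei'.
        have /rookP [h _] := rS.
        by have [] := h _ _ hj' hj erefl.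
      by case: ifP => h; rewrite !inE; case: (j' =P j) => [->|_]; rewrite ?h ?andbF ?andbT.
    rewrite eqj (_ : (Some (u2 j) == Some b) = (u2 j == b)) //.
    by case: (u2 j == b); rewrite ?cards1 ?cards0.
  rewrite (_ : [set _ | _] = set0) ?cards0 //; apply/setP => j; rewrite !inE.
  apply/negP; rewrite /H xpair_eqE => /andP[_].
  case ei : (col_partner S j) => [i'|//] /= /eqP [/(congr1 v)].
  rewrite permKV => ei'; have : (v i, j) \in S by rewrite -col_partnerE // ei ei'.
  by rewrite -row_partnerE // ej.
have [h hh] : exists h : 'S_m, forall j, H Q e2 g^-1%g (h j) = H P f2 id j.
  apply: perm_of_codom => -[b [i|]].
    have := cardH P f1 f2 1%g b i rP; rewrite perm1 invg1.
    have -> : [set j | H P f2 (1%g : 'S_n) j == (b, Some i)] =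
              [set j | H P f2 id j == (b, Some i)].
      apply/setP => j; rewrite !inE /H; congr ((_, _) == _).
      by case: (col_partner P j) => //= a; rewrite perm1.
    by move=> ->; rewrite (cardH Q e1 e2 g b i rQ) hg.
  by have /(congr1 val) := hc b; rewrite /= !contentE // !cardH0.
exists (g, h); rewrite /tri_act /=; congr (_, (_, _)).
- apply/setP => -[i j].
  have -> : (i, j) = cellmap (g, h) (g^-1%g i, h^-1%g j).
    by rewrite /cellmap /= !permKV.
  rewrite mem_setact /cellmap /= -!col_partnerE //.
  move: (g^-1%g i) (h^-1%g j) => a b.
  have [_] := hh b; rewrite /H.
  case: (col_partner Q _) => [i'|]; case: (col_partner P b) => [a'|] //= -[<-].
  apply/eqP/eqP => -[e]; congr Some; first by rewrite -e permKV.
  by rewrite e permK.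
- apply/ffunP => i; rewrite ffunE; have := hg (g^-1%g i).
  by rewrite permKV => -[<- _].
- apply/ffunP => j; rewrite ffunE; have := hh (h^-1%g j).
  by rewrite permKV => -[<- _].
Qed.

End RookColourings.

End Rooks.

(** The rooks lie on the diagonal. Writing the dimensions as sums lets [split] separate occupied
    rows and columns from free ones. *)
Lemma tri_realize (k a b D : nat) (K1 K2 : finType)
    (A : {ffun K1 * K2 -> 'I_D.+1}) (B : {ffun K1 -> 'I_D.+1})
    (B' : {ffun K2 -> 'I_D.+1}) :
  (k + a <= D)%N -> (k + b <= D)%N -> ((k + a) * (k + b) <= D)%N ->
  (\sum_i A i = k)%N -> (\sum_i B i = a)%N -> (\sum_i B' i = b)%N ->
  exists t : {set 'I_(k + a) * 'I_(k + b)} *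
     ({ffun 'I_(k + a) -> K1} * {ffun 'I_(k + b) -> K2}),
  rookn k t.1 /\ tri_content D t = (A, (B, B')).
Proof.
move=> aD bD abD sA sB sB'.
have [u hu] := colouring_of_content sA.
have [v hv] := colouring_of_content sB.
have [v' hv'] := colouring_of_content sB'.
pose f : {ffun 'I_(k + a) -> K1} :=
  [ffun i => match split i with inl r => (u r).1 | inr s => v s end].
pose f' : {ffun 'I_(k + b) -> K2} :=
  [ffun i => match split i with inl r => (u r).2 | inr s => v' s end].
pose d (r : 'I_k) : 'I_(k + a) * 'I_(k + b) := (lshift a r, lshift b r).
have fl r : f (lshift a r) = (u r).1.
  by rewrite ffunE -[lshift a r]/(unsplit (inl r)) unsplitK.
have fr s : f (rshift k s) = v s.
  by rewrite ffunE -[rshift k s]/(unsplit (inr s)) unsplitK.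
have fl' r : f' (lshift b r) = (u r).2.
  by rewrite ffunE -[lshift b r]/(unsplit (inl r)) unsplitK.
have fr' s : f' (rshift k s) = v' s.
  by rewrite ffunE -[rshift k s]/(unsplit (inr s)) unsplitK.
have di : injective d by move=> r r' [/val_inj].
pose P := d @: [set: 'I_k].
have rC : ~: rows P = (fun s : 'I_a => rshift k s) @: [set: 'I_a].
  apply/setP => i; rewrite inE; apply/negP/imsetP => [h|[s _ ->] /imsetP].
    case: (splitP i) => [r e|s e].
      case: h; apply/imsetP; exists (d r); first exact: imset_f.
      exact: val_inj.
    by exists s => //; apply: val_inj.
  case=> _ /imsetP [r _ ->] /(congr1 val) /= e.
  by have := ltn_ord r; rewrite -e; lia.
have cC : ~: cols P = (fun s : 'I_b => rshift k s) @: [set: 'I_b].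
  apply/setP => i; rewrite inE; apply/negP/imsetP => [h|[s _ ->] /imsetP].
    case: (splitP i) => [r e|s e].
      case: h; apply/imsetP; exists (d r); first exact: imset_f.
      exact: val_inj.
    by exists s => //; apply: val_inj.
  case=> _ /imsetP [r _ ->] /(congr1 val) /= e.
  by have := ltn_ord r; rewrite -e; lia.
have kD : (#|'I_k| <= D)%N by rewrite card_ord; lia.
have aD' : (#|'I_a| <= D)%N by rewrite card_ord; lia.
have bD' : (#|'I_b| <= D)%N by rewrite card_ord; lia.
exists (P, (f, f')); split.
  rewrite /rookn /= card_imset // cardsT card_ord eqxx andbT; apply/rookP.
  by split=> _ _ /imsetP [r _ ->] /imsetP [r' _ ->] /= /lshift_inj ->.
rewrite /tri_content /= rC cC /P !content_imset //; try exact: rshift_inj.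
congr (_, (_, _)); apply/ffunP => i; apply: val_inj; rewrite /= contentE //.
- rewrite -hu; apply: eq_card => r; rewrite !inE /pair_col /= fl fl'.
  by case: (u r).
- by rewrite -hv; apply: eq_card => r; rewrite !inE /= fr.
- by rewrite -hv'; apply: eq_card => r; rewrite !inE /= fr'.
Qed.

Lemma rook_colouring_exists (n m k D : nat) (K1 K2 : finType)
    (A : {ffun K1 * K2 -> 'I_D.+1}) (B : {ffun K1 -> 'I_D.+1})
    (B' : {ffun K2 -> 'I_D.+1}) :
  (k <= n)%N -> (k <= m)%N ->
  (n <= D)%N -> (m <= D)%N -> (n * m <= D)%N ->
  (\sum_i A i = k)%N -> (\sum_i B i = n - k)%N -> (\sum_i B' i = m - k)%N ->
  exists t : {set 'I_n * 'I_m} * ({ffun 'I_n -> K1} * {ffun 'I_m -> K2}),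
  rookn k t.1 /\ tri_content D t = (A, (B, B')).
Proof.
move=> kn km.
have en : n = (k + (n - k))%N by rewrite subnKC.
have em : m = (k + (m - k))%N by rewrite subnKC.
move: (n - k)%N (m - k)%N en em => a b en em; subst n m.
exact: tri_realize.
Qed.

(** Orbit counting for coloured placements. Up to the group order, the Frobenius image of the
    permutation module on [k]-placements is the degree [k] part of the Cauchy kernel times [h_(n-k)]
    in [x] and [h_(m-k)] in [y]. *)
Lemma fixed_rooks_pcyc (R : comNzRingType) (n m k D : nat)
    (x : 'I_n -> R) (y : 'I_m -> R) :
  (k <= n)%N -> (k <= m)%N ->
  (n <= D)%N -> (m <= D)%N -> (n * m <= D)%N ->
  \sum_(g : 'S_n) \sum_(h : 'S_m)
     (fixed_rooks k (g, h))%:R * (pcyc x g * pcyc y h) =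
  ((hser D (fun ij : 'I_n * 'I_m => x ij.1 * y ij.2))`_k *
     ((hser D x)`_(n - k) * (hser D y)`_(m - k))) *+ (n`! * m`!).
Proof.
move=> kn km nD mD nmD.
pose X := ({set 'I_n * 'I_m} * ({ffun 'I_n -> 'I_n} * {ffun 'I_m -> 'I_m}))%type.
pose DX (t : X) := rookn k t.1.
pose w (y0 : {ffun 'I_n * 'I_m -> 'I_D.+1} *
   ({ffun 'I_n -> 'I_D.+1} * {ffun 'I_m -> 'I_D.+1})) : R :=
  (\prod_ij (x ij.1 * y ij.2) ^+ y0.1 ij) *
  ((\prod_i x i ^+ y0.2.1 i) * (\prod_j y j ^+ y0.2.2 j)).
have cellD : (#|{: 'I_n * 'I_m}| <= D)%N by rewrite card_prod !card_ord.
have rowD : (#|'I_n| <= D)%N by rewrite card_ord.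
have colD : (#|'I_m| <= D)%N by rewrite card_ord.
have wE (t : X) : DX t -> (\prod_i x (t.2.1 i)) * (\prod_j y (t.2.2 j)) =
    w (tri_content D t).
  case: t => P [f f'] /= /andP[/rookP [h1 h2] _].
  rewrite /w /= -!content_prod // /pair_col /=.
  rewrite (bigID (mem (rows P))) /= [X in _ * X = _](bigID (mem (cols P))) /=.
  rewrite big_imset => [/=|c c' cP c'P]; last exact: h1.
  rewrite [X in _ * (X * _) = _]big_imset => [/=|c c' cP c'P]; last exact: h2.
  rewrite mulrACA -big_split /=; congr (_ * (_ * _)); apply: eq_bigl => i.
    by rewrite inE.
  by rewrite inE.
transitivity (\sum_(p : 'S_n * 'S_m) \sum_(t | DX t && (tri_act t p == t))
    w (tri_content D t)).
  rewrite pair_bigA; apply: eq_bigr => -[g h] _ /=.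
  rewrite /fixed_rooks -sum1_card natr_sum mulr_suml !pcyc_colourings.
  transitivity (\sum_(P | rookn k P && (setact P (g, h) == P))
     \sum_(q : {ffun 'I_n -> 'I_n} * {ffun 'I_m -> 'I_m} |
             fixcol g q.1 && fixcol h q.2)
        (\prod_i x (q.1 i)) * (\prod_j y (q.2 j))).
    apply: eq_big => [P|P _]; first by rewrite inE.
    rewrite mul1r mulr_suml -(pair_big_dep (fun f : {ffun 'I_n -> 'I_n} => fixcol g f)
      (fun _ (f' : {ffun 'I_m -> 'I_m}) => fixcol h f')
      (fun f f' => (\prod_i x (f i)) * (\prod_j y (f' j)))) /=.
    by apply: eq_bigr => f _; rewrite mulr_sumr.
  rewrite pair_big_dep /=; apply: eq_big => [[P [f f']]|[P [f f']]] /=.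
    by rewrite /tri_act /= !xpair_eqE /= !colact_fix /DX /= -!andbA.
  by case/andP => /andP[rP _] _; rewrite -wE.
rewrite (@burnside _ _ _ _ _ DX (fun t : X => tri_content D t) w); first last.
- by move=> t t' Dt Dt' e; apply: (tri_transitive nD mD nmD Dt Dt' e).
- by move=> t p _; exact: tri_content_act.
- by move=> t p; rewrite /DX /= rookn_setact.
- by move=> t p q; rewrite /tri_act /= setactM !colactM.
rewrite card_prod !card_Sn; congr (_ *+ _).
rewrite !hser_content.
have imE (q : {ffun 'I_n * 'I_m -> 'I_D.+1} *
      ({ffun 'I_n -> 'I_D.+1} * {ffun 'I_m -> 'I_D.+1})) :
    (q \in (fun t : X => tri_content D t) @: [set t : X | DX t]) =
    [&& (\sum_i q.1 i == k)%N, (\sum_i q.2.1 i == n - k)%N &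
        (\sum_i q.2.2 i == m - k)%N].
  apply/imsetP/and3P => [[t]|[/eqP s1 /eqP s2 /eqP s3]].
    rewrite inE => /andP[rt /eqP ct] ->; rewrite /tri_content /= !content_sum //.
    have := cardsC (rows t.1); have := cardsC (cols t.1).
    rewrite rook_card_rows // rook_card_cols // ct !card_ord => e1 e2.
    by split => //; apply/eqP; [rewrite -[in RHS]e2|rewrite -[in RHS]e1]; rewrite addKn.
  case: q s1 s2 s3 => A [B B'] /= s1 s2 s3.
  have [t [rt ct]] := rook_colouring_exists kn km nD mD nmD s1 s2 s3.
  by exists t; rewrite ?inE ?ct.
rewrite (eq_bigl _ _ imE) mulr_suml.
transitivity (\sum_(A : {ffun 'I_n * 'I_m -> 'I_D.+1} | (\sum_i A i == k)%N)
   \sum_(q : {ffun 'I_n -> 'I_D.+1} * {ffun 'I_m -> 'I_D.+1} |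
      (\sum_i q.1 i == n - k)%N && (\sum_i q.2 i == m - k)%N) w (A, q)).
  by rewrite pair_big_dep; apply: eq_big => [[A q]|[A q] _].
apply: eq_bigr => A _.
rewrite mulr_suml mulr_sumr -(pair_big_dep
  (fun B : {ffun 'I_n -> 'I_D.+1} => (\sum_i B i == n - k)%N)
  (fun _ (B' : {ffun 'I_m -> 'I_D.+1}) => (\sum_i B' i == m - k)%N)
  (fun B B' => w (A, (B, B')))) /=.
by apply: eq_bigr => B _; rewrite !mulr_sumr; apply: eq_bigr.
Qed.

(** * Irreducible characters of symmetric groups *)

Lemma rmorph_pcyc (R S : comNzRingType) (f : {rmorphism R -> S}) n
    (x : 'I_n -> R) g : f (pcyc x g) = pcyc (fun i => f (x i)) g.
Proof.
rewrite /pcyc rmorph_prod; apply: eq_bigr => c _.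
by rewrite rmorph_sum; apply: eq_bigr => i _; rewrite rmorphXn.
Qed.

Lemma eq_pcyc (R : comNzRingType) n (x y : 'I_n -> R) g :
  x =1 y -> pcyc x g = pcyc y g.
Proof.
by move=> e; apply: eq_bigr => c _; apply: eq_bigr => i _; rewrite e.
Qed.

Section Psi.
Variable n : nat.
Notation Xi := (fun i : 'I_n => 'X_i : {mpoly int[n]}).

Definition colour_mnm (f : 'I_n -> 'I_n) : 'X_{1..n} := (\sum_i U_(f i))%MM.

Lemma pcyc_mpoly (R : comNzRingType) (g : 'S_n) :
  pcyc (fun i : 'I_n => 'X_i : {mpoly R[n]}) g =
  \sum_(f : {ffun 'I_n -> 'I_n} | fixcol g f) 'X_[colour_mnm f].
Proof.
by rewrite pcyc_colourings; apply: eq_bigr => f _; rewrite mprodXE.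
Qed.

Lemma pcyc_coef (R : comNzRingType) (g : 'S_n) t :
  (pcyc (fun i : 'I_n => 'X_i : {mpoly R[n]}) g)@_t =
  #|[set f : {ffun 'I_n -> 'I_n} | fixcol g f && (colour_mnm f == t)]|%:R.
Proof.
rewrite pcyc_mpoly raddf_sum /= -sum1_card natr_sum big_mkcond [RHS]big_mkcond /=.
apply: eq_bigr => f _; rewrite inE mcoeffX.
by case: ifP => //= _; case: ifP.
Qed.

Lemma pcyc_schur (g : 'S_n) : exists c : seq nat -> int,
  pcyc Xi g = \sum_(la <- partitions n) c la *: gt (@Xn int n) n la.
Proof.
apply: schur_expand => [s|t].
  rewrite /msym rmorph_pcyc /pcyc; apply: eq_bigr => c _.
  rewrite [RHS](reindex_inj (@perm_inj _ s)); apply: eq_bigr => i _ /=.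
  by rewrite mmapX mmap1U.
rewrite pcyc_coef pnatr_eq0 cards_eq0 => /set0Pn [f].
rewrite inE => /andP[_ /eqP <-]; rewrite mdeg_sum.
by under eq_bigr do rewrite mdeg1; rewrite sum1_card card_ord.
Qed.

(* The irreducible character values, read off from Frobenius' formula. *)
Definition psi : seq nat -> 'S_n -> int :=
  epsilon (inhabits (fun _ _ => 0)) (fun c => forall g : 'S_n,
    pcyc Xi g = \sum_(la <- partitions n) c la g *: gt (@Xn int n) n la).

Lemma psiP (g : 'S_n) :
  pcyc Xi g = \sum_(la <- partitions n) psi la g *: gt (@Xn int n) n la.
Proof.
have h : exists c : seq nat -> 'S_n -> int, forall g : 'S_n,
    pcyc Xi g = \sum_(la <- partitions n) c la g *: gt (@Xn int n) n la.
  have [c hc] := fin_all_exists (fun g : 'S_n => pcyc_schur g).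
  by exists (fun la g => c g la).
exact: (epsilon_spec _ _ h g).
Qed.

Lemma pcyc_psi (R : comNzRingType) (x : 'I_n -> R) (g : 'S_n) :
  pcyc x g = \sum_(la <- partitions n) (psi la g)%:~R * schur x la.
Proof.
pose f : {mpoly int[n]} -> R := mmap (intr : int -> R) x.
have fX i : f 'X_i = x i by rewrite /f mmapX mmap1U.
have := congr1 f (psiP g); rewrite /f rmorph_pcyc rmorph_sum /= -/f.
rewrite (eq_pcyc _ fX) => ->; rewrite big_seq [RHS]big_seq.
apply: eq_bigr => la /partitionsP [pl _]; rewrite /f mmapZ rmorph_gt; congr (_ * _).
pose x' (i : nat) : R := if insub i is Some k then x k else 0.
rewrite (eq_schur (y := fun i : 'I_n => x' i)); last by move=> i; rewrite /x' valK.
rewrite schurE //; apply: eq_gt => i hi /=.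
by rewrite -[i]/(val (Ordinal hi)) XnE /x' valK mmapX mmap1U.
Qed.

(** The Cauchy kernel has two expansions, by power sums through [pcyc_orthogonal] and by Schur
    polynomials through [cauchy]; independence of the products of Schur polynomials allows comparing
    coefficients. *)
Lemma psi_orthogonal la mu : la \in partitions n -> mu \in partitions n ->
  \sum_(g : 'S_n) psi la g * psi mu g = (n`!)%:R * (la == mu)%:R.
Proof.
move=> hl hm; apply/eqP; rewrite -subr_eq0; apply/eqP.
apply: (@schur_pair_free int n n (fun _ _ => true)
  (fun la mu => \sum_(g : 'S_n) psi la g * psi mu g - (n`!)%:R * (la == mu)%:R))
  => // {la mu hl hm} al be _ _ _.
rewrite [X in X@__](_ : _ = 0) ?mcoeff0 //.
pose s la mu := schur (@xv int n n) la * schur (@yv int n n) mu.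
have -> : \sum_(la <- partitions n) \sum_(mu <- partitions n)
   (\sum_(g : 'S_n) psi la g * psi mu g - (n`!)%:R * (la == mu)%:R) *: s la mu =
   \sum_(g : 'S_n) pcyc (@xv int n n) g * pcyc (@yv int n n) g -
   (\sum_(la <- partitions n) s la la) *+ n`!.
  have -> : \sum_(g : 'S_n) pcyc (@xv int n n) g * pcyc (@yv int n n) g =
     \sum_(la <- partitions n) \sum_(mu <- partitions n)
       (\sum_(g : 'S_n) psi la g * psi mu g) *: s la mu.
    under eq_bigr do rewrite !pcyc_psi mulr_suml.
    rewrite exchange_big; apply: eq_bigr => la _ /=.
    under eq_bigr do rewrite mulr_sumr.
    rewrite exchange_big; apply: eq_bigr => mu _ /=.
    rewrite scaler_suml; apply: eq_bigr => g _.
    by rewrite mulrACA -intrM mulrzl -scaler_int intz.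
  rewrite -sumrMnl -sumrB big_seq [RHS]big_seq; apply: eq_bigr => la hl.
  under eq_bigr do rewrite scalerBl.
  rewrite sumrB; congr (_ - _).
  rewrite (bigD1_seq la) ?partitions_uniq //= eqxx mulr1 scaler_nat big1 ?addr0 //.
  by move=> mu; rewrite eq_sym => /negbTE ->; rewrite mulr0 scale0r.
rewrite (pcyc_orthogonal _ _ (leqnn n)).
have -> : hser n (fun ij : 'I_n * 'I_n => xv int n ij.1 * yv int n ij.2) =
   hser n (fun ij : 'I_n * 'I_n => xn int n n ij.1 * yn int n n ij.2).
  by apply: eq_hser => ij; rewrite /xn /yn !valK.
rewrite -cauchy // (_ : \sum_(la <- _) gt _ _ la * _ = \sum_(la <- partitions n) s la la).
  by rewrite subrr.
rewrite big_seq [RHS]big_seq; apply: eq_bigr => la /partitionsP [pl _].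
by rewrite /s schur_xE // schur_yE.
Qed.

End Psi.

(** * Permutation modules and their traces *)

Section PermutationModule.
Variables (gT : finGroupType) (X : finType) (act : X -> gT -> X).
Hypothesis actM : forall x g h, act x (g * h)%g = act (act x g) h.
Hypothesis act1 : forall x, act x 1%g = x.

Definition pmx (F : fieldType) (g : gT) : 'M[F]_#|X| :=
  \matrix_(i, j) (act (enum_val i) g == enum_val j)%:R.

Definition dmx (F : fieldType) (D : pred X) : 'M[F]_#|X| :=
  \matrix_(i, j) ((i == j) && D (enum_val i))%:R.

Section OneField.
Variable F : fieldType.

Lemma sum_enum_rank (V : nmodType) (G : 'I_#|X| -> V) (x : X) :
  (forall i, i != enum_rank x -> G i = 0) -> \sum_i G i = G (enum_rank x).
Proof. by move=> h; rewrite (bigD1 (enum_rank x)) //= big1 ?addr0. Qed.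

Lemma pmxM g h : pmx F (g * h)%g = pmx F g *m pmx F h.
Proof.
apply/matrixP => i j; rewrite !mxE (@sum_enum_rank _ _ (act (enum_val i) g)).
  by rewrite !mxE enum_rankK eqxx mul1r actM.
move=> k hk; rewrite !mxE (_ : (_ == enum_val k) = false) ?mul0r //.
by apply: contraNF hk => /eqP ->; rewrite enum_valK.
Qed.

Lemma pmx1 : pmx F 1%g = 1%:M.
Proof.
apply/matrixP => i j; rewrite !mxE act1 (inj_eq enum_val_inj).
by [].
Qed.

Lemma dmx_idem D : dmx F D *m dmx F D = dmx F D.
Proof.
apply/matrixP => i j; rewrite !mxE (bigD1 i) //= big1 => [|k ki].
  by rewrite !mxE eqxx addr0 /= -natrM mulnb andbCA andbb.
by rewrite !mxE eq_sym (negbTE ki) mul0r.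
Qed.

Lemma dmxC D g : (forall x, D (act x g) = D x) ->
  dmx F D *m pmx F g = pmx F g *m dmx F D.
Proof.
move=> h; apply/matrixP => i j; rewrite !mxE.
transitivity ((D (enum_val i))%:R * (act (enum_val i) g == enum_val j)%:R : F).
  rewrite (bigD1 i) //= big1 => [|k ki]; first by rewrite !mxE eqxx addr0.
  by rewrite !mxE eq_sym (negbTE ki) mul0r.
symmetry; rewrite (bigD1 j) //= big1 => [|k kj].
  rewrite !mxE eqxx addr0 -!natrM !mulnb /=; congr _%:R; congr nat_of_bool.
  by rewrite andbC; case: eqP => [<-|_]; rewrite ?h ?andbT ?andbF.
by rewrite !mxE (negbTE kj) mulr0.
Qed.

Lemma dmx_stable D g : (forall x, D (act x g) = D x) ->
  stablemx (dmx F D) (pmx F g).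
Proof. by move=> h; rewrite dmxC // submxMl. Qed.

Lemma trace_on_dmx D g : (forall x, D (act x g) = D x) ->
  trace_on (dmx F D) (pmx F g) = #|[set x | D x && (act x g == x)]|%:R.
Proof.
move=> h; rewrite trace_on_idem ?dmx_idem ?dmx_stable // /mxtrace.
rewrite -sum1_card natr_sum [RHS]big_mkcond /=.
rewrite [RHS](reindex _ (onW_bij _ (enum_val_bij X))) /=.
apply: eq_bigr => i _; rewrite !mxE (bigD1 i) //= big1 => [|k ki].
  rewrite !mxE eqxx /= addr0 -natrM mulnb inE.
  by case: ifP.
by rewrite !mxE eq_sym (negbTE ki) mul0r.
Qed.

End OneField.

Lemma map_pmx (F F' : fieldType) (f : {rmorphism F -> F'}) g :
  map_mx f (pmx F g) = pmx F' g.
Proof. by apply/matrixP => i j; rewrite !mxE rmorph_nat. Qed.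

Lemma pmx_repr : mx_repr [set: gT] (pmx algC).
Proof. by split=> [|g h _ _]; rewrite ?pmx1 ?pmxM. Qed.

Definition perm_repr := MxRepresentation pmx_repr.

(** The bridge from [trace_on] to the library's characters: a stable row space is a submodule, and
    its own basis computes the same trace. *)
Lemma trace_on_character (U : 'M[algC]_#|X|) :
  (forall g, stablemx U (pmx algC g)) ->
  exists2 chi : 'CF([set: gT]), chi \is a character &
    forall g, chi g = trace_on U (pmx algC g).
Proof.
move=> st; have mU : mxmodule perm_repr U.
  by apply/mxmoduleP => g _; exact: st.
exists (cfRepr (submod_repr mU)); first exact: cfRepr_char.
move=> g; rewrite cfunE inE mulr1n; symmetry.
apply: (@trace_onE _ _ _ U (pmx algC g) (val_submod 1%:M)).
- by rewrite /row_free (val_submod1 U).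
- exact: val_submod1.
- have := val_submodJ mU 1%:M (in_setT g); rewrite mul1mx => <-.
  exact: val_submodE.
Qed.

End PermutationModule.

(** * Frobenius coefficients as scalar products *)

Section Coefficients.
Variables (n m : nat).
Notation G := ([set: 'S_n * 'S_m])%g.

(** A scalar product of class functions; conjugation is absent because [psi] has integer values, so
    the formula makes sense over any field. *)
Definition fcoef (F : fieldType) (la mu : seq nat) (chi : 'S_n -> 'S_m -> F) : F :=
  (n`! * m`!)%:R^-1 *
  \sum_(g : 'S_n) \sum_(h : 'S_m) chi g h * ((psi la g * psi mu h)%:~R).

Lemma Frob_coef (F : fieldType) (chi : 'S_n -> 'S_m -> F) :
  Frob chi = \sum_(la <- partitions n) \sum_(mu <- partitions m)
     fcoef la mu chi *: (schur (@xv F n m) la * schur (@yv F n m) mu).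
Proof.
rewrite /Frob; under [RHS]eq_bigr do under eq_bigr do
  rewrite /fcoef -scalerA.
under [RHS]eq_bigr do rewrite -scaler_sumr.
rewrite -scaler_sumr; congr (_ *: _).
transitivity (\sum_(la <- partitions n) \sum_(mu <- partitions m)
  \sum_(g : 'S_n) \sum_(h : 'S_m) (chi g h * ((psi la g * psi mu h)%:~R)) *:
    (schur (@xv F n m) la * schur (@yv F n m) mu)); last first.
  apply: eq_bigr => la _; apply: eq_bigr => mu _; rewrite scaler_suml.
  by apply: eq_bigr => g _; rewrite scaler_suml.
transitivity (\sum_(g : 'S_n) \sum_(h : 'S_m) \sum_(la <- partitions n)
  \sum_(mu <- partitions m) (chi g h * ((psi la g * psi mu h)%:~R)) *:
    (schur (@xv F n m) la * schur (@yv F n m) mu)).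
  apply: eq_bigr => g _; apply: eq_bigr => h _.
  rewrite !pcyc_psi mulr_suml scaler_sumr; apply: eq_bigr => la _.
  rewrite mulr_sumr scaler_sumr; apply: eq_bigr => mu _.
  by rewrite mulrACA -intrM mulrzl -scaler_int scalerA.
under eq_bigr do rewrite exchange_big.
rewrite exchange_big; apply: eq_bigr => la _ /=.
under eq_bigr do rewrite exchange_big.
by rewrite exchange_big.
Qed.

Lemma eq_fcoef (F : fieldType) la mu (chi chi' : 'S_n -> 'S_m -> F) :
  (forall g h, chi g h = chi' g h) -> fcoef la mu chi = fcoef la mu chi'.
Proof.
by move=> e; congr (_ * _); apply: eq_bigr => g _; apply: eq_bigr => h _; rewrite e.
Qed.

Lemma fcoef0 (F : fieldType) la mu : fcoef la mu (fun _ _ => 0 : F) = 0.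
Proof. by rewrite /fcoef big1 ?mulr0 // => g _; rewrite big1 // => h _; rewrite mul0r. Qed.

Lemma fcoefD (F : fieldType) la mu (chi chi' : 'S_n -> 'S_m -> F) :
  fcoef la mu (fun g h => chi g h + chi' g h) = fcoef la mu chi + fcoef la mu chi'.
Proof.
rewrite /fcoef -mulrDr -big_split; congr (_ * _); apply: eq_bigr => g _.
by rewrite -big_split; apply: eq_bigr => h _; rewrite mulrDl.
Qed.

Lemma fcoefN (F : fieldType) la mu (chi : 'S_n -> 'S_m -> F) :
  fcoef la mu (fun g h => - chi g h) = - fcoef la mu chi.
Proof.
rewrite /fcoef -mulrN -sumrN; congr (_ * _); apply: eq_bigr => g _.
by rewrite -sumrN; apply: eq_bigr => h _; rewrite mulNr.
Qed.

Lemma fcoef_map (F F' : fieldType) (f : {rmorphism F -> F'}) la mu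
    (chi : 'S_n -> 'S_m -> F) :
  fcoef la mu (fun g h => f (chi g h)) = f (fcoef la mu chi).
Proof.
rewrite /fcoef [RHS]rmorphM fmorphV rmorph_nat rmorph_sum; congr (_ * _).
apply: eq_bigr => g _; rewrite rmorph_sum; apply: eq_bigr => h _.
by rewrite [RHS]rmorphM rmorph_int.
Qed.

Definition virtual (phi : 'S_n * 'S_m -> algC) : Prop :=
  exists2 chi : 'CF(G), chi \in 'Z[irr G]%g & forall p, chi p = phi p.

Lemma virtual_sum (I : eqType) (r : seq I) (P : pred I)
    (phi : I -> 'S_n * 'S_m -> algC) (c : I -> int) :
  (forall i, i \in r -> P i -> virtual (phi i)) ->
  virtual (fun p => \sum_(i <- r | P i) (c i)%:~R * phi i p).
Proof.
elim: r => [|i r IH] h.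
  by exists 0 => [|p]; rewrite ?rpred0 // big_nil cfunE.
have [j jr|chi Zchi e] := IH; first by apply: h; rewrite inE jr orbT.
case: (boolP (P i)) => Pi; last first.
  by exists chi => // p; rewrite big_cons (negbTE Pi).
have [xi Zxi ex] := h i (mem_head _ _) Pi.
exists (xi *~ c i + chi) => [|p]; first by rewrite rpredD ?rpredMz.
rewrite big_cons Pi cfunE e; congr (_ + _).
by rewrite -scaler_int cfunE ex.
Qed.

Definition pairX := ({ffun 'I_n -> 'I_n} * {ffun 'I_m -> 'I_m})%type.
Definition pair_act (q : pairX) (p : 'S_n * 'S_m) : pairX :=
  (colact q.1 p.1, colact q.2 p.2).

Lemma colour_mnm_act k (f : {ffun 'I_k -> 'I_k}) g :
  colour_mnm (colact f g) = colour_mnm f.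
Proof.
rewrite /colour_mnm [RHS](reindex_inj (@perm_inj _ g^-1%g)).
by apply: eq_bigr => i _; rewrite ffunE.
Qed.

(** A monomial coefficient of a product of power sums counts the fixed colourings of prescribed
    content, so it is the character of a permutation module. *)
Lemma virtual_perm t u : virtual (fun p =>
  ((pcyc (fun i : 'I_n => 'X_i : {mpoly int[n]}) p.1)@_t)%:~R *
  ((pcyc (fun i : 'I_m => 'X_i : {mpoly int[m]}) p.2)@_u)%:~R).
Proof.
pose D (q : pairX) := (colour_mnm q.1 == t) && (colour_mnm q.2 == u).
have aM q p p' : pair_act q (p * p')%g = pair_act (pair_act q p) p'.
  by rewrite /pair_act /= !colactM.
have a1 q : pair_act q 1%g = q by case: q => f f'; rewrite /pair_act /= !colact1.
have aD q p : D (pair_act q p) = D q by rewrite /D !colour_mnm_act.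
have [g|chi Nchi e] := @trace_on_character _ _ _ aM a1 (dmx algC D).
  exact: dmx_stable.
exists chi; first exact: char_vchar.
move=> p; rewrite e trace_on_dmx // !pcyc_coef !natz -!pmulrn -natrM; congr _%:R.
rewrite -cardsX; apply: eq_card => -[f f'].
rewrite !inE /= /D /pair_act xpair_eqE /= !colact_fix.
by rewrite -!andbA andbCA; do !bool_congr.
Qed.

(* [psi la * psi mu] is obtained from permutation characters by inverting the
   unitriangular Kostka matrix over the integers. *)
Lemma virtual_psi la mu : la \in partitions n -> mu \in partitions m ->
  virtual (fun p => (psi la p.1 * psi mu p.2)%:~R).
Proof.
pose r := [seq (la, mu) | la <- partitions n, mu <- partitions m].
have rP q : (q \in r) = (q.1 \in partitions n) && (q.2 \in partitions m).
  apply/allpairsP/andP => [[[a b] /= [ha hb ->]] //|[ha hb]].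
  by exists q; split => //; case: (q).
have ur : uniq r.
  by apply: allpairs_uniq => [||[a b] [a' b'] _ _ [-> ->]] //; apply: partitions_uniq.
pose w (q : seq nat * seq nat) := (dweight n q.1 + dweight m q.2)%N.
pose Kx la al := (gt (@Xn int n) n la)@_(mpart n al).
pose Ky mu be := (gt (@Xn int m) m mu)@_(mpart m be).
suff main q : q \in r -> virtual (fun p => (psi q.1 p.1 * psi q.2 p.2)%:~R).
  by move=> hl hm; apply: (main (la, mu)); rewrite rP hl hm.
pose W := (\max_(i <- r) w i)%N.
have [k] := ubnP (W - w q)%N; elim: k q => // k IH [al be]; rewrite ltnS => hk hq.
have := hq; rewrite rP /= => /andP[ha hb].
have [|xi Zxi ex] := @virtual_sum _ r (fun q => (q != (al, be)) && (Kx q.1 al * Ky q.2 be != 0))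
   (fun q p => (psi q.1 p.1 * psi q.2 p.2)%:~R) (fun q => Kx q.1 al * Ky q.2 be).
  move=> [la' mu'] hq' /andP[ne]; rewrite mulf_eq0 negb_or /= => /andP[k1 k2].
  apply: (IH (la', mu')) => //; have leW : (w (la', mu') <= W)%N by apply: leq_bigmax_seq.
  have := hq'; rewrite rP /= => /andP[ha' hb'].
  suff lt : (w (al, be) < w (la', mu'))%N.
    exact: leq_trans (ltn_sub2l (leq_trans lt leW) lt) hk.
  case: (kostka_weight (leqnn n) ha' ha k1) => [e1|w1];
  case: (kostka_weight (leqnn m) hb' hb k2) => [e2|w2]; rewrite /w /= ?e1 ?e2; try lia.
  by rewrite e1 e2 eqxx in ne.
have [chi Zchi ec] := virtual_perm (mpart n al) (mpart m be).
exists (chi - xi) => [|p]; first exact: rpredB.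
have key : (pcyc (fun i : 'I_n => 'X_i : {mpoly int[n]}) p.1)@_(mpart n al) *
    (pcyc (fun i : 'I_m => 'X_i : {mpoly int[m]}) p.2)@_(mpart m be) =
    \sum_(q <- r) Kx q.1 al * Ky q.2 be * (psi q.1 p.1 * psi q.2 p.2).
  rewrite !psiP !raddf_sum big_allpairs mulr_suml /=; apply: eq_bigr => la' _.
  rewrite mulr_sumr; apply: eq_bigr => mu' _; rewrite !mcoeffZ mulrACA mulrC.
  by [].
rewrite cfunE [X in _ + X]cfunE ec ex -intrM key (bigD1_seq (al, be)) //=.
rewrite /Kx /Ky (kostka_diag _ (leqnn n) ha) (kostka_diag _ (leqnn m) hb) !mul1r.
rewrite intrD -[RHS]addr0 -[LHS]addrA; congr (_ + _).
apply/eqP; rewrite subr_eq0; apply/eqP.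
rewrite rmorph_sum /= (bigID (fun q => Kx q.1 al * Ky q.2 be == 0)) /=.
rewrite big1 ?add0r => [|q /andP[_ /eqP e]]; last by rewrite -/(Kx _ _) -/(Ky _ _) e mul0r.
by apply: eq_bigr => q _; rewrite [LHS]intrM.
Qed.

(* A virtual character of norm one is irreducible up to sign, so its scalar
   products with characters all have the same sign. *)
Lemma coef_same_sign la mu (chi chi' : 'CF(G)) :
  la \in partitions n -> mu \in partitions m ->
  chi \is a character -> chi' \is a character ->
  fcoef la mu (fun g h => chi (g, h)) + fcoef la mu (fun g h => chi' (g, h)) = 0 ->
  fcoef la mu (fun g h => chi (g, h)) = 0.
Proof.
move=> hl hm Nchi Nchi'; have [Psi ZPsi PsiE] := virtual_psi hl hm.
have cG : #|G| = (n`! * m`!)%N by rewrite cardsT card_prod !card_Sn.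
have dotE (xi : 'CF(G)) : '[xi, Psi] = fcoef la mu (fun g h => xi (g, h)).
  rewrite cfdotE /fcoef cG pair_bigA /=; congr (_ * _).
  apply: eq_big => [p|[g h] _]; first by rewrite inE.
  by rewrite PsiE rmorph_int.
have nPsi : '[Psi] = 1.
  rewrite dotE /fcoef; under eq_bigr do under eq_bigr do rewrite PsiE /= -intrM mulrACA.
  under eq_bigr do rewrite -rmorph_sum /= -mulr_sumr.
  rewrite -rmorph_sum /= -mulr_suml !psi_orthogonal // !eqxx !mulr1 -natrM.
  rewrite natz -pmulrn mulVf // pnatr_eq0 -lt0n muln_gt0 !fact_gt0.
  by [].
have [b [i e]] := vchar_norm1P ZPsi nPsi.
rewrite -!dotE e !cfdotZr rmorph_sign -mulrDr.
move/eqP; rewrite mulf_eq0 signr_eq0 /= paddr_eq0 ?natr_ge0 ?Cnat_cfdot_char_irr //.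
by case/andP => /eqP -> _; rewrite mulr0.
Qed.

End Coefficients.

(** * Functions of bounded degree on rook placements *)

Section Degree.
Variables (F : fieldType) (n m : nat).
Notation cell := ('I_n * 'I_m)%type.
Implicit Types (phi : {set cell} -> F) (P Q A : {set cell}).

(** The sets of cells are arbitrary, which makes the notion multiplicative; on placements the
    indicator of a set that is not itself a placement vanishes. *)
Definition degle (k : nat) phi : Prop :=
  exists s : seq (F * {set cell}), all (fun q : F * {set cell} => #|q.2| <= k)%N s /\
    forall A, phi A = \sum_(q <- s) q.1 * (q.2 \subset A)%:R.

Lemma eq_degle k phi phi' : phi =1 phi' -> degle k phi -> degle k phi'.
Proof. by move=> e [s [h hs]]; exists s; split => // A; rewrite -e. Qed.

Lemma degle_subset k Q : (#|Q| <= k)%N -> degle k (fun A => (Q \subset A)%:R).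
Proof.
move=> h; exists [:: (1, Q)]; rewrite /= h; split => // A.
by rewrite big_seq1 mul1r.
Qed.

Lemma degle0 k : degle k (fun=> 0).
Proof. by exists [::]; split => // A; rewrite big_nil. Qed.

Lemma degle1 k : degle k (fun=> 1).
Proof.
apply: eq_degle (degle_subset (Q := set0) _) => [A|]; last by rewrite cards0.
by rewrite sub0set.
Qed.

Lemma degleD k phi phi' : degle k phi -> degle k phi' ->
  degle k (fun A => phi A + phi' A).
Proof.
move=> [s [hs e]] [s' [hs' e']]; exists (s ++ s'); rewrite all_cat hs hs'.
by split => // A; rewrite big_cat e e'.
Qed.

Lemma degleM k k' phi phi' : degle k phi -> degle k' phi' ->
  degle (k + k') (fun A => phi A * phi' A).
Proof.
move=> [s [/allP hs e]] [s' [/allP hs' e']].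
exists [seq (q.1 * q'.1, q.2 :|: q'.2) | q <- s, q' <- s']; split.
  apply/allP => _ /allpairsP [[q q'] /= [/hs h /hs' h' ->]] /=.
  by apply: leq_trans (leq_card_setU _ _) _; apply: leq_add.
move=> A; rewrite e e' big_allpairs_dep mulr_suml; apply: eq_bigr => q _.
rewrite mulr_sumr; apply: eq_bigr => q' _ /=.
by rewrite subUset mulrACA -natrM mulnb.
Qed.

Lemma degleZ k c phi : degle k phi -> degle k (fun A => c * phi A).
Proof.
move=> [s [hs e]]; exists [seq (c * q.1, q.2) | q <- s]; split.
  by rewrite all_map.
by move=> A; rewrite e big_map mulr_sumr; apply: eq_bigr => q _; rewrite mulrA.
Qed.

Lemma degle_sum k (I : Type) (r : seq I) (phi : I -> {set cell} -> F) :
  (forall i, degle k (phi i)) -> degle k (fun A => \sum_(i <- r) phi i A).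
Proof.
move=> h; elim: r => [|i r IH].
  by apply: eq_degle (degle0 k) => A; rewrite big_nil.
by apply: eq_degle (degleD (h i) IH) => A; rewrite big_cons.
Qed.

Lemma degle_prod (I : Type) (r : seq I) (phi : I -> {set cell} -> F) :
  (forall i, degle 1 (phi i)) -> degle (size r) (fun A => \prod_(i <- r) phi i A).
Proof.
move=> h; elim: r => [|i r IH].
  by apply: eq_degle (degle1 0) => A; rewrite big_nil.
by apply: eq_degle (degleM (h i) IH) => A; rewrite big_cons.
Qed.

(* Modulo lower degree, [1 - u] may be replaced by [- u] in a product. *)
Lemma degle_complement (I : Type) (r : seq I) (u : I -> {set cell} -> F) k e :
  (forall i, degle 1 (u i)) -> degle k e -> (0 < k + size r)%N ->
  degle (k + size r).-1 (fun A =>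
    e A * \prod_(i <- r) (1 - u i A) - (-1) ^+ size r * (e A * \prod_(i <- r) u i A)).
Proof.
move=> hu; elim: r k e => [|i r IH] k e he kr.
  apply: eq_degle (degle0 _) => A.
  by rewrite !big_nil expr0 mul1r subrr.
have hN j : degle 1 (fun A => 1 - u j A).
  apply: eq_degle (degleD (degle1 1) (degleZ (-1) (hu j))) => A.
  by rewrite mulN1r.
(* Splitting one factor [1 - u i]: its summand 1 leaves a product of lower degree, and its summand
   [- u i] is absorbed into [e] for the induction. *)
have h1 : degle (k + size (i :: r)).-1 (fun A => e A * \prod_(i <- r) (1 - u i A)).
  by rewrite addnS; apply: degleM he (degle_prod _ hN).
have := IH (k + 1)%N (fun A => e A * u i A) (degleM he (hu i)).
rewrite addn1 addSn => /(_ isT); rewrite -addnS => h2.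
apply: eq_degle (degleD h1 (degleZ (-1) h2)) => A.
rewrite !big_cons /= exprS; ring.
Qed.

End Degree.

(** A partial injection from [J] to [J] extends to a permutation supported on [J]; values are
    corrected one at a time by transpositions. *)
Lemma perm_on_extend (n : nat) (J : {set 'I_n}) (I : eqType) (s : seq I)
    (p q : I -> 'I_n) :
  {in s, forall c, p c \in J} -> {in s, forall c, q c \in J} ->
  {in s &, injective p} -> {in s &, injective q} ->
  exists2 w : 'S_n, perm_on J w & {in s, forall c, w (p c) = q c}.
Proof.
elim: s => [|c s IH] hp hq ip iq; first by exists 1%g; rewrite ?perm_on1.
case: (boolP (c \in s)) => cs.
  have [||||w Jw h] := IH.
  - by move=> d ds; apply: hp; rewrite inE ds orbT.
  - by move=> d ds; apply: hq; rewrite inE ds orbT.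
  - by move=> d d' ds ds'; apply: ip; rewrite inE ?ds ?ds' orbT.
  - by move=> d d' ds ds'; apply: iq; rewrite inE ?ds ?ds' orbT.
  exists w => // d; rewrite inE => /orP[/eqP ->|]; exact: h.
have [||||w Jw h] := IH.
- by move=> d ds; apply: hp; rewrite inE ds orbT.
- by move=> d ds; apply: hq; rewrite inE ds orbT.
- by move=> d d' ds ds'; apply: ip; rewrite inE ?ds ?ds' orbT.
- by move=> d d' ds ds'; apply: iq; rewrite inE ?ds ?ds' orbT.
exists (w * tperm (w (p c)) (q c))%g.
  apply: perm_onM => //; apply/subsetP => i; rewrite inE; apply: contraR => iJ.
  have pJ : w (p c) \in J by rewrite (perm_closed _ Jw) hp ?mem_head.
  have qJ : q c \in J by rewrite hq ?mem_head.
  by rewrite tpermD //; apply: contraNneq iJ => <-.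
move=> d; rewrite inE permM => /orP[/eqP ->|ds]; first by rewrite tpermL.
have dc : d != c by apply: contraNneq cs => <-.
have mc := mem_head c s; have md : d \in c :: s by rewrite inE ds orbT.
rewrite (h d ds) tpermD //; last by apply: contraNneq dc => e; apply/eqP; apply: iq.
apply: contraNneq dc => e; apply/eqP; apply: ip => //; apply: (@perm_inj _ w).
by rewrite h.
Qed.

(** * Symmetrization over rows and columns lowers the degree *)

Section Symmetrizer.
Variables (F : fieldType) (n m : nat).
Notation cell := ('I_n * 'I_m)%type.
Implicit Types (P Q A : {set cell}).

(** After symmetrization only two conditions on [A] remain: it contains [Pout], and it has a rook
    with row in [J] in every column of [Pin]. Their joint indicator [y] is a product of degree [d],
    congruent up to sign, modulo lower degree, to the product with each [u] replaced by [1 - u];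
    that product vanishes on [r]-placements by a pigeonhole count. *)
Lemma row_symmetrizer (J : {set 'I_n}) P d r : rookn d P ->
  (0 < d)%N -> (n + m < #|J| + d + r)%N ->
  exists2 phi, degle d.-1 phi & forall A, rookn r A ->
    \sum_(w : 'S_n | perm_on J w) (setact P (w, 1%g) \subset A)%:R = phi A :> F.
Proof.
move=> /andP[rP /eqP cP] d0 hJ; have /rookP [P1 P2] := rP.
pose Pin := [set c in P | c.1 \in J]; pose Pout := [set c in P | c.1 \notin J].
have cin c : c \in Pin -> c \in P /\ c.1 \in J by rewrite inE => /andP.
have cPio : (#|Pout| + #|Pin| = d)%N.
  rewrite -cP -(cardsID [set c | c.1 \in J] P) addnC; congr (_ + _)%N.
    by apply: eq_card => c; rewrite !inE.
  by apply: eq_card => c; rewrite !inE andbC.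
pose u (c : cell) (A : {set cell}) : F := \sum_(i <- enum J) ([set (i, c.2)] \subset A)%:R.
have du c : degle 1 (u c).
  by apply: degle_sum => i; apply: degle_subset; rewrite cards1.
pose e A : F := (Pout \subset A)%:R.
have de : degle #|Pout| e by apply: degle_subset.
pose y A : F := e A * \prod_(c <- enum Pin) u c A.
have uE c A : rook A -> u c A = [exists i in J, (i, c.2) \in A]%:R.
  move=> /rookP [_ A2]; rewrite /u big_enum.
  case: exists_inP => [[i iJ iA]|h].
    rewrite (bigD1 i) // sub1set iA big1 => [|j /andP[jJ ji]].
      exact: addr0.
    rewrite sub1set; case: (boolP ((j, c.2) \in A)) => // jA.
    by have [e'] := A2 _ _ jA iA erefl; rewrite e' eqxx in ji.
  rewrite big1 // => j jJ; rewrite sub1set; case: (boolP ((j, c.2) \in A)) => // jA.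
  by case: h; exists j.
(* The permutations moving [P] into a given [A], when there are any, form a coset of [stab], so
   their number does not depend on [A]. *)
pose stab := [set w : 'S_n | perm_on J w & [forall c in Pin, w c.1 == c.1]].
(* The witness has degree below [d] by [degle_complement]; on placements the product of the [1 - u]
   drops out and [#|stab| * y] remains. *)
exists (fun A => #|stab|%:R * (- (-1) ^+ #|Pin| *
   (e A * \prod_(c <- enum Pin) (1 - u c A) - (-1) ^+ #|Pin| * y A))).
  apply/degleZ/degleZ; have := @degle_complement F n m _ (enum Pin) u _ _ du de.
  by rewrite -cardE cPio; apply.
move=> A /andP[rA /eqP cA]; have /rookP [A1 A2] := rA.
(* If no column of [Pin] meets [A] inside [J], the rooks of [A] in the rows [J] avoid all [d]
   columns of [P]: those of [Pout] already carry a rook outside [J]. So at most [m - d] rooks lie in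
   [J] and at most [n - #|J|] outside, fewer than [r] in total. *)
have van : e A * \prod_(c <- enum Pin) (1 - u c A) = 0.
  rewrite /e; case: (boolP (Pout \subset A)) => [sP|]; last by rewrite mul0r.
  rewrite mul1r; apply/eqP; rewrite prodf_seq_eq0; apply/hasP.
  case: (boolP [exists c in Pin, [exists i in J, (i, c.2) \in A]]).
    case/exists_inP => c cPin h; exists c; first by rewrite mem_enum.
    by rewrite /= uE // h subrr.
  rewrite negb_exists_in => /forall_inP no.
  exfalso; move: hJ; apply/negP; rewrite -leqNgt.
  pose AJ := [set c in A | c.1 \in J]; pose AJ' := [set c in A | c.1 \notin J].
  have cAA : #|A| = (#|AJ| + #|AJ'|)%N.
    rewrite -(cardsID [set c | c.1 \in J] A); congr (_ + _)%N.
      by apply: eq_card => c; rewrite !inE.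
    by apply: eq_card => c; rewrite !inE andbC.
  have h1 : (#|AJ'| + #|J| <= n)%N.
    rewrite -(rook_card_rows (rook_sub _ rA)); last first.
      by apply/subsetP => c; rewrite inE => /andP[].
    have cJ := cardsC J; rewrite card_ord in cJ.
    rewrite -[leqRHS]cJ addnC leq_add2l.
    apply: subset_leq_card; apply/subsetP => _ /imsetP [c + ->].
    by rewrite !inE => /andP[].
  have h2 : (#|AJ| + d <= m)%N.
    rewrite -(rook_card_cols (rook_sub _ rA)); last first.
      by apply/subsetP => c; rewrite inE => /andP[].
    rewrite -cP -(rook_card_cols rP) -cardsUI.
    rewrite (_ : cols AJ :&: cols P = set0) ?cards0 ?addn0.
      by apply: leq_trans (max_card _) _; rewrite card_ord.
    apply/setP => j; rewrite !inE; apply/negP => /andP[/imsetP [c + ->] /imsetP [c' c'P]].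
    rewrite inE => /andP[cAm cJ] ec; case: (boolP (c'.1 \in J)) => hc'.
      have c'in : c' \in Pin by rewrite inE c'P.
      have := no c' c'in; rewrite negb_exists_in => /forall_inP /(_ c.1 cJ).
      by rewrite -ec -surjective_pairing cAm.
    have c'A : c' \in A by apply: (subsetP sP); rewrite inE c'P.
    by move: hc'; rewrite -(A2 _ _ cAm c'A ec) cJ.
  by rewrite -cA cAA; lia.
rewrite van.
have -> : - (-1) ^+ #|Pin| * (0 - (-1) ^+ #|Pin| * y A) = y A.
  by rewrite sub0r mulrNN mulrA -expr2 sqrr_sign mul1r.
have fixw w (c : cell) : perm_on J w -> c.1 \notin J -> cellmap (w, 1%g) c = c.
  by move=> Jw cJ; rewrite /cellmap /= perm1 (out_perm Jw) // -surjective_pairing.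
have subE w : perm_on J w -> (setact P (w, 1%g) \subset A) =
    (Pout \subset A) && [forall c in Pin, (w c.1, c.2) \in A].
  move=> Jw; apply/subsetP/andP => [h|[/subsetP h1 /forall_inP h2] _ /imsetP [c cPm ->]].
    split.
      apply/subsetP => c; rewrite inE => /andP[cPm cJ].
      by have e1 := fixw w c Jw cJ; rewrite -e1; apply/h/imset_f.
    apply/forall_inP => c /cin [cPm cJ].
    have := h (cellmap (w, 1%g) c); rewrite /cellmap /= perm1; apply.
    by apply/imsetP; exists c => //; rewrite /cellmap /= perm1.
  case: (boolP (c.1 \in J)) => cJ; last by rewrite fixw // h1 // inE cPm.
  by rewrite /cellmap /= perm1; apply: h2; rewrite inE cPm.
case: (boolP ((Pout \subset A) && [forall c in Pin, [exists i in J, (i, c.2) \in A]]));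
  last first.
  move=> no; rewrite big1 => [|w Jw].
    rewrite /y /e; move: no; rewrite negb_and => /orP[/negbTE ->|].
      by rewrite mul0r mulr0.
    rewrite negb_forall_in => /exists_inP [c cPin nc].
    rewrite (big_rem c) ?mem_enum //= uE // (negbTE nc) mul0r !mulr0.
    by [].
  rewrite subE // (_ : _ && _ = false) //; apply: contraNF no => /andP[-> /forall_inP h].
  apply/forall_inP => c cPin; apply/exists_inP; exists (w c.1); last exact: h.
  by rewrite (perm_closed _ Jw); case/cin: cPin.
case/andP => sP /forall_inP ex.
have yA : y A = 1.
  rewrite /y /e sP mul1r big_seq big1 // => c; rewrite mem_enum => cPin.
  by rewrite uE // ex.
rewrite yA mulr1.
(* [q c] is the row in which [A] occupies the column of [c]; a permutation [w0] realising [q] is the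
   base point of the coset of [stab]. *)
pose q (c : cell) : 'I_n := odflt c.1 [pick i in J | (i, c.2) \in A].
have qP c : c \in Pin -> q c \in J /\ (q c, c.2) \in A.
  move=> cPin; rewrite /q; case: pickP => [i /andP[] //|h].
  by case/exists_inP: (ex c cPin) => i iJ iA; have := h i; rewrite iJ iA.
have [||||w0 Jw0 hw0] := @perm_on_extend n J _ (enum Pin) (fun c => c.1) q.
- by move=> c; rewrite mem_enum => /cin [].
- by move=> c; rewrite mem_enum => /qP [].
- by move=> c c'; rewrite !mem_enum => /cin [cPm _] /cin [c'P _]; exact: P1.
- move=> c c'; rewrite !mem_enum => cPin c'Pin eq.
  have [_ h1] := qP c cPin; have [_ h2] := qP c' c'Pin.
  have [e2] := A1 _ _ h1 h2 eq.
  by case/cin: cPin => cPm _; case/cin: c'Pin => c'P _; exact: P2.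
rewrite -natr_sum; congr _%:R.
rewrite -(card_imset stab (mulIg w0)) -sum1_card big_mkcond [RHS]big_mkcond /=.
apply: eq_bigr => w _.
have -> : (w \in [set x * w0 | x in stab]%g) =
    perm_on J w && (setact P (w, 1%g) \subset A).
  apply/imsetP/andP => [[v + ->]|[Jw sw]].
    rewrite inE => /andP[Jv /forall_inP hv].
    have Jvw : perm_on J (v * w0)%g by apply: perm_onM.
    split => //; rewrite subE // sP; apply/forall_inP => c cPin.
    rewrite permM (eqP (hv c cPin)) hw0 ?mem_enum //.
    by case: (qP c cPin).
  exists (w * w0^-1)%g; last by rewrite mulgKV.
  rewrite inE perm_onM ?perm_onV //=; apply/forall_inP => c cPin.
  move: sw; rewrite subE // => /andP[_ /forall_inP /(_ c cPin) h].
  have [_ h'] := qP c cPin; have [e1] := A2 _ _ h h' erefl.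
  by rewrite permM e1 -hw0 ?mem_enum // permK.
by case: (perm_on J w) => //=; case: (_ \subset _).
Qed.

End Symmetrizer.

Section Transpose.
Variables (n m : nat).

Definition tset (n m : nat) (A : {set 'I_n * 'I_m}) : {set 'I_m * 'I_n} :=
  [set (c.2, c.1) | c in A].

Lemma mem_tset k l (A : {set 'I_k * 'I_l}) c : (c \in tset A) = ((c.2, c.1) \in A).
Proof.
apply/imsetP/idP => [[c' c'A ->]|h]; last by exists (c.2, c.1) => //; case: c {h}.
by rewrite -surjective_pairing.
Qed.

Lemma tsetK k l : cancel (@tset k l) (@tset l k).
Proof. by move=> A; apply/setP => -[i j]; rewrite !mem_tset. Qed.

Lemma tset_sub k l (A B : {set 'I_k * 'I_l}) :
  (tset A \subset tset B) = (A \subset B).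
Proof.
apply/subsetP/subsetP => h c; last by rewrite !mem_tset; apply: h.
by have := h (c.2, c.1); rewrite !mem_tset -surjective_pairing.
Qed.

Lemma rookn_tset d (A : {set 'I_n * 'I_m}) : rookn d (tset A) = rookn d A.
Proof.
rewrite /rookn card_imset; last by move=> [a b] [a' b'] [-> ->].
congr (_ && _); apply/rookP/rookP => -[h1 h2]; split => c c' cA c'A e.
- have tA : (c.2, c.1) \in tset A by rewrite mem_tset -surjective_pairing.
  have tA' : (c'.2, c'.1) \in tset A by rewrite mem_tset -surjective_pairing.
  have [] := h2 _ _ tA tA' e.
  by case: c c' {cA c'A e tA tA'} => a b [a' b'] /= -> ->.
- have tA : (c.2, c.1) \in tset A by rewrite mem_tset -surjective_pairing.
  have tA' : (c'.2, c'.1) \in tset A by rewrite mem_tset -surjective_pairing.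
  have [] := h1 _ _ tA tA' e.
  by case: c c' {cA c'A e tA tA'} => a b [a' b'] /= -> ->.
- rewrite !mem_tset in cA c'A; have [] := h2 _ _ cA c'A e.
  by case: c c' {cA c'A e} => a b [a' b'] /= -> ->.
- rewrite !mem_tset in cA c'A; have [] := h1 _ _ cA c'A e.
  by case: c c' {cA c'A e} => a b [a' b'] /= -> ->.
Qed.

Lemma tset_setact (A : {set 'I_n * 'I_m}) g h :
  setact (tset A) (h, g) = tset (setact A (g, h)).
Proof. by rewrite /setact /tset -!imset_comp. Qed.

Lemma degle_tset (F : fieldType) k (phi : {set 'I_m * 'I_n} -> F) :
  degle k phi -> degle k (fun A => phi (tset A)).
Proof.
move=> [s [hs e]]; exists [seq (q.1, tset q.2) | q <- s]; split.
  rewrite all_map; apply: sub_all hs => q /=.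
  by rewrite card_imset // => -[a b] [a' b'] [-> ->].
move=> A; rewrite e big_map; apply: eq_bigr => q _ /=.
by rewrite -[q.2 in LHS]tsetK tset_sub.
Qed.

Lemma col_symmetrizer (F : fieldType) (J : {set 'I_m}) (P : {set 'I_n * 'I_m}) d r :
  rookn d P -> (0 < d)%N -> (n + m < #|J| + d + r)%N ->
  exists2 phi, degle d.-1 phi & forall A, rookn r A ->
    \sum_(w : 'S_m | perm_on J w) (setact P (1%g, w) \subset A)%:R = phi A :> F.
Proof.
rewrite -rookn_tset addnC => rP d0 hJ.
have [phi dphi e] := row_symmetrizer F rP d0 hJ.
exists (fun A => phi (tset A)); first exact: degle_tset.
move=> A rA; rewrite -e ?rookn_tset //; apply: eq_bigr => w _.
by rewrite tset_setact tset_sub.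
Qed.

End Transpose.

(** * Inclusion matrices *)

Section Inclusion.
Variables (n m : nat).
Notation cell := ('I_n * 'I_m)%type.
Notation N := #|{set cell}|.
Implicit Types (P Q A : {set cell}) (p : 'S_n * 'S_m).

(** Rows and columns range over all sets of cells, with zeros off the placements. All inclusion
    matrices are then square of one size, carry the same group action, and [incl F r r] is the
    projection onto functions on [r]-placements. *)
Definition incl (F : fieldType) (d r : nat) : 'M[F]_N :=
  \matrix_(i, j) ([&& rookn d (enum_val i), rookn r (enum_val j) &
                      enum_val i \subset enum_val j])%:R.

Notation pm F p := (pmx (@setact n m) F p).

Lemma incl_pmx (F : fieldType) d r p :
  incl F d r *m pm F p = pm F p *m incl F d r.
Proof.
apply/matrixP => i j; rewrite !mxE.
rewrite (@sum_enum_rank _ _ _ (setact (enum_val j) p^-1%g)) => [|k hk]; last first.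
  rewrite !mxE (_ : (_ == enum_val j) = false) ?mulr0 //.
  apply: contraNF hk => /eqP <-; rewrite -setactM mulgV setact1 enum_valK.
  by [].
rewrite (@sum_enum_rank _ _ _ (setact (enum_val i) p)) => [|k hk]; last first.
  rewrite !mxE (_ : (_ == enum_val k) = false) ?mul0r //.
  by apply: contraNF hk => /eqP ->; rewrite enum_valK.
rewrite !mxE !enum_rankK -setactM mulVg setact1 !eqxx mulr1 mul1r.
by rewrite !rookn_setact -(setact_sub _ _ p) -setactM mulVg setact1.
Qed.

Lemma incl_stable (F : fieldType) d r p : stablemx (incl F d r) (pm F p).
Proof. by rewrite incl_pmx submxMl. Qed.

Lemma incl_dmx (F : fieldType) r : incl F r r = dmx F (rookn r).
Proof.
apply/matrixP => i j; rewrite !mxE; congr _%:R; congr nat_of_bool.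
case: eqP => [->|ne]; first by rewrite subxx andbT andbb.
apply/negP => /and3P[/andP[_ /eqP c1] /andP[_ /eqP c2] s]; apply: ne.
apply: enum_val_inj; apply/eqP; rewrite eqEcard s /=.
by rewrite c1 c2.
Qed.

Lemma card_between d k r P A : P \subset A -> #|P| = d -> #|A| = r ->
  (d <= k)%N ->
  #|[set Q : {set cell} | [&& P \subset Q, Q \subset A & #|Q| == k]]| = 'C(r - d, k - d).
Proof.
move=> sPA cP cA dk.
have cD : #|A :\: P| = (r - d)%N.
  by rewrite cardsD (setIidPr sPA) cA cP.
rewrite -cD -(cards_draws (A :\: P) (k - d)%N).
rewrite -[RHS](@card_in_imset _ _ (fun B : {set cell} => P :|: B)); last first.
  move=> B B'; rewrite !inE => /andP[/subsetP h _] /andP[/subsetP h' _] e.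
  apply/setP => c; case: (boolP (c \in P)) => cP'.
    transitivity false; first by apply/negP => /h; rewrite inE cP'.
    by apply/esym/negP => /h'; rewrite inE cP'.
  by have := congr1 (fun S : {set cell} => c \in S) e; rewrite !inE (negbTE cP').
have cU (B : {set cell}) : B \subset A :\: P -> #|P :|: B| = (d + #|B|)%N.
  move=> /subsetP h; rewrite cardsU (_ : P :&: B = set0) ?cards0 ?subn0 ?cP //.
  apply/setP => c; rewrite !inE; apply/negP => /andP[h1 /h].
  by rewrite inE h1.
apply: eq_card => Q; rewrite inE; apply/and3P/imsetP => [[h1 h2 /eqP h3]|[B]].
  have e : Q = P :|: (Q :\: P).
    by apply/setP => c; rewrite !inE; case: (boolP (c \in P)) => //= /(subsetP h1).
  exists (Q :\: P) => //; rewrite inE setSD //=.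
  by rewrite -(eqn_add2l d) -cU ?setSD // -e h3 subnKC.
rewrite inE => /andP[hB /eqP cB] ->; split.
- exact: subsetUl.
- by rewrite subUset sPA (subset_trans hB) // subsetDl.
- by rewrite cU // cB subnKC.
Qed.

(** Every inclusion is counted once per intermediate set of size [k], and subsets of placements are
    placements. In characteristic zero the binomial is invertible, which gives both the filtration
    and the containment of kernels. *)
Lemma incl_mul (F : fieldType) d k r : (d <= k)%N -> (k <= r)%N ->
  incl F d k *m incl F k r = 'C(r - d, k - d)%:R *: incl F d r.
Proof.
move=> dk kr; apply/matrixP => i j; rewrite !mxE.
set P := enum_val i; set A := enum_val j.
transitivity (\sum_(Q : {set cell}) ([&& rookn d P, rookn k Q & P \subset Q])%:R *
   ([&& rookn k Q, rookn r A & Q \subset A])%:R : F).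
  rewrite [RHS](reindex _ (onW_bij _ (enum_val_bij {set cell}))) /=.
  by apply: eq_bigr => l _; rewrite !mxE.
case: (boolP [&& rookn d P, rookn r A & P \subset A]) => [/and3P[rP rA sPA]|no].
  have /andP[_ /eqP cP] := rP; have /andP[rkA /eqP cA] := rA.
  rewrite mulr1 -(card_between sPA cP cA dk) -sum1_card natr_sum [RHS]big_mkcond.
  apply: eq_bigr => Q _; rewrite -natrM mulnb inE rP rA /=.
  case: (boolP (Q \subset A)) => sQ; rewrite ?andbF //= andbT.
  by rewrite /rookn (rook_sub sQ rkA) /=; case: (#|Q| == k); case: (P \subset Q).
rewrite mulr0 big1 // => Q _; rewrite -natrM mulnb.
case: (boolP (_ && _)) => // /andP[/and3P[h1 _ h2] /and3P[_ h3 h4]].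
by move: no; rewrite h1 h3 (subset_trans h2 h4).
Qed.

Definition rookvec (F : fieldType) (r : nat) (phi : {set cell} -> F) : 'rV[F]_N :=
  \row_j ((rookn r (enum_val j))%:R * phi (enum_val j)).

Section CharZero.
Variable F : numFieldType.

Lemma incl_mono d k r : (d <= k)%N -> (k <= r)%N -> (incl F d r <= incl F k r)%MS.
Proof.
move=> dk kr.
have c0 : 'C(r - d, k - d)%:R != 0 :> F.
  by rewrite pnatr_eq0 -lt0n bin_gt0 leq_sub2r.
rewrite -[incl F d r](scalerK c0) -incl_mul //.
by rewrite scalemx_sub // submxMl.
Qed.

Lemma rookvec_subset k r Q : (#|Q| <= k)%N -> (k <= r)%N ->
  (rookvec r (fun A => (Q \subset A)%:R : F) <= incl F k r)%MS.
Proof.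
move=> Qk kr; case: (boolP (rook Q)) => rQ.
  apply: submx_trans (incl_mono Qk kr).
  suff -> : rookvec r (fun A => (Q \subset A)%:R : F) =
      row (enum_rank Q) (incl F #|Q| r) by exact: row_sub.
  apply/rowP => j; rewrite !mxE enum_rankK /rookn rQ eqxx /=.
  by rewrite -natrM mulnb.
rewrite (_ : rookvec _ _ = 0) ?sub0mx //; apply/rowP => j; rewrite !mxE -natrM mulnb.
case: (boolP (_ && _)) => // /andP[/andP[h _] s].
by rewrite (rook_sub s h) in rQ.
Qed.

Lemma rookvec_degle k r phi : (k <= r)%N -> degle k phi ->
  (rookvec r phi <= incl F k r)%MS.
Proof.
move=> kr [s [/allP hs e]].
have -> : rookvec r phi =
    \sum_(q <- s) q.1 *: rookvec r (fun A => (q.2 \subset A)%:R : F).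
  apply/rowP => j; rewrite !mxE e mulr_sumr summxE; apply: eq_bigr => q _.
  by rewrite !mxE mulrCA.
rewrite big_seq; apply: summx_sub => q qs; rewrite scalemx_sub //.
exact: rookvec_subset (hs q qs) kr.
Qed.

(** Translates the degree bound for each [P] into matrices: the symmetrized row of [P] is the vector
    of values of [phi]. *)
Lemma incl_symmetrizer (I : finType) (S : pred I) (w : I -> 'S_n * 'S_m) d r :
  (0 < d <= r)%N ->
  (forall P, rookn d P -> exists2 phi, degle d.-1 phi & forall A, rookn r A ->
     \sum_(i | S i) (setact P (w i) \subset A)%:R = phi A :> F) ->
  (incl F d r *m (\sum_(i | S i) pm F (w i)) <= incl F d.-1 r)%MS.
Proof.
move=> /andP[d0 dr] h; apply/row_subP => k; rewrite mulmx_sumr.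
under eq_bigr do rewrite incl_pmx.
have -> : row k (\sum_(i | S i) pm F (w i) *m incl F d r) =
    \row_j \sum_(i | S i) (incl F d r) (enum_rank (setact (enum_val k) (w i))) j.
  apply/rowP => j; rewrite !mxE summxE; apply: eq_bigr => i _.
  rewrite !mxE (@sum_enum_rank _ _ _ (setact (enum_val k) (w i))) => [|l hl].
    by rewrite !mxE enum_rankK eqxx mul1r.
  rewrite !mxE (_ : (_ == enum_val l) = false) ?mul0r //.
  by apply: contraNF hl => /eqP ->; rewrite enum_valK.
case: (boolP (rookn d (enum_val k))) => rP; last first.
  rewrite (_ : \row_j _ = 0) ?sub0mx //; apply/rowP => j; rewrite !mxE big1 // => i _.
  by rewrite !mxE enum_rankK rookn_setact (negbTE rP).
have [phi dphi e] := h _ rP.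
rewrite (_ : \row_j _ = rookvec r phi); first by apply: rookvec_degle => //; lia.
apply/rowP => j; rewrite !mxE.
case: (boolP (rookn r (enum_val j))) => rA; last first.
  by rewrite mul0r big1 // => i _; rewrite !mxE (negbTE rA) andbF.
rewrite mul1r -e //; apply: eq_bigr => i _.
by rewrite !mxE enum_rankK rookn_setact rP rA.
Qed.

Definition chiF (F : fieldType) (d r : nat) (g : 'S_n) (h : 'S_m) : F :=
  trace_on (incl F d r) (pm F (g, h)).

Lemma chiF_symmetrizer (I : finType) (S : pred I) (w : I -> 'S_n * 'S_m) d r q :
  (0 < d <= r)%N ->
  (forall P, rookn d P -> exists2 phi, degle d.-1 phi & forall A, rookn r A ->
     \sum_(i | S i) (setact P (w i) \subset A)%:R = phi A :> F) ->
  \sum_(i | S i) trace_on (incl F d r) (pm F (w i * q)%g) =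
  \sum_(i | S i) trace_on (incl F d.-1 r) (pm F (w i * q)%g).
Proof.
move=> hd h; rewrite -!trace_on_sum.
have -> : \sum_(i | S i) pm F (w i * q)%g = (\sum_(i | S i) pm F (w i)) *m pm F q.
  rewrite mulmx_suml; apply: eq_bigr => i _; apply: pmxM.
  exact: setactM.
have le := incl_symmetrizer hd h.
have mono : (incl F d.-1 r <= incl F d r)%MS by apply: incl_mono; lia.
have le' : (incl F d r *m ((\sum_(i | S i) pm F (w i)) *m pm F q) <= incl F d.-1 r)%MS.
  rewrite mulmxA; apply: submx_trans (submxMr _ le) _.
  exact: incl_stable.
apply: trace_on_sub => //.
exact: submx_trans le' mono.
Qed.

End CharZero.

End Inclusion.

(** * Multiplicities in the degree filtration *)

(** The stabilizer of a colouring is invariant under multiplication by permutations supported on one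
    colour class, so its sum is an average of sums that vanish by hypothesis. *)
Lemma stabilizer_sum0 (F : numFieldType) (k : nat) (K : eqType) (f : 'I_k -> K)
    (a : K) (delta : 'S_k -> F) :
  (forall g, \sum_(w : 'S_k | perm_on [set i | f i == a] w) delta (w * g)%g = 0) ->
  \sum_(g : 'S_k | fixcol g f) delta g = 0.
Proof.
set J := [set i | f i == a] => h.
have fw w i : perm_on J w -> f (w i) = f i.
  move=> Jw; case: (boolP (i \in J)) => iJ; last by rewrite (out_perm Jw).
  have : w i \in J by rewrite (perm_closed _ Jw).
  by move: iJ; rewrite !inE => /eqP -> /eqP ->.
have fixM w g : perm_on J w -> fixcol (w * g)%g f = fixcol g f.
  move=> Jw; apply/forallP/forallP => e i.
    have := e (w^-1%g i); rewrite permM permKV => /eqP ->.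
    by rewrite -(fw w _ Jw) permKV.
  by rewrite permM (eqP (e _)) fw.
set S := \sum_(g | _) _.
have : S *+ #|[set w | perm_on J w]| = 0.
  rewrite -sumr_const.
  transitivity (\sum_(w : 'S_k | perm_on J w) \sum_(g : 'S_k | fixcol g f) delta (w * g)%g).
    apply: eq_big => [w|w]; first by rewrite inE.
    rewrite inE => Jw; rewrite /S (reindex_inj (mulgI w)).
    by apply: eq_bigl => g; exact: fixM.
  by rewrite exchange_big big1.
move/eqP; rewrite mulrn_eq0 => /orP[|/eqP //].
rewrite cards_eq0 => /eqP e; have : 1%g \in [set w | perm_on J w].
  by rewrite inE perm_on1.
by rewrite e inE.
Qed.

Lemma colour_mnmE k (f : 'I_k -> 'I_k) i :
  colour_mnm f i = #|[set j | f j == i]|.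
Proof.
rewrite /colour_mnm mnm_sumE -sum1_card [RHS]big_mkcond /=.
by apply: eq_bigr => j _; rewrite mnm1E inE; case: eqP.
Qed.

Lemma card_colour_part1 k (f : 'I_k -> 'I_k) al (i : 'I_k) : i = 0%N :> nat ->
  colour_mnm f = mpart k al -> #|[set j | f j == i]| = part1 al.
Proof. by move=> i0 e; rewrite -colour_mnmE e mnmE i0 nth0. Qed.

Section Multiplicities.
Variables (n m : nat).
Notation cell := ('I_n * 'I_m)%type.
Notation pm F p := (pmx (@setact n m) F p).

Lemma Frob_mcoeff (F : fieldType) (chi : 'S_n -> 'S_m -> F) t u :
  (Frob chi)@_(mcat t u) = (n`! * m`!)%:R^-1 *
    \sum_(g : 'S_n) \sum_(h : 'S_m) chi g h *
      ((\sum_(f : {ffun 'I_n -> 'I_n} | fixcol g f && (colour_mnm f == t)) 1) *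
       (\sum_(f : {ffun 'I_m -> 'I_m} | fixcol h f && (colour_mnm f == u)) 1)).
Proof.
rewrite /Frob mcoeffZ raddf_sum; congr (_ * _); apply: eq_bigr => g _ /=.
rewrite raddf_sum; apply: eq_bigr => h _ /=; rewrite mcoeffZ; congr (_ * _).
have ex : pcyc (@xv F n m) g = embx m (pcyc (fun i => 'X_i) g).
  rewrite /embx rmorph_pcyc; apply: eq_pcyc => i.
  by rewrite /= mmapX mmap1U.
have ey : pcyc (@yv F n m) h = emby n (pcyc (fun i => 'X_i) h).
  rewrite /emby rmorph_pcyc; apply: eq_pcyc => i.
  by rewrite /= mmapX mmap1U.
rewrite ex ey mcoeff_emb !pcyc_coef -!sum1_card !natr_sum.
by congr (_ * _); apply: eq_bigl => f; rewrite inE.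
Qed.

(** A monomial coefficient of [Frob delta] sums [delta] over stabilizers of colourings. The colour
    class of index 0 has as many elements as the first part of the exponent, so symmetrizing over it
    applies once that part exceeds [n + m - d - r]. This bound survives enlarging the first part,
    and [schur_pair_free] transfers the vanishing to Schur coefficients. *)
Lemma coef_chiF_step (F : numFieldType) d r la mu :
  la \in partitions n -> mu \in partitions m ->
  (r <= minn n m)%N -> (0 < d <= r)%N ->
  (n + m < maxn (part1 la) (part1 mu) + d + r)%N ->
  fcoef la mu (@chiF n m F d r) = fcoef la mu (@chiF n m F d.-1 r).
Proof.
move=> hl hm rnm hd hM.
pose delta g h := @chiF n m F d r g h - chiF F d.-1 r g h.
suff e0 : fcoef la mu delta = 0.
  apply/eqP; rewrite -subr_eq0 -fcoefN -fcoefD; apply/eqP; exact: e0.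
have Fd : Frob delta = \sum_(la <- partitions n) \sum_(mu <- partitions m)
     fcoef la mu delta *: (schur (@xv F n m) la * schur (@yv F n m) mu).
  exact: Frob_coef.
have drow (J : {set 'I_n}) g h : (n + m < #|J| + d + r)%N ->
    \sum_(w : 'S_n | perm_on J w) delta (w * g)%g h = 0.
  move=> hJ; rewrite sumrB; apply/eqP; rewrite subr_eq0; apply/eqP.
  have := @chiF_symmetrizer n m F _ (fun w : 'S_n => perm_on J w)
    (fun w => (w, 1%g)) d r (g, h) hd.
  have mulE (w : 'S_n) : ((w, 1) * (g, h))%g = ((w * g)%g, h) :> 'S_n * 'S_m.
    by rewrite -[RHS]/((w * g)%g, h) -{2}[h]mul1g.
  move=> e; rewrite /chiF; under eq_bigr do rewrite -mulE.
  under [RHS]eq_bigr do rewrite -mulE.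
  apply: e => P rP; apply: row_symmetrizer rP _ hJ.
  by case/andP: hd.
have dcol (J : {set 'I_m}) g h : (n + m < #|J| + d + r)%N ->
    \sum_(w : 'S_m | perm_on J w) delta g (w * h)%g = 0.
  move=> hJ; rewrite sumrB; apply/eqP; rewrite subr_eq0; apply/eqP.
  have := @chiF_symmetrizer n m F _ (fun w : 'S_m => perm_on J w)
    (fun w => (1%g, w)) d r (g, h) hd.
  have mulE (w : 'S_m) : ((1, w) * (g, h))%g = (g, (w * h)%g) :> 'S_n * 'S_m.
    by rewrite -[RHS]/(g, (w * h)%g) -{2}[g]mul1g.
  move=> e; rewrite /chiF; under eq_bigr do rewrite -mulE.
  under [RHS]eq_bigr do rewrite -mulE.
  apply: e => P rP; apply: col_symmetrizer rP _ hJ.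
  by case/andP: hd.
(* Rows are symmetrized when [la] has the larger first part, columns otherwise. *)
case: (leqP (part1 mu) (part1 la)) => hlm.
  apply: (@schur_pair_free F n m (fun al be => n + m < part1 al + d + r)%N
    (fun la mu => fcoef la mu delta)) hl hm _.
  - by move=> a b al be h h1 _; lia.
  - move=> al be /partitionsP [pal sal] hb hq; rewrite -Fd Frob_mcoeff.
    have al0 : (0 < n)%N.
      rewrite lt0n; apply/eqP => n0; have := ispart_size pal.
      by move: hq; rewrite /part1; case: (al) => //=; lia.
    pose i0 := Ordinal al0.
    rewrite exchange_big big1 ?mulr0 // => h _ /=.
    under eq_bigr do rewrite mulrA.
    rewrite -mulr_suml; under [X in X * _]eq_bigr do rewrite mulr_sumr.
    rewrite (exchange_big_dep (fun f : {ffun 'I_n -> 'I_n} =>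
      colour_mnm f == mpart n al)) /=; last by move=> g f _ /andP[].
    rewrite big1 ?mul0r // => f /eqP ef.
    transitivity (\sum_(g : 'S_n | fixcol g f) delta g h).
      by apply: eq_big => [g|g _]; rewrite ?ef ?eqxx ?andbT ?mulr1.
    apply: (@stabilizer_sum0 _ _ _ _ i0) => g; apply: drow.
    by rewrite (card_colour_part1 _ ef).
  - by move: hM; rewrite (maxn_idPl hlm).
apply: (@schur_pair_free F n m (fun al be => n + m < part1 be + d + r)%N
  (fun la mu => fcoef la mu delta)) hl hm _.
- by move=> a b al be h _ h1; lia.
- move=> al be ha /partitionsP [pal sal] hq; rewrite -Fd Frob_mcoeff.
  have al0 : (0 < m)%N.
    rewrite lt0n; apply/eqP => n0; have := ispart_size pal.
    by move: hq; rewrite /part1; case: (be) => //=; lia.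
  pose i0 := Ordinal al0.
  rewrite [X in _ * X]big1 ?mulr0 // => g _ /=.
  transitivity ((\sum_(f : {ffun 'I_n -> 'I_n} | fixcol g f &&
      (colour_mnm f == mpart n al)) 1) * (\sum_(h : 'S_m)
      \sum_(f : {ffun 'I_m -> 'I_m} | fixcol h f && (colour_mnm f == mpart m be))
        delta g h)).
    rewrite mulr_sumr; apply: eq_bigr => h _; rewrite mulrCA mulr_sumr.
    by congr (_ * _); apply: eq_bigr => f _; rewrite mulr1.
  rewrite (exchange_big_dep (fun f : {ffun 'I_m -> 'I_m} =>
    colour_mnm f == mpart m be)) /=; last by move=> h f _ /andP[].
  rewrite [X in _ * X]big1 ?mulr0 // => f /eqP ef.
  transitivity (\sum_(h : 'S_m | fixcol h f) delta g h).
    by apply: eq_big => [h|h _]; rewrite ?ef ?eqxx ?andbT ?mulr1.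
  apply: (@stabilizer_sum0 _ _ _ _ i0) => h; apply: dcol.
  by rewrite (card_colour_part1 _ ef).
- by move: hM; rewrite (maxn_idPr (ltnW hlm)).
Qed.

End Multiplicities.

Section MultiplicityFormula.
Variables (n m : nat).
Notation cell := ('I_n * 'I_m)%type.
Notation N := #|{set cell}|.
Notation pm F p := (pmx (@setact n m) F p).
Notation chi F d r := (@chiF n m F d r).
Notation W F d r := (@incl n m F d r).

Lemma schur_pair_unique (C : comNzRingType) (c c' : seq nat -> seq nat -> C) :
  \sum_(la <- partitions n) \sum_(mu <- partitions m)
     c la mu *: (schur (@xv C n m) la * schur (@yv C n m) mu) =
  \sum_(la <- partitions n) \sum_(mu <- partitions m)
     c' la mu *: (schur (@xv C n m) la * schur (@yv C n m) mu) ->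
  {in partitions n & partitions m, forall la mu, c la mu = c' la mu}.
Proof.
move=> e la mu hl hm; apply/eqP; rewrite -subr_eq0; apply/eqP.
apply: (@schur_pair_free C n m (fun _ _ => true)
  (fun la mu => c la mu - c' la mu)) hl hm _ => // al be _ _ _.
rewrite [X in X@__](_ : _ = 0) ?mcoeff0 //.
move/eqP: e; rewrite -subr_eq0 -sumrB => /eqP e; rewrite -[RHS]e.
apply: eq_bigr => l _; rewrite -sumrB; apply: eq_bigr => k _.
by rewrite scalerBl.
Qed.

(** For [d = r] the space is the whole permutation module on [r]-placements, and the Cauchy identity
    turns the orbit count into the defining sum of [SF]. *)
Lemma Frob_chiF_diag (F : numFieldType) r : (r <= minn n m)%N ->
  Frob (chi F r r) = SF F n m r.
Proof.
move=> hr; have [rn rm] : (r <= n /\ r <= m)%N by lia.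
have f0 : (n`! * m`!)%:R != 0 :> F.
  by rewrite pnatr_eq0 -lt0n muln_gt0 !fact_gt0.
rewrite /Frob -[RHS](scalerK f0); congr (_ *: _).
pose D := (n * m + n + m)%N.
rewrite scaler_nat.
transitivity (\sum_(g : 'S_n) \sum_(h : 'S_m)
  (fixed_rooks r (g, h))%:R * (pcyc (@xv F n m) g * pcyc (@yv F n m) h)).
  apply: eq_bigr => g _; apply: eq_bigr => h _.
  rewrite /chiF incl_dmx trace_on_dmx; last by move=> P; exact: rookn_setact.
  by rewrite -scaler_nat -mulr_algl scaler_nat.
rewrite (@fixed_rooks_pcyc _ n m r D) //; try by rewrite /D; lia.
congr (_ *+ _); rewrite /SF.
have -> : hser D (fun ij : 'I_n * 'I_m => xv F m ij.1 * yv F n ij.2) =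
   hser D (fun ij : 'I_n * 'I_m => xn F n m ij.1 * yn F n m ij.2).
  by apply: eq_hser => ij; rewrite /xn /yn !valK.
rewrite -cauchy; last by rewrite /D; lia.
rewrite -!hcompE; try by rewrite /D; lia.
rewrite mulr_suml big_seq [RHS]big_seq; apply: eq_bigr => nu /partitionsP [pn _].
by rewrite schur_xE // schur_yE // mulrACA.
Qed.

Lemma coef_chiF_diag (F : numFieldType) r la mu :
  (r <= minn n m)%N -> la \in partitions n -> mu \in partitions m ->
  fcoef la mu (chi F r r) = (common_strips la mu r)%:R.
Proof.
move=> hr hl hm; apply: (@schur_pair_unique F (fun la mu => fcoef la mu (chi F r r))
  (fun la mu => (common_strips la mu r)%:R)) hl hm.
by rewrite -Frob_coef Frob_chiF_diag // SF_expand.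
Qed.

(** Iterates [coef_chiF_step] from [r] down to [d]. The last application is at [d.+1], so the
    inequality at [d] need not be strict; the equality case is the one used for the reflected
    degree. *)
Lemma coef_chiF_top (F : numFieldType) d r la mu :
  (r <= minn n m)%N -> la \in partitions n -> mu \in partitions m ->
  (d <= r)%N -> (n + m <= maxn (part1 la) (part1 mu) + d + r)%N ->
  fcoef la mu (chi F d r) = fcoef la mu (chi F r r).
Proof.
move=> hr hl hm dr h.
have main k : (k <= r - d)%N -> fcoef la mu (chi F (r - k) r) = fcoef la mu (chi F r r).
  elim: k => [|k IH] hk; first by rewrite subn0.
  rewrite -IH; last exact: ltnW.
  have -> : (r - k.+1 = (r - k).-1)%N by lia.
  by symmetry; apply: coef_chiF_step => //; lia.
by rewrite -(main (r - d)%N) // subKn.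
Qed.

(** The intersection with [W F d d] discards the sets that are not [d]-placements, on which the
    inclusion matrix is trivially zero. *)
Definition ker_incl (F : fieldType) (d r : nat) : 'M[F]_N :=
  (W F d d :&: kermx (W F d r))%MS.

Lemma ker_incl_stable (F : fieldType) d r p : stablemx (ker_incl F d r) (pm F p).
Proof.
rewrite sub_capmx; apply/andP; split.
  by apply: submx_trans (submxMr _ (capmxSl _ _)) _; exact: incl_stable.
rewrite sub_kermx -mulmxA -incl_pmx mulmxA.
have /sub_kermxP -> : (ker_incl F d r <= kermx (W F d r))%MS by exact: capmxSr.
by rewrite mul0mx.
Qed.

Lemma chiF_ker (F : numFieldType) d r g h : (d <= r)%N ->
  chi F d d g h = trace_on (ker_incl F d r) (pm F (g, h)) + chi F d r g h.
Proof.
move=> dr; apply: (@trace_on_exact F N N _ _ _ _ _ (W F d r)).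
- exact: incl_stable.
- by rewrite -mulmxA -incl_pmx mulmxA.
- exact: eqmx_refl.
- by rewrite incl_mul // subnn bin0 scale1r; exact: eqmx_refl.
Qed.

(** The map from [d] to [r'] factors through [r] up to a nonzero binomial, so the kernel into [r]
    lies in the kernel into [r']; rank-nullity then applies to the map into [r] restricted to the
    latter. *)
Lemma ker_incl_exact (F : numFieldType) d r r' p : (d <= r)%N -> (r <= r')%N ->
  trace_on (ker_incl F d r') (pm F p) =
  trace_on (ker_incl F d r) (pm F p) +
  trace_on (ker_incl F d r' *m W F d r) (pm F p).
Proof.
move=> dr rr'; apply: (@trace_on_exact F N N _ _ _ _ _ (W F d r)).
- exact: ker_incl_stable.
- by rewrite -mulmxA -incl_pmx mulmxA.
- apply/eqmxP/andP; split; last first.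
    rewrite sub_capmx; apply/andP; split; last exact: capmxSr.
    by apply: submx_trans (capmxSl _ _) _; exact: capmxSl.
  rewrite !sub_capmx (capmxSl _ _) (capmxSr _ _) !andbT /=.
  have c0 : 'C(r' - d, r - d)%:R != 0 :> F.
    by rewrite pnatr_eq0 -lt0n bin_gt0 leq_sub2r.
  rewrite sub_kermx; apply/eqP; apply: (scalerI c0).
  rewrite scaler0 scalemxAr -incl_mul // mulmxA.
  have /sub_kermxP -> : (ker_incl F d r <= kermx (W F d r))%MS by exact: capmxSr.
  by rewrite mul0mx.
- exact: eqmx_refl.
Qed.

Lemma stable_character (U : 'M[algC]_N) : (forall p, stablemx U (pm algC p)) ->
  exists2 xi : 'CF([set: 'S_n * 'S_m]%g), xi \is a character &
    forall p, xi p = trace_on U (pm algC p).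
Proof.
apply: trace_on_character; [exact: setactM | exact: setact1].
Qed.

Lemma coef_stable_eq0 (U V : 'M[algC]_N) la mu :
  la \in partitions n -> mu \in partitions m ->
  (forall p, stablemx U (pm algC p)) -> (forall p, stablemx V (pm algC p)) ->
  fcoef la mu (fun g h => trace_on U (pm algC (g, h))) +
  fcoef la mu (fun g h => trace_on V (pm algC (g, h))) = 0 ->
  fcoef la mu (fun g h => trace_on U (pm algC (g, h))) = 0.
Proof.
move=> hl hm stU stV.
have [xi Nxi ex] := stable_character stU; have [xi' Nxi' ex'] := stable_character stV.
rewrite -(eq_fcoef la mu (fun g h => ex (g, h))) -(eq_fcoef la mu (fun g h => ex' (g, h))).
exact: coef_same_sign.
Qed.

Lemma coef_chiF_algC d r la mu :
  (r <= minn n m)%N -> la \in partitions n -> mu \in partitions m ->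
  (d <= r)%N -> (maxn (part1 la) (part1 mu) + d + r <= n + m)%N ->
  fcoef la mu (chi algC d r) = (common_strips la mu d)%:R.
Proof.
move=> hr hl hm dr hM.
have /partitionsP [pl sl] := hl; have /partitionsP [pm' sm] := hm.
have dnm : (d <= minn n m)%N by lia.
have split d' : (d <= d')%N -> fcoef la mu (chi algC d d) =
    fcoef la mu (fun g h => trace_on (ker_incl algC d d') (pm algC (g, h))) +
    fcoef la mu (chi algC d d').
  by move=> dd'; rewrite -fcoefD; apply: eq_fcoef => g h; exact: chiF_ker.
suff k0 : fcoef la mu (fun g h => trace_on (ker_incl algC d r) (pm algC (g, h))) = 0.
  by rewrite -(coef_chiF_diag algC dnm hl hm) (split r dr) k0 add0r.
(* The reflected degree, chosen so that [common_strips] agrees at [d] and [d']; the hypothesis on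
   [d] and [r] says precisely that it is at least [r]. *)
pose d' := (n + m - maxn (part1 la) (part1 mu) - d)%N.
have cs : common_strips la mu d = common_strips la mu d'.
  by apply: common_strips_refl; rewrite ?sl ?sm /d' //; lia.
have rd' : (r <= d')%N by rewrite /d'; lia.
case: (leqP d' (minn n m)) => hd'.
  (* The reflected degree meets the bound of [coef_chiF_top] with equality, so the image of the map
     from [d] to [d'] has multiplicity [a_d' = a_d] and nothing is left for the kernel. *)
  have kd' : fcoef la mu (fun g h => trace_on (ker_incl algC d d') (pm algC (g, h))) = 0.
    have := split d' (leq_trans dr rd').
    rewrite (coef_chiF_top _ hd' hl hm) ?(leq_trans dr rd') //; last by rewrite /d'; lia.
    rewrite !coef_chiF_diag // -cs => e.
    by apply: (addIr (common_strips la mu d)%:R); rewrite add0r -e.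
  apply: (@coef_stable_eq0 _ (ker_incl algC d d' *m W algC d r)) => //.
  - by move=> p; exact: ker_incl_stable.
  - by move=> p; rewrite -mulmxA incl_pmx mulmxA submxMr // ker_incl_stable.
  rewrite -fcoefD -[RHS]kd'; apply: eq_fcoef => g h.
  by rewrite (ker_incl_exact _ _ dr rd').
(* Here the reflected degree exceeds both sizes, so the common multiplicity is zero, and the kernel
   and image coefficients add up to zero. *)
apply: (@coef_stable_eq0 _ (W algC d r)) => //.
- by move=> p; exact: ker_incl_stable.
- by move=> p; exact: incl_stable.
rewrite -(split r dr) coef_chiF_diag // cs common_strips_large //.
by rewrite sl sm.
Qed.

(** Inclusion and permutation matrices are defined over the rationals, so these traces are rational;
    this allows passing from [algC] to [F]. *)
Lemma chiF_ratr (F : numFieldType) d r g h : chi F d r g h = ratr (chi rat d r g h).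
Proof.
rewrite /chiF -trace_on_map ?incl_stable // map_pmx; congr trace_on.
by apply/matrixP => i j; rewrite !mxE rmorph_nat.
Qed.

Lemma coef_chiF (F : numFieldType) d r la mu :
  (r <= minn n m)%N -> la \in partitions n -> mu \in partitions m ->
  (d <= r)%N -> (maxn (part1 la) (part1 mu) + d + r <= n + m)%N ->
  fcoef la mu (chi F d r) = (common_strips la mu d)%:R.
Proof.
move=> hr hl hm dr hM; have := coef_chiF_algC hr hl hm dr hM.
rewrite (eq_fcoef _ _ (@chiF_ratr algC d r)) (eq_fcoef _ _ (@chiF_ratr F d r)).
rewrite !fcoef_map -(rmorph_nat (@ratr algC)) => /fmorph_inj ->.
exact: rmorph_nat.
Qed.

End MultiplicityFormula.

(** * The graded pieces of the orbit harmonics quotient *)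

Section OrbitHarmonics.
Variables (C : numFieldType) (n m r : nat).
Notation cell := ('I_n * 'I_m)%type.
Notation N := #|{set cell}|.
Notation K := (NV n m).
Notation poly := (Defs.Poly C n m).
Notation pm p := (pmx (@setact n m) C p).
Notation W d := (@incl n m C d r).

Definition rook_point (A : {set cell}) (v : 'I_K) : C := (vpos v \in A)%:R.

Definition ev (f : poly) : 'rV[C]_N := rookvec r (fun A => meval (rook_point A) f).

Lemma rooksE (A : 'M[bool]_(n, m)) :
  (A \in rooks n m r) = rookn r [set ij | A ij.1 ij.2].
Proof.
rewrite inE /rookn andbC; congr (_ && _).
apply/andP/rookP => [[/forallP h1 /forallP h2]|[h1 h2]].
  split=> -[i j] [i' j']; rewrite !inE /= => a a' e.
    move: e a' => <- a'; congr (_, _).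
    by apply: (card_le1_eqP (h1 i)); rewrite inE.
  move: e a' => <- a'; congr (_, _).
  by apply: (card_le1_eqP (h2 j)); rewrite inE.
split; apply/forallP => i; apply/card_le1_eqP => j j'; rewrite !inE => a a'.
  have h : (i, j) \in [set ij | A ij.1 ij.2] by rewrite inE.
  have h' : (i, j') \in [set ij | A ij.1 ij.2] by rewrite inE.
  by have [] := h1 _ _ h h' erefl.
have h : (j, i) \in [set ij | A ij.1 ij.2] by rewrite inE.
have h' : (j', i) \in [set ij | A ij.1 ij.2] by rewrite inE.
by have [] := h2 _ _ h h' erefl.
Qed.

Lemma inIP (f : poly) : inI r f <-> ev f = 0.
Proof.
split=> [h|h A rA].
  apply/rowP => j; rewrite !mxE; case: (boolP (rookn _ _)) => rj; last by rewrite mul0r.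
  rewrite mul1r -(h (\matrix_(i, k) ((i, k) \in enum_val j))).
    apply: meval_eq => v; rewrite /rook_point /pt mxE -surjective_pairing.
    by [].
  rewrite rooksE (_ : [set ij | _] = enum_val j) //; apply/setP => c.
  by rewrite inE mxE -surjective_pairing.
have /rowP /(_ (enum_rank [set ij | A ij.1 ij.2])) := h.
rewrite !mxE enum_rankK -rooksE rA mul1r => <-.
by apply: meval_eq => v; rewrite /rook_point /pt inE.
Qed.

Lemma evD f g : ev (f + g) = ev f + ev g.
Proof. by apply/rowP => j; rewrite !mxE mevalD mulrDr. Qed.

Lemma evZ c f : ev (c *: f) = c *: ev f.
Proof. by apply/rowP => j; rewrite !mxE mevalZ mulrCA. Qed.

Lemma ev0 : ev 0 = 0.
Proof. by rewrite -(scale0r 0) evZ scale0r. Qed.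

Lemma evB f g : ev (f - g) = ev f - ev g.
Proof. by rewrite -scaleN1r evD evZ scaleN1r. Qed.

Lemma ev_sum (I : Type) (s : seq I) (P : pred I) (f : I -> poly) :
  ev (\sum_(i <- s | P i) f i) = \sum_(i <- s | P i) ev (f i).
Proof. exact: (big_morph ev evD ev0). Qed.

Definition cells (t : 'X_{1..K}) : {set cell} := [set c | t (enum_rank c) != 0%N].

Lemma card_cells_mdeg t : (#|cells t| <= mdeg t)%N.
Proof.
rewrite -sum1_card mdegE (reindex _ (onW_bij _ (enum_rank_bij cell))) /=.
rewrite big_mkcond; apply: leq_sum => c _; rewrite inE.
by case: eqP => //= /eqP; rewrite lt0n.
Qed.

(** Coordinates of a placement are 0 or 1, so the sizes of positive exponents do not affect the
    value and a monomial becomes the indicator of its support. *)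
Lemma meval_rook_point A t : meval (rook_point A) 'X_[t] = (cells t \subset A)%:R.
Proof.
rewrite mevalX; case: (boolP (cells t \subset A)) => [/subsetP s|].
  rewrite big1 // => v _; rewrite /rook_point.
  case: (eqVneq (t v) 0%N) => [->|tv]; first by rewrite expr0.
  by rewrite s ?expr1n // inE enum_valK.
case/subsetPn => c; rewrite inE => tc cA; rewrite (bigD1 (enum_rank c)) //=.
by rewrite /rook_point /vpos enum_rankK (negbTE cA) expr0n (negbTE tc) mul0r.
Qed.

Definition deglt (d : nat) (f : poly) : Prop :=
  forall t, (d <= mdeg t)%N -> f@_t = 0.

(** The values taken on placements by polynomials of degree strictly less than [d], hence the shift
    by one. The cap is essential: [W k] is zero for [k > r], whereas from degree [r] on all
    functions occur. *)
Definition filt (d : nat) : 'M[C]_N := if d is k.+1 then W (minn k r) else 0.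

Lemma rookvec_full phi : (rookvec r phi <= W r)%MS.
Proof.
suff -> : rookvec r phi = rookvec r phi *m W r by exact: submxMl.
apply/rowP => j; rewrite !mxE incl_dmx (bigD1 j) //= big1 => [|k kj].
  by rewrite !mxE eqxx addr0 mulrAC -natrM mulnb andbb.
by rewrite !mxE (negbTE kj) mulr0.
Qed.

Lemma ev_filt d f : deglt d f -> (ev f <= filt d)%MS.
Proof.
case: d => [|k] h.
  have -> : f = 0 by apply/mpolyP => t; rewrite h ?mcoeff0.
  by rewrite ev0 sub0mx.
rewrite /filt; case: (leqP k r) => kr; last first.
  exact: rookvec_full.
apply: rookvec_degle => //.
exists [seq (f@_t, cells t) | t <- msupp f]; split.
  apply/allP => _ /mapP [t tf ->] /=; apply: leq_trans (card_cells_mdeg t) _.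
  rewrite leqNgt; apply/negP => kt.
  by move: tf; rewrite mcoeff_msupp h ?eqxx.
move=> A; rewrite mevalE [RHS]big_map /=; apply: eq_bigr => t _.
by rewrite -mevalX meval_rook_point.
Qed.

Definition mset (Q : {set cell}) : 'X_{1..K} :=
  [multinom (vpos v \in Q : nat) | v < K].

Lemma cells_mset Q : cells (mset Q) = Q.
Proof.
by apply/setP => c; rewrite inE mnmE /vpos enum_rankK; case: (c \in Q).
Qed.

Lemma mdeg_mset Q : mdeg (mset Q) = #|Q|.
Proof.
rewrite mdegE -sum1_card (reindex _ (onW_bij _ (enum_rank_bij cell))) /=.
rewrite [RHS]big_mkcond; apply: eq_bigr => c _.
by rewrite mnmE /vpos enum_rankK; case: (c \in Q).
Qed.

Lemma ev_mset k Q : rookn k Q -> ev 'X_[mset Q] = row (enum_rank Q) (W k).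
Proof.
move=> rQ; apply/rowP => j; rewrite !mxE enum_rankK rQ /= meval_rook_point cells_mset.
by rewrite -natrM mulnb.
Qed.

Lemma filt_ev d (v : 'rV_N) : (v <= filt d)%MS ->
  exists2 f, deglt d f & ev f = v.
Proof.
case: d => [|k] /=.
  by rewrite submx0 => /eqP ->; exists 0 => [t _|]; rewrite ?mcoeff0 ?ev0.
set l := minn k r => /submxP [u ->].
exists (\sum_(i < N | rookn l (enum_val i)) u 0 i *: 'X_[mset (enum_val i)]).
  move=> t kt; rewrite raddf_sum big1 //= => i /andP[_ /eqP ci].
  rewrite mcoeffZ mcoeffX (_ : (_ == t) = false) ?mulr0 //.
  by apply: contraTF kt => /eqP <-; rewrite mdeg_mset ci -leqNgt geq_minl.
rewrite ev_sum mulmx_sum_row [RHS](bigID (fun i => rookn l (enum_val i))) /=.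
rewrite [X in _ = _ + X]big1 ?addr0 => [|i ri]; last first.
  rewrite (_ : row i _ = 0) ?scaler0 //; apply/rowP => j.
  by rewrite !mxE (negbTE ri).
by apply: eq_bigr => i ri; rewrite evZ (ev_mset ri) enum_valK.
Qed.

Section Degree.
Variable d : nat.
Notation D := (Dim K d).
Notation mon i := (nth 0%MM (mons K d) i).

Lemma mem_mons t : (t \in mons K d) = (mdeg t == d).
Proof.
apply/mapP/idP => [[u + ->]|td]; first by rewrite mem_filter => /andP[].
have h : (mdeg t < d.+1)%N by rewrite (eqP td).
by exists (BMultinom h) => //; rewrite mem_filter td mem_enum.
Qed.

Lemma mons_uniq : uniq (mons K d).
Proof.
rewrite map_inj_uniq; last exact: val_inj.
by rewrite filter_uniq ?enum_uniq.
Qed.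

Lemma mon_mdeg (i : 'I_D) : mdeg (mon i) = d.
Proof. by apply/eqP; rewrite -mem_mons mem_nth. Qed.

Lemma mon_inj (i j : 'I_D) : (mon i == mon j) = (i == j).
Proof. by rewrite nth_uniq ?mons_uniq. Qed.

Lemma mon_index t : mdeg t = d -> exists i : 'I_D, mon i = t.
Proof.
move=> td; have h : t \in mons K d by rewrite mem_mons td.
have hi : (index t (mons K d) < D)%N by rewrite index_mem.
by exists (Ordinal hi); rewrite /= nth_index.
Qed.

Definition evmx : 'M[C]_(D, N) := \matrix_i ev 'X_[mon i].

Definition vecpoly (v : 'rV[C]_D) : poly := \sum_i v 0 i *: 'X_[mon i].

Lemma ev_vecpoly v : ev (vecpoly v) = v *m evmx.
Proof.
rewrite /vecpoly ev_sum mulmx_sum_row; apply: eq_bigr => i _.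
by rewrite evZ rowK.
Qed.

Lemma vecpoly_homog v : vecpoly v \is d.-homog.
Proof.
apply: rpred_sum => i _; apply: rpredZ; rewrite dhomogX; apply/eqP.
exact: mon_mdeg.
Qed.

Lemma coords_vecpoly v : coords d (vecpoly v) = v.
Proof.
apply/rowP => i; rewrite mxE raddf_sum (bigD1 i) //= big1 => [|j ji].
  by rewrite mcoeffZ mcoeffX eqxx mulr1 addr0.
by rewrite mcoeffZ mcoeffX mon_inj (negbTE ji) mulr0.
Qed.

Lemma vecpoly_coords f : f \is d.-homog -> vecpoly (coords d f) = f.
Proof.
move=> hf; apply/mpolyP => t; rewrite raddf_sum /=.
case: (eqVneq (mdeg t) d) => [/mon_index [i <-]|td].
  rewrite (bigD1 i) //= big1 => [|j ji].
    by rewrite mcoeffZ mcoeffX eqxx mulr1 addr0 mxE.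
  by rewrite mcoeffZ mcoeffX mon_inj (negbTE ji) mulr0.
rewrite (dhomog_nemf_coeff hf td) big1 // => i _.
rewrite mcoeffZ mcoeffX; case: eqP => [e|_]; last by rewrite mulr0.
by move: td; rewrite -e mon_mdeg eqxx.
Qed.

Definition pre_filt : 'M[C]_D := kermx (evmx *m cokermx (filt d)).

Lemma pre_filtP k (v : 'M_(k, D)) : (v <= pre_filt)%MS = (v *m evmx <= filt d)%MS.
Proof. by rewrite sub_kermx mulmxA submxE. Qed.

Lemma topc_coef (g : poly) t :
  (topc g)@_t = if mdeg t == (msize g).-1 then g@_t else 0.
Proof.
rewrite /topc raddf_sum /=; case: (boolP (t \in msupp g)) => tg; last first.
  rewrite (memN_msupp_eq0 tg) if_same big_seq_cond big1 // => u /andP[ug _].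
  rewrite mcoeffZ mcoeffX; case: eqP => [e|_]; last by rewrite mulr0.
  by rewrite -e ug in tg.
rewrite big_mkcond (bigD1_seq t) ?msupp_uniq //= big1 => [|u ut].
  by rewrite addr0; case: ifP => // _; rewrite mcoeffZ mcoeffX eqxx mulr1.
by case: ifP => // _; rewrite mcoeffZ mcoeffX (negbTE ut) mulr0.
Qed.

Lemma topc_homog (g : poly) : topc g \is (msize g).-1.-homog.
Proof.
apply/dhomogP => t; rewrite mcoeff_msupp topc_coef.
by case: ifP => [/eqP //|_]; rewrite eqxx.
Qed.

(** Since [g] vanishes on placements, ['X_[t] * topc g] agrees there with [- 'X_[t] * (g - topc g)],
    whose degree is below [d]. *)
Lemma ev_top_mul (g : poly) t : inI r g -> (mdeg t + (msize g).-1)%N = d ->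
  (ev ('X_[t] * topc g)%R <= filt d)%MS.
Proof.
move=> Ig td.
have e0 : ev ('X_[t] * g) = 0.
  move/inIP: Ig => Ig; apply/inIP => A rA; rewrite mevalM.
  by move/inIP: Ig => ->; rewrite ?mulr0.
have -> : 'X_[t] * topc g = 'X_[t] * g - 'X_[t] * (g - topc g).
  by rewrite mulrBr opprB addrCA subrr addr0.
rewrite evB e0 sub0r eqmx_opp; apply: ev_filt => u du.
rewrite mulrC mcoeffMXif; case: ifP => // tu.
have eu : mdeg (u - t) = (mdeg u - mdeg t)%N.
  by have := congr1 mdeg (submK tu); rewrite mdegD; lia.
rewrite mcoeffB topc_coef; case: eqP => [_|ne]; first by rewrite subrr.
rewrite subr0; apply: memN_msupp_eq0; apply: msize_mdeg_ge.
move: ne td du; rewrite eu; move: (mdeg u) (mdeg t) (msize g) => a b c.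
by lia.
Qed.

Lemma in_grI_filt (f : poly) : in_grI r f -> f \is d.-homog -> (ev f <= filt d)%MS.
Proof.
(* A homogeneous [f] equals the degree [d] component of the combination; after expanding the
   cofactors into monomials only the products of degree exactly [d] contribute. *)
move=> [s [hs fE]] hf; rewrite -(pihomog_dE hf) fE raddf_sum /=.
elim: s hs {fE} => [|q s IH] hs; first by rewrite big_nil ev0 sub0mx.
rewrite big_cons evD addmx_sub //; last by apply: IH => q' hq'; apply: hs; right.
have [g [Ig [_ ->]]] := hs q (or_introl erefl).
rewrite (mpolyE q.1) mulr_suml raddf_sum ev_sum summx_sub // => t _.
rewrite -scalerAl /= linearZ /= evZ scalemx_sub //=.
have hX : 'X_[t] * topc g \is (mdeg t + (msize g).-1).-homog.
  by apply: dhomogM; rewrite ?dhomogX ?topc_homog.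
case: (eqVneq (mdeg t + (msize g).-1)%N d) => [td|td].
  by rewrite pihomog_dE -?td // td; exact: ev_top_mul.
by rewrite (pihomog_ne0 td hX) ev0 sub0mx.
Qed.

(** Take [g] of degree below [d] with the same values as [f]: then [f - g] vanishes on placements
    and its top component is [f]. *)
Lemma filt_in_grI (f : poly) : f \is d.-homog -> (ev f <= filt d)%MS -> in_grI r f.
Proof.
move=> hf /filt_ev [g dg eg].
have [->|f0] := eqVneq f 0; first by exists [::]; split => //; rewrite big_nil.
have [t tf] : exists t, f@_t != 0.
  case E : (msupp f) => [|t s]; first by move/eqP: E; rewrite msupp_eq0 (negbTE f0).
  by exists t; rewrite -mcoeff_msupp E mem_head.
have td : mdeg t = d by apply: (dhomog_mf hf); rewrite mcoeff_msupp.
have ht : (f - g)@_t != 0 by rewrite mcoeffB (dg t) ?subr0 // td.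
have sz : (msize (f - g)).-1 = d.
  apply/eqP; rewrite eqn_leq; apply/andP; split; last first.
    by have := msize_mdeg_lt (p := f - g) (m := t); rewrite mcoeff_msupp ht td => /(_ isT); lia.
  suff: (msize (f - g) <= d.+1)%N by case: (msize _).
  rewrite msizeE.
  apply/bigmax_leqP_seq => u; rewrite mcoeff_msupp mcoeffB => hu _; rewrite ltnS leqNgt.
  apply/negP => du; move: hu; rewrite (dg u) ?(ltnW du) // subr0.
  have nu : mdeg u != d by rewrite neq_ltn du orbT.
  by rewrite (dhomog_nemf_coeff hf nu) eqxx.
exists [:: (1, f)]; split; last by rewrite big_seq1 mul1r.
move=> q [<-|//]; exists (f - g); split; first by apply/inIP; rewrite evB eg subrr.
split; first by apply: contraNneq ht => ->; rewrite mcoeff0.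
apply/mpolyP => u; rewrite topc_coef sz /= mcoeffB.
case: (eqVneq (mdeg u) d) => hu; first by rewrite (dg u) ?subr0 // hu.
exact: dhomog_nemf_coeff hf hu.
Qed.

(** [spanP] is chosen by [epsilon]. The vectors to be spanned are exactly those of [pre_filt], so a
    span exists and has this row space. *)
Lemma grI_dE : (grI_d C n m r d :=: pre_filt)%MS.
Proof.
pose S (v : 'rV[C]_D) := exists f : poly,
   [/\ in_grI r f, f \is [in C[K], d.-homog] & v = coords d f].
have SP v : S v <-> (v <= pre_filt)%MS.
  rewrite pre_filtP -ev_vecpoly; split.
    by move=> [f [If hf ->]]; rewrite vecpoly_coords //; exact: in_grI_filt.
  move=> h; exists (vecpoly v); split; last by rewrite coords_vecpoly.
    exact: filt_in_grI (vecpoly_homog v) h.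
  exact: vecpoly_homog.
have ex : exists U : 'M[C]_D, (forall v, S v -> (v <= U)%MS) /\
    (forall U' : 'M[C]_D, (forall v, S v -> (v <= U')%MS) -> (U <= U')%MS).
  exists pre_filt; split => [v /SP //|U' hU']; apply/row_subP => i; apply/hU'/SP.
  exact: row_sub.
have [h1 h2] := epsilon_spec (inhabits 0) _ ex.
apply/eqmxP/andP; split.
  by apply: h2 => v /SP.
by apply/row_subP => i; apply/h1/SP; exact: row_sub.
Qed.

Lemma sigv_enum_rank (g : 'S_n) (h : 'S_m) c :
  sigv g h (enum_rank c) = enum_rank (cellmap (g, h) c).
Proof. by rewrite /sigv /vidx /vpos enum_rankK. Qed.

Lemma cells_actm g h (t : 'X_{1..K}) : cells (Defs.actm g h t) = setact (cells t) (g, h).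
Proof.
apply/setP => c; have -> : c = cellmap (g, h) (cellmap (g^-1, h^-1)%g c).
  by case: c => i j; rewrite /cellmap /= !permKV.
rewrite mem_setact !inE mnmE sigv_enum_rank /cellmap /= !permK.
by [].
Qed.

Lemma mdeg_actm g h (t : 'X_{1..K}) : mdeg (Defs.actm g h t) = mdeg t.
Proof.
have si : injective (@sigv n m g^-1 h^-1).
  move=> v v'; rewrite -[v]enum_valK -[v']enum_valK !sigv_enum_rank.
  by move=> /enum_rank_inj /cellmap_inj ->.
rewrite !mdegE [RHS](reindex_inj si); apply: eq_bigr => v _.
by rewrite mnmE.
Qed.

Lemma actmx_ev g h : actmx C d g h *m evmx = evmx *m pm (g, h).
Proof.
apply/matrixP => i j; rewrite !mxE.
have [k ek] := mon_index (etrans (mdeg_actm g h (mon i)) (mon_mdeg i)).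
rewrite (bigD1 k) //= big1 => [|l lk]; last first.
  by rewrite mxE -ek mon_inj eq_sym (negbTE lk) mul0r.
rewrite !mxE ek eqxx mul1r addr0 meval_rook_point cells_actm.
rewrite (@sum_enum_rank _ _ _ (setact (enum_val j) (g, h)^-1%g)) => [|l hl]; last first.
  rewrite !mxE (_ : (_ == enum_val j) = false) ?mulr0 //.
  by apply: contraNF hl => /eqP <-; rewrite -setactM mulgV setact1 enum_valK.
rewrite !mxE enum_rankK -setactM mulVg setact1 eqxx mulr1 meval_rook_point.
by rewrite rookn_setact -(setact_sub (cells _) _ (g, h)) -setactM mulVg setact1.
Qed.

Lemma filt_stable k p : stablemx (filt k) (pm p).
Proof. by case: k => [|k]; rewrite ?mul0mx ?sub0mx // incl_stable. Qed.

(** Rank-nullity for evaluation, once on all forms of degree [d] and once on [pre_filt]: the kernel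
    is the same in both cases and cancels in the difference. *)
Lemma chiR_filt g h : chiR C r d g h =
  trace_on <<evmx>>%MS (pm (g, h)) - trace_on (<<evmx>> :&: filt d)%MS (pm (g, h)).
Proof.
have stX : stablemx pre_filt (actmx C d g h).
  rewrite pre_filtP -mulmxA actmx_ev mulmxA.
  have h1 : (pre_filt *m evmx <= filt d)%MS by rewrite -pre_filtP.
  exact: submx_trans (submxMr _ h1) (filt_stable _ _).
have stG : stablemx (grI_d C n m r d) (actmx C d g h).
  by rewrite (eqmxMr _ grI_dE) grI_dE.
rewrite /chiR (trace_on_eqmx stG grI_dE).
have e1 : trace_on 1%:M (actmx C d g h) = \tr (actmx C d g h).
  by rewrite trace_on_idem ?mul1mx ?submx1.
have st1 : stablemx 1%:M (actmx C d g h) by rewrite submx1.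
have x1 : trace_on 1%:M (actmx C d g h) =
    trace_on (kermx evmx) (actmx C d g h) + trace_on <<evmx>>%MS (pm (g, h)).
  apply: (trace_on_exact (E := evmx) st1).
  - by rewrite !mul1mx actmx_ev.
  - by apply/eqmxP; rewrite sub_capmx submx1 submx_refl capmxSr.
  - by rewrite mul1mx; exact: genmxE.
have x2 : trace_on pre_filt (actmx C d g h) =
    trace_on (kermx evmx) (actmx C d g h) +
    trace_on (<<evmx>> :&: filt d)%MS (pm (g, h)).
  apply: (trace_on_exact (E := evmx) stX).
  - by rewrite -mulmxA actmx_ev mulmxA.
  - apply/eqmxP/andP; split; last exact: capmxSr.
    rewrite sub_capmx submx_refl andbT pre_filtP.
    by have /sub_kermxP -> := submx_refl (kermx evmx); rewrite sub0mx.
  - apply/eqmxP/andP; split; last first.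
      by rewrite sub_capmx genmxE submxMl -pre_filtP submx_refl.
    apply/rV_subP => v; rewrite sub_capmx genmxE => /andP[/submxP [u ->] hu].
    by apply: submxMr; rewrite pre_filtP.
by rewrite -e1 x1 x2 opprD addrACA subrr add0r.
Qed.

Lemma evmx_incl : (d <= r)%N -> (<<evmx>> :=: W d)%MS.
Proof.
move=> dr; apply: eqmx_trans (genmxE _) _; apply/eqmxP/andP; split.
  apply/row_subP => i; rewrite rowK.
  have := @ev_filt d.+1 'X_[mon i]; rewrite /filt (minn_idPl dr); apply => t dt.
  by rewrite mcoeffX; case: eqP dt => // <-; rewrite mon_mdeg ltnn.
apply/row_subP => i; case: (boolP (rookn d (enum_val i))) => ri; last first.
  rewrite (_ : row i _ = 0) ?sub0mx //; apply/rowP => j.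
  by rewrite !mxE (negbTE ri).
have := ev_mset ri; rewrite enum_valK => <-.
have [k <-] : exists k : 'I_D, mon k = mset (enum_val i).
  by apply: mon_index; rewrite mdeg_mset; case/andP: ri => _ /eqP.
by have := row_sub k evmx; rewrite rowK.
Qed.

End Degree.

(** For [d > r] all functions on placements already come from degree below [d], so the quotient is
    zero; otherwise evaluation of forms of degree [d] has image [W d], which contains the preceding
    step. *)
Lemma chiR_chiF d (g : 'S_n) (h : 'S_m) : chiR C r d g h =
  if (d <= r)%N then
    @chiF n m C d r g h - (if d is k.+1 then @chiF n m C k r g h else 0)
  else 0.
Proof.
rewrite chiR_filt; case: (leqP d r) => dr.
  have stE : stablemx <<evmx d>>%MS (pm (g, h)).
    by rewrite (eqmxMr _ (evmx_incl dr)) (evmx_incl dr) incl_stable.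
  rewrite (trace_on_eqmx stE (evmx_incl dr)); congr (_ - _).
  have eqc : (<<evmx d>> :&: filt d :=: filt d)%MS.
    apply/capmx_idPr; rewrite (evmx_incl dr); case: d dr {stE} => [|k] kr /=.
      exact: sub0mx.
    by rewrite (minn_idPl (ltnW kr)) incl_mono // ltnW.
  rewrite (trace_on_eqmx _ eqc).
    case: d dr {stE eqc} => [|k] kr /=; first by rewrite trace_on0.
    by rewrite (minn_idPl (ltnW kr)).
  by rewrite (eqmxMr _ eqc) eqc filt_stable.
have eqc : (<<evmx d>> :&: filt d :=: <<evmx d>>)%MS.
  apply/capmx_idPl; rewrite genmxE; apply/row_subP => i; rewrite rowK.
  by case: d dr i => // k kr i; rewrite /filt (minn_idPr (kr : (r <= k)%N)); exact: rookvec_full.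
rewrite (trace_on_eqmx _ eqc) ?subrr //.
rewrite (eqmxMr _ eqc) eqc (eqmxMr _ (genmxE _)) genmxE -actmx_ev.
exact: submxMl.
Qed.

End OrbitHarmonics.

(** * Comparison of coefficients *)

Lemma part1_le n la : la \in partitions n -> (part1 la <= n)%N.
Proof. by case/partitionsP => _ <-; rewrite /part1 -nth0 nth_le_sumn. Qed.

Definition strips_prev (la mu : seq nat) (d : nat) : nat :=
  if d is k.+1 then common_strips la mu k else 0%N.

(** [schur_coef] is also chosen by [epsilon]; exhibiting one expansion and invoking uniqueness
    determines its values. *)
Lemma schur_coef_SF (C : numFieldType) n m d la mu : (d <= minn n m)%N ->
  la \in partitions n -> mu \in partitions m ->
  schur_coef (SF C n m d - SFprev C n m d) la mu =
  (common_strips la mu d)%:R - (strips_prev la mu d)%:R.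
Proof.
move=> hd hl hm.
pose c la mu : C := (common_strips la mu d)%:R - (strips_prev la mu d)%:R.
have ex : schur_expansion (SF C n m d - SFprev C n m d) c.
  rewrite /schur_expansion /c SF_expand //.
  have -> : SFprev C n m d = \sum_(la <- partitions n) \sum_(mu <- partitions m)
     (strips_prev la mu d)%:R *: (schur (@xv C n m) la * schur (@yv C n m) mu).
    case: d hd {c} => [|k] hk; last by rewrite -SF_expand //; lia.
    by rewrite big1 // => l _; rewrite big1 // => k _; rewrite scale0r.
  rewrite -sumrB; apply: eq_bigr => l _; rewrite -sumrB; apply: eq_bigr => k _.
  by rewrite scalerBl.
have := epsilon_spec (inhabits (fun _ _ => 0)) _ (ex_intro _ c ex).
rewrite -/(schur_coef _) {1}ex => e.
by have := schur_pair_unique (esym e) hl hm.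
Qed.

(** Inside the truncation range both steps of the filtration have their full multiplicities; outside
    it [coef_chiF_step] makes the two multiplicities equal and the difference vanishes. *)
Lemma coef_chiR (C : numFieldType) n m r d la mu : (d <= r)%N ->
  (r <= minn n m)%N -> la \in partitions n -> mu \in partitions m ->
  fcoef la mu (fun (g : 'S_n) (h : 'S_m) => chiR C r d g h) =
  if (part1 la <= n + m - d - r)%N && (part1 mu <= n + m - d - r)%N then
    (common_strips la mu d)%:R - (strips_prev la mu d)%:R else 0.
Proof.
move=> dr hr hl hm; have l1 := part1_le hl; have m1 := part1_le hm.
rewrite (@eq_fcoef n m C la mu _ (fun g h => @chiF n m C d r g h +
   - (if d is k.+1 then @chiF n m C k r g h else 0))); last first.
  by move=> g h; rewrite chiR_chiF dr.
rewrite fcoefD fcoefN.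
(* The truncated subtraction is harmless because [d + r <= n + m]. *)
have -> : ((part1 la <= n + m - d - r) && (part1 mu <= n + m - d - r))%N =
    (maxn (part1 la) (part1 mu) + d + r <= n + m)%N by lia.
case: d dr => [|k] kr /=.
  rewrite fcoef0 subr0 subr0.
  (* In degree 0 the truncation is vacuous: first parts are at most [max(n, m)] and [r] is at most
     [min(n, m)]. *)
  have hM : (maxn (part1 la) (part1 mu) + 0 + r <= n + m)%N by lia.
  by rewrite hM coef_chiF.
case: leqP => hM.
  by rewrite !coef_chiF //; lia.
by rewrite (@coef_chiF_step n m C k.+1 r) //= ?subrr.
Qed.

Theorem mainTheorem12 (C : numClosedFieldType) (n m r : nat) :
  (0 < n)%N -> (0 < m)%N -> (r <= minn n m)%N ->
  forall d : nat,
    FrobR C n m r d =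
    (if (d <= r)%N
     then trunc (n + m - d - r) (SF C n m d - SFprev C n m d)
     else 0).
Proof.
move=> _ _ hr d; rewrite /FrobR Frob_coef; case: (leqP d r) => dr; last first.
  rewrite big1 // => la _; rewrite big1 // => mu _.
  rewrite (@eq_fcoef n m C la mu _ (fun _ _ => 0)) ?fcoef0 ?scale0r // => g h.
  by rewrite chiR_chiF leqNgt dr.
rewrite /trunc big_seq [RHS]big_seq; apply: eq_bigr => la hl.
rewrite [RHS]big_mkcond big_seq [RHS]big_seq; apply: eq_bigr => mu hm.
rewrite coef_chiR // schur_coef_SF //; last by lia.
by case: ifP => // _; rewrite scale0r.
Qed.
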